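(* Let $\Gamma$ be a finite ranked poset and $A'_\Gamma$ the associated graded algebra of its splitting algebra with respect to the rank filtration. Then: (1) $A'_\Gamma$ is quadratic if and only if $\Gamma$ is uniform; (2) $A'_\Gamma$ is Koszul if and only if $\Gamma$ is Cohen–Macaulay.
   Context: Fix a field $\mathbb{F}$. A finite ranked poset is a finite poset $\Gamma$ (strict order $<$) with a unique minimal element $*$ such that for every $x\in\Gamma$ all maximal chains in $[*,x]$ have the same length, denoted $rk(x)$. For $y<x$ put $d(x,y)=rk(x)-rk(y)$; $x$ covers $y$ ($x\to y$) if $y<x$ and $d(x,y)=1$; these pairs are the edges. Let $W$ be the $\mathbb{F}$-vector space with basis the edges and $T(W)$ the free associative algebra on $W$. For $a<b$ let $\Pi(b,a)$ be the set of paths $b=c_0\to c_1\to\cdots\to c_n=a$ ($n=d(b,a)$); for such a path $\pi$ with edges $e_1,\dots,e_n$ define $e(\pi,j)$ by $(s-e_1)\cdots(s-e_n)=\sum_{j=0}^n e(\pi,j)s^{n-j}$ with $s$ a central indeterminate. The splitting algebra $A_\Gamma=T(W)/I$, $I$ generated by all $e(\pi,j)-e(\pi',j)$ with $a<b$, $\pi,\pi'\in\Pi(b,a)$, $0\le j\le d(b,a)$; it is graded with edges in degree 1. An edge $x\to y$ has rank $rk(x)$; $F^nA_\Gamma$ is the span of images of products of edges $e_1\cdots e_r$ with $\sum rk(e_i)\le n$, and $A'_\Gamma=\bigoplus_n F^nA_\Gamma/F^{n-1}A_\Gamma$ is the associated graded algebra, graded by the degree inherited from $A_\Gamma$. For $x\in\Gamma$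 let $S_x(1)=\{a\in\Gamma: x\to a\}$. For $a,b\in S_x(1)$ write $a\sim_x b$ if some $c$ is covered by both $a$ and $b$, and extend $\sim_x$ to the equivalence relation it generates on $S_x(1)$. $\Gamma$ is uniform if for every $x\neq *$ in $\Gamma$ the relation $\sim_x$ has exactly one equivalence class. For a finite poset $P$, $\Delta(P)$ is its order complex (simplices are nonempty chains), and reduced cohomology has coefficients in $\mathbb{F}$, with $\tilde H^{-1}(\Delta(\emptyset))=\mathbb{F}$. $\Gamma$ is Cohen–Macaulay if for all $a<b$ in $\Gamma$, $\tilde H^n(\Delta((a,b)))\neq 0$ implies $n=\dim\Delta((a,b))$, where $(a,b)$ is the open interval. *)

(* Defs.v *)
From HB Require Import structures.
From mathcomp Require Import all_boot all_order all_algebra.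
Set Implicit Arguments. Unset Strict Implicit. Unset Printing Implicit Defensive.
Import GRing.Theory.
Local Open Scope ring_scope.

(* Finite ranked posets.  The poset is a finite type T with a strict   *)
(* order lt; star is its unique minimal element.                        *)
Section Poset.
Variables (T : finType) (lt : rel T) (star : T).

Definition ple (x y : T) : bool := (x == y) || lt x y.

Definition is_chain (C : {set T}) : bool :=
  [forall x in C, forall y in C, ple x y || ple y x].

Definition cint (x : T) : {set T} := [set z | ple star z && ple z x].

Definition maxchain (x : T) (C : {set T}) : bool :=
  [&& is_chain C, C \subset cint x &
      [forall C' : {set T},
         [&& is_chain C', C' \subset cint x & C \subset C'] ==> (C' == C)]].

Definition minimal (m : T) : Prop := forall y, ~~ lt y m.

Definition ranked : Prop :=
  forall x C1 C2, maxchain x C1 -> maxchain x C2 -> #|C1| = #|C2|.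

Definition rk (x : T) : nat := \max_(C : {set T} | maxchain x C) (#|C|).-1.

Definition covers (x y : T) : bool := lt y x && (rk x == (rk y).+1).

Definition edge : finType := {p : T * T | covers p.1 p.2}.
Definition esrc (e : edge) : T := (val e).1.
Definition etgt (e : edge) : T := (val e).2.
Definition erk (e : edge) : nat := rk (esrc e).

Fixpoint epath (b a : T) (s : seq edge) : bool :=
  if s is e :: s' then (esrc e == b) && epath (etgt e) a s' else b == a.

Definition S1 (x : T) : {set T} := [set a | covers x a].
Definition simrel (x : T) : rel T := fun a b =>
  [&& a \in S1 x, b \in S1 x & [exists c, covers a c && covers b c]].
(* for x <> star, the equivalence relation generated by ~_x on S_x(1)
   (= connect (simrel x), simrel x being symmetric) has exactly one class *)
Definition uniform : Prop :=
  forall x, x != star ->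
    exists2 a, a \in S1 x &
      forall a' b', a' \in S1 x -> b' \in S1 x -> connect (simrel x) a' b'.

End Poset.

Section Span.
Variables (F : fieldType) (X : Type).
Inductive inspan (P : (X -> F) -> Prop) : (X -> F) -> Prop :=
| inspan0 : inspan P (fun _ => 0)
| inspan_gen f : P f -> inspan P f
| inspan_add f g : inspan P f -> inspan P g -> inspan P (fun w => f w + g w)
| inspan_scale (c : F) f : inspan P f -> inspan P (fun w => c * f w).
End Span.

Section OrderComplex.
Variables (F : fieldType) (T : finType) (lt : rel T).

Definition oint (a b : T) : {set T} := [set z | lt a z && lt z b].
(* simplices of Delta((a,b)) together with the empty simplex (augmentation) *)
Definition ochain (a b : T) (C : {set T}) : bool :=
  is_chain lt C && (C \subset oint a b).

(* augmented (reduced) simplicial coboundary; vertices of a chain are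
   ordered by lt, so the position of v in C is #{u in C | u < v} *)
Definition cobd (g : {set T} -> F) (C : {set T}) : F :=
  \sum_(v in C) (-1) ^+ #|[set u in C | lt u v]| * g (C :\ v).

(* reduced cohomology  H~^(m-1)(Delta((a,b)); F) vanishes
   (cochains in degree m-1 = functions on chains of cardinality m) *)
Definition hvan (a b : T) (m : nat) : Prop :=
  forall f : {set T} -> F,
    (forall C, ochain a b C -> #|C| = m.+1 -> cobd f C = 0) ->
    exists g : {set T} -> F,
      forall C, ochain a b C -> #|C| = m -> f C = cobd g C.

(* dim Delta((a,b)) + 1  (= 0 when the interval is empty) *)
Definition dimplus (a b : T) : nat := \max_(C : {set T} | ochain a b C) #|C|.

(* Cohen-Macaulay: H~^n(Delta((a,b))) <> 0 implies n = dim Delta((a,b)),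
   written with n = m - 1 *)
Definition cohen_macaulay : Prop :=
  forall a b, lt a b -> forall m : nat, ~ hvan a b m -> m = dimplus a b.

End OrderComplex.

(* Elements of T(W) are represented as functions  seq edge -> F        *)
(* (coefficient of each word); only finitely supported ones arise.     *)
Section Splitting.
Variables (F : fieldType) (T : finType) (lt : rel T) (star : T).

Local Notation E := (edge lt star).
Local Notation TW := (seq E -> F).

Definition mono (w : seq E) : TW := fun w' => (w' == w)%:R.

Definition tmul (x y : TW) : TW :=
  fun w => \sum_(k < (size w).+1) x (take k w) * y (drop k w).

(* e(pi, j) for the path with edge sequence s: the coefficient of
   s^(n-j) in (s - e_1)...(s - e_n), i.e. (-1)^j times the sum of the
   ordered products e_{i1}...e_{ij}, i1 < ... < ij *)
Definition esym (s : seq E) (j : nat) : TW := fun w =>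
  if size w == j then
    (-1) ^+ j * #|[set m : (size s).-tuple bool | mask m s == w]|%:R
  else 0.

Definition relgen (r : TW) : Prop :=
  exists (a b : T) (s s' : seq E) (j : nat),
    [/\ lt a b, epath b a s, epath b a s', (j <= size s)%N &
        r = (fun w => esym s j w - esym s' j w)].

Definition Iset : TW -> Prop :=
  inspan (fun y => exists (u v : seq E) (r : TW),
                     relgen r /\ y = tmul (tmul (mono u) r) (mono v)).

Definition wt (w : seq E) : nat := \sum_(e <- w) erk e.

(* y lies in the preimage in T(W) of F^(n-1) A_Gamma, i.e. in
   I + span{ words w : wt w <= n-1 }  (= I when n = 0) *)
Definition Filbelow (n : nat) (y : TW) : Prop :=
  exists z, Iset z /\ forall w, y w != z w -> (wt w < n)%N.

Definition wpart (n : nat) (x : TW) : TW :=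
  fun w => if wt w == n then x w else 0.

Definition finsupp (x : TW) : Prop :=
  exists N : nat, forall w, (N < size w)%N -> x w = 0.

(* K = kernel of the canonical surjection T(W) -> A'_Gamma of graded
   algebras sending a word w = e1...er to the class of its image in
   F^(wt w) A / F^(wt w - 1) A; thus A'_Gamma = T(W)/K. *)
Definition Kker (x : TW) : Prop :=
  finsupp x /\ forall n, Filbelow n (wpart n x).

Definition Kdeg (d : nat) (r : TW) : Prop :=
  Kker r /\ forall w, size w != d -> r w = 0.

(* A'_Gamma = T(W)/K is quadratic: the kernel of T(A'_1) -> A'_Gamma is
   generated in degree 2, i.e. K is the ideal generated by K_1 and K_2 *)
Definition quadratic : Prop :=
  forall x, Kker x ->
    inspan (fun y => exists (u v : seq E) (r : TW),
               (Kdeg 1 r \/ Kdeg 2 r) /\ y = tmul (tmul (mono u) r) (mono v)) x.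

(* Normalized bar complex B(A') computing Tor^{A'}(F,F):
   B_i = (A'_+)^{(x) i}, lifted to (T(W)_+)^{(x) i}, whose elements are
   represented as functions on lists of (nonempty) words. *)
Local Notation BT := (seq (seq E) -> F).

(* x is homogeneous: homological degree i, internal degree j *)
Definition bsupp (i j : nat) (x : BT) : Prop :=
  forall ws, x ws != 0 ->
    [/\ size ws = i, all (fun w => w != [::]) ws & sumn (map size ws) = j].

(* bar differential  [a1|...|ai] |-> sum_k (-1)^k [a1|..|a_k a_(k+1)|..|ai]
   (the terms involving the augmentation vanish on A'_+) *)
Definition bard (x : BT) : BT := fun ws =>
  \sum_(k < size ws)
    \sum_(l < size (nth [::] ws k))
      if (0 < l)%N then
        (-1) ^+ k.+1 *
          x (take k ws ++ take l (nth [::] ws k) :: drop l (nth [::] ws k)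
                       :: drop k.+1 ws)
      else 0.

Definition ptens (fs : seq TW) : BT := fun ws =>
  if size ws == size fs then
    \prod_(k < size ws) (nth (fun _ => 0) fs k) (nth [::] ws k)
  else 0.

(* kernel of (T(W)_+)^{(x) i} -> (A'_+)^{(x) i} *)
Definition Nbar : BT -> Prop :=
  inspan (fun y => exists (us vs : seq (seq E)) (r : TW),
     [/\ all (fun u => u != [::]) us, all (fun v => v != [::]) vs, Kker r &
         y = ptens (map mono us ++ r :: map mono vs)]).

Definition torvan (i j : nat) : Prop :=
  forall x, bsupp i j x -> Nbar (bard x) ->
    exists y, bsupp i.+1 j y /\ Nbar (fun ws => x ws - bard y ws).

Definition koszul : Prop := forall i j : nat, i != j -> torvan i j.

End Splitting.

(* Main.v *)
(* Write [A'] for the associated graded algebra.  All edges leaving a vertex [x] have the same class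
   in [A'], and [A'] is the algebra of the monoid generated by the vertices [x <> star] in which
   [x_1 ... x_k = y_1 ... y_k] for any two paths with [x_1 = y_1].  That no further relation holds is
   the basis theorem of Gelfand, Retakh, Serconek and Wilson.  We get it from a representation of
   [A] on the space of normal words of the monoid: if [X_(x,k)] is the action of [e(pi, k)], where
   [pi] is a path from [x] to [star], then [P_x(s) = sum_k X_(x,k) s^(rk x - k)] must be a left
   multiple of [P_y(s)] whenever [y < x]; these identities define the operators recursively and are
   consistent.

   (1) For two paths [x -> a -> c] and [x -> b -> d], the quadratic relations identify [x a c] and
   [x b d] exactly when [a] and [b] are in the same class of [~_x]; if there is only one class,
   induction on the length of paths gives all the relations.

   (2) Dually to the bar complex, consider cochains on lists of normal words.  The lists
   [(x, l_1) | (y_1, l_2) | ... ] of single blocks in which all neighbours merge form a subcomplex,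
   and the other lists cancel in pairs: at the first failure either a word is split after its first
   block, or a block is glued to the next word.  The subcomplex of total degree [j] headed by [x] is
   the complex of chains of [{y < x | rk y > rk x - j}], so [A'] is Koszul iff all these truncated
   lower intervals have cohomology in top degree only.  Adding the level of rank [rk x - j] to
   such a truncation cones off the open intervals [(y, x)] with [y] in this level, and the long
   exact sequences turn the condition into the Cohen-Macaulay property. *)
Require Import Defs.
From HB Require Import structures.
From mathcomp Require Import all_boot all_order all_algebra.
From mathcomp Require Import zify ring.
From Stdlib Require Import FunctionalExtensionality Classical.
Set Implicit Arguments. Unset Strict Implicit. Unset Printing Implicit Defensive.
Import GRing.Theory.
Local Open Scope ring_scope.

(** Everything about the kernel of [T(W) -> A'] is read off from sums over fibres: a finitely
    supported element lies in [Kker] iff its coefficients add up to zero over each fibre of [cls].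
    Sufficiency is a leading-term argument: among the subwords of given length of a path the initial
    one is the heaviest. Necessity needs enough functionals that kill the ideal, and these come from
    the representation. Its operators are written as transposes, on arbitrary functions of lists of
    blocks, so no finiteness has to be tracked; only values at normal words count. The difficulty is
    consistency. The recursion imposes the coefficient of index [k + l] of [P_x = P_(x/y) P_y] at a
    word [m'] only when [(y, l) :: m'] is normal; the other coefficients have to be derived, by
    comparison with a third vertex [z < y]. In part (2) every bidegree is finite-dimensional, so the
    homology of the bar complex can be traded for the cohomology of its dual, where cochains are
    plain functions of lists of normal words and the quotient by [Nbar] disappears. *)

Section Words.
Variable X : eqType.
Implicit Types (A : seq X) (w : seq X).

Fixpoint words A (n : nat) : seq (seq X) :=
  if n is n'.+1 then [seq a :: w | a <- A, w <- words A n'] else [:: [::]].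

Lemma mem_words A n w : (w \in words A n) = (size w == n) && all (mem A) w.
Proof.
elim: n w => [|n IH] [|a w] //=; first by apply/allpairsP=> -[[b v] /= []].
rewrite eqSS andbCA -IH; apply/allpairsP/andP => [[[b v] /= [h1 h2 [-> ->]]]|[h1 h2]] //.
by exists (a, w).
Qed.

Lemma words_uniq A n : uniq A -> uniq (words A n).
Proof. by move=> uA; elim: n => //= n IH; apply: allpairs_uniq => // -[a v] [b v'] _ _ [-> ->]. Qed.

Lemma sum_words_cons (V : nmodType) A n (f : seq X -> V) :
  \sum_(w <- words A n.+1) f w = \sum_(a <- A) \sum_(w <- words A n) f (a :: w).
Proof. by rewrite /= big_allpairs_dep. Qed.

End Words.

Lemma card_tuple_words (X : finType) n (P : pred (seq X)) :
  #|[set t : n.-tuple X | P t]| = count P (words (enum X) n).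
Proof.
have pe : perm_eq [seq val t | t <- enum {: n.-tuple X}] (words (enum X) n).
  apply: uniq_perm; rewrite ?words_uniq ?enum_uniq //.
    by rewrite map_inj_uniq ?enum_uniq //; apply: val_inj.
  move=> w; rewrite mem_words (_ : all _ w) ?andbT; last by apply/allP=> a _; rewrite /= mem_enum.
  apply/mapP/eqP => [[t _ ->]|h]; first by rewrite size_tuple.
  by exists (Tuple (introT eqP h)); rewrite ?mem_enum.
rewrite -(permP pe) count_map cardE enumT /enum_mem size_filter.
by apply: eq_count => t; rewrite /= inE.
Qed.

(** * Linear algebra in spaces of functions *)

Section Subspaces.
Variables (F : fieldType) (X : eqType).

Definition subspace (S : (X -> F) -> Prop) : Prop :=
  [/\ S (fun _ => 0), forall f g, S f -> S g -> S (fun w => f w + g w)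
    & forall c f, S f -> S (fun w => c * f w)].

Lemma inspan_subspace P : subspace (@inspan F X P).
Proof. by split; [apply: inspan0 | apply: inspan_add | apply: inspan_scale]. Qed.

Lemma subspace_sum S (I : eqType) (r : seq I) (g : I -> X -> F) : subspace S ->
  (forall i, i \in r -> S (g i)) -> S (fun w => \sum_(i <- r) g i w).
Proof.
case=> S0 SD SZ; elim: r => [|i r IH] hr.
  by rewrite (_ : (fun w => _) = fun=> 0) //; apply: functional_extensionality => w; rewrite big_nil.
rewrite (_ : (fun w => _) = fun w => g i w + \sum_(j <- r) g j w).
  by apply: SD; [apply: hr; rewrite inE eqxx | apply: IH => j hj; apply: hr; rewrite inE hj orbT].
by apply: functional_extensionality => w; rewrite big_cons.
Qed.

Definition delta (a : X) : X -> F := fun w => (w == a)%:R.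

Lemma class_sum0 (K : eqType) (kap : X -> K) (s : seq X) (x f : X -> F) :
  {in s &, forall a b, kap a = kap b -> f a = f b} ->
  (forall k, \sum_(a <- s | kap a == k) x a = 0) -> \sum_(a <- s) x a * f a = 0.
Proof.
move=> hf x0; pose ks := undup (map kap s).
rewrite (eq_big_seq (fun a => \sum_(k <- ks | kap a == k) x a * f a)) => [|a ha].
  rewrite (exchange_big_dep xpredT) //=; apply: big1 => k _.
  case: (boolP (has (fun a => kap a == k) s)) => [/hasP[b bs /eqP kb]|/hasPn hk].
    rewrite big_seq_cond (eq_bigr (fun a => x a * f b)) => [|a /andP[ha /eqP ka]].
      by rewrite -big_seq_cond -mulr_suml x0 mul0r.
    by congr (_ * _); apply: hf => //; rewrite ka kb.
  by rewrite big_seq_cond big1 // => a /andP[/hk/negbTE ->].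
rewrite -big_filter (eq_filter (a2 := pred1 (kap a))) => [|k]; last by rewrite /= eq_sym.
by rewrite filter_pred1_uniq ?undup_uniq ?mem_undup ?map_f // big_seq1.
Qed.

(* Subtract from each word a representative of its class. *)
Lemma subspace_classes (K : eqType) (kap : X -> K) S (s : seq X) (x : X -> F) :
  subspace S -> uniq s -> (forall a, a \notin s -> x a = 0) ->
  {in s &, forall a b, kap a = kap b -> x a != 0 -> S (fun w => delta a w - delta b w)} ->
  (forall k, \sum_(a <- s | kap a == k) x a = 0) -> S x.
Proof.
move=> sS us xs Sk x0.
case: s => [|a0 s0] in us xs Sk x0 *.
  case: sS => S0 _ _; rewrite (_ : x = fun=> 0) //.
  by apply: functional_extensionality => w; apply: xs.
set s := a0 :: s0 in us xs Sk x0.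
pose rep k := nth a0 s (index k (map kap s)).
have repP a : a \in s -> rep (kap a) \in s /\ kap (rep (kap a)) = kap a.
  move=> ha; have h : kap a \in map kap s by apply: map_f.
  have hi : (index (kap a) (map kap s) < size s)%N by rewrite -(size_map kap) index_mem.
  by rewrite mem_nth // -(nth_map a0 (kap a) kap hi) nth_index.
have -> : x = fun w => \sum_(a <- s) x a * (delta a w - delta (rep (kap a)) w).
  apply: functional_extensionality => w.
  rewrite (eq_bigr _ (fun a _ => mulrBr _ _ _)) sumrB.
  rewrite [X in _ - X](_ : _ = 0) ?subr0; last first.
    by apply: (class_sum0 (kap := kap)) => // a b ha hb ->.
  case: (boolP (w \in s)) => hw.
    rewrite (bigD1_seq w) //= /delta eqxx mulr1 big1 ?addr0 // => a aw.
    by rewrite eq_sym (negbTE aw) mulr0.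
  rewrite xs // big_seq big1 // => a ha; rewrite /delta.
  by case: eqP => [e|_]; [rewrite e ha in hw | rewrite mulr0].
apply: subspace_sum => // a ha; have [h1 h2] := repP a ha.
case: (sS) => S0 _ SZ; case: (eqVneq (x a) 0) => [->|xa].
  rewrite (_ : (fun w => _) = fun=> 0) //.
  by apply: functional_extensionality => w; rewrite mul0r.
by apply: SZ; apply: Sk.
Qed.
End Subspaces.

Section Fredholm.
Variable F : fieldType.

(** The row space of a matrix is the annihilator of its right kernel. This is the tool for passing
    between the bar complex and its dual. *)
Lemma fredholm (X Y : eqType) (sx : seq X) (sy : seq Y) (M : X -> Y -> F) (v : Y -> F) :
  uniq sx -> uniq sy ->
  (forall w : Y -> F, (forall x, x \in sx -> \sum_(y <- sy) M x y * w y = 0) ->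
     \sum_(y <- sy) v y * w y = 0) ->
  exists u : X -> F, forall y, y \in sy -> v y = \sum_(x <- sx) u x * M x y.
Proof.
case: sx => [|x0 sx0] ux; case: sy => [|y0 sy0] uy H.
- by exists (fun=> 0).
- exists (fun=> 0) => y hy; rewrite big_nil.
  have h0 x : x \in [::] -> \sum_(z <- y0 :: sy0) M x z * (z == y)%:R = 0 by [].
  have := H _ h0; rewrite (bigD1_seq y) //= eqxx mulr1 big1 ?addr0 // => z /negbTE ->; by rewrite mulr0.
- by exists (fun=> 0).
set sx := x0 :: sx0 in ux H *; set sy := y0 :: sy0 in uy H *.
have sumE (Z : eqType) (z0 : Z) (s : seq Z) (G : Z -> F) :
    \sum_(z <- s) G z = \sum_(i < size s) G (nth z0 s i) by rewrite (big_nth z0) big_mkord.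
pose A := \matrix_(i < size sx, j < size sy) M (nth x0 sx i) (nth y0 sy j).
pose b := \row_(j < size sy) v (nth y0 sy j).
have : (b <= A)%MS.
  rewrite submxE; apply/eqP/rowP => c; rewrite !mxE.
  (* The test vector is a column of [cokermx A], extended by 0; it is killed by [A], hence by
     [v]. *)
  pose w y := if insub (index y sy) is Some j then cokermx A j c else 0.
  have wE (j : 'I_(size sy)) : w (nth y0 sy j) = cokermx A j c.
    by rewrite /w index_uniq // insubT // => h; congr (cokermx A _ c); apply: val_inj.
  have := H w; rewrite (sumE _ y0) => H'.
  rewrite -[RHS]H' => [|x hx]; first by apply: eq_bigr => j _; rewrite mxE wE.
  have hi : (index x sx < size sx)%N by rewrite index_mem.
  have /matrixP/(_ (Ordinal hi) c) e := mulmx_coker A; rewrite !mxE in e; rewrite (sumE _ y0) -[RHS]e.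
  by apply: eq_bigr => j _; rewrite mxE wE /= nth_index.
case/submxP=> D /matrixP hD.
pose u x := if insub (index x sx) is Some i then D 0 i else 0.
have uE (i : 'I_(size sx)) : u (nth x0 sx i) = D 0 i.
  by rewrite /u index_uniq // insubT // => h; congr (D 0 _); apply: val_inj.
exists u => y hy; have hj : (index y sy < size sy)%N by rewrite index_mem.
have := hD 0 (Ordinal hj); rewrite !mxE /= nth_index // => ->.
by rewrite (sumE _ x0); apply: eq_bigr => i _; rewrite mxE uE /= nth_index.
Qed.

End Fredholm.

(** * The differential that merges neighbours in a list *)

Section Merge.
Variables (F : fieldType) (A : Type) (op : A -> A -> A).
Implicit Types (s : seq A) (f : seq A -> F).

Fixpoint merge (k : nat) s : seq A :=
  match k, s with
  | 0, a :: b :: r => op a b :: r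
  | k'.+1, a :: r => a :: merge k' r
  | _, _ => s
  end.

(** Transpose of the bar differential, with the signs of [bard], for any product [op]: concatenation
    of words, [nmul], or the merging of blocks. *)
Definition dlt f s : F := \sum_(k < (size s).-1) (-1) ^+ k.+1 * f (merge k s).

Lemma merge_cat p a b r : merge (size p) (p ++ a :: b :: r) = p ++ op a b :: r.
Proof. by elim: p => //= c p ->. Qed.

Lemma size_merge k s : (k.+1 < size s)%N -> size (merge k s) = (size s).-1.
Proof.
elim: k s => [|k IH] [|a [|b r]] //= h; rewrite IH //.
Qed.

Lemma eq_dlt f g s : (forall k, (k < (size s).-1)%N -> f (merge k s) = g (merge k s)) ->
  dlt f s = dlt g s.
Proof. by move=> H; rewrite /dlt; apply: eq_bigr => k _; rewrite H. Qed.

Lemma dlt1 f a : dlt f [:: a] = 0. Proof. by rewrite /dlt big_ord0. Qed.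

Lemma dlt_cons f a b r :
  dlt f (a :: b :: r) = - f (op a b :: r) - dlt (fun s => f (a :: s)) (b :: r).
Proof.
rewrite /dlt big_ord_recl /= expr1 mulN1r; congr (_ + _); rewrite -sumrN.
by apply: eq_bigr => k _; rewrite /bump /= exprS mulN1r mulNr.
Qed.

Lemma dltB f g s : dlt (fun r => f r - g r) s = dlt f s - dlt g s.
Proof. by rewrite /dlt -sumrB; apply: eq_bigr => k _; rewrite mulrBr. Qed.

Lemma dltN f s : dlt (fun r => - f r) s = - dlt f s.
Proof. by rewrite /dlt -sumrN; apply: eq_bigr => k _; rewrite mulrN. Qed.

Lemma split_at k s : (k < size s)%N -> exists p a r, s = p ++ a :: r /\ size p = k.
Proof.
elim: k s => [|k IH] [|a s] //= h; first by exists [::], a, s.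
by have [p [b [r [-> <-]]]] := IH _ h; exists (a :: p), b, r.
Qed.

Lemma split_at2 k s : (k.+1 < size s)%N -> exists p a b r, s = p ++ a :: b :: r /\ size p = k.
Proof.
move=> h; have [p [a [r [e sp]]]] := split_at (ltnW h).
case: r e => [|b r] e; last by exists p, a, b, r.
by move: h; rewrite e size_cat /= sp addn1 ltnn.
Qed.

Lemma dlt_dlt f s : associative op -> dlt (dlt f) s = 0.
Proof.
move=> opA; elim: s f => [|a [|b r] IH] f; rewrite ?dlt1 //.
  by rewrite /dlt big_ord0.
rewrite dlt_cons.
(* A merge inside [b :: r] leaves a nonempty list, so [dlt_cons] applies to every term. *)
have -> : dlt (fun s => dlt f (a :: s)) (b :: r) =
    dlt (fun s => (if s is c :: s' then - f (op a c :: s') else 0)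
                  - dlt (fun s' => f (a :: s')) s) (b :: r).
  apply: eq_dlt => k hk; have := size_merge (hk : (k.+1 < size (b :: r))%N).
  by case: (merge k (b :: r)) => [/esym /= e|c s _]; [rewrite /= e in hk | rewrite dlt_cons].
rewrite dltB IH subr0; case: r IH => [|c r] IH; first by rewrite !dlt1 !oppr0 addr0.
rewrite !dlt_cons opA.
have -> : dlt (fun s => - f (op a b :: s)) (c :: r) = - dlt (fun s => f (op a b :: s)) (c :: r).
  exact: dltN.
ring.
Qed.

End Merge.

Lemma map_merge (A B : Type) (op : A -> A -> A) (op' : B -> B -> B) (phi : A -> B) k s :
  (forall a b, phi (op a b) = op' (phi a) (phi b)) ->
  map phi (merge op k s) = merge op' k (map phi s).
Proof. by move=> H; elim: k s => [|k IH] [|a [|b r]] //=; rewrite ?H ?IH. Qed.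

Lemma dlt_map (F : fieldType) (A B : Type) (op : A -> A -> A) (op' : B -> B -> B) (phi : A -> B)
    (f : seq B -> F) s :
  (forall a b, phi (op a b) = op' (phi a) (phi b)) ->
  dlt op (fun r => f (map phi r)) s = dlt op' f (map phi s).
Proof.
move=> H; rewrite /dlt size_map; apply: eq_bigr => k _; by rewrite (map_merge (op' := op')).
Qed.

(** * Ranked posets *)

Section SplittingAlgebra.
Variables (F : fieldType) (T : finType) (lt : rel T) (star : T).
Hypotheses (lt_irr : irreflexive lt) (lt_tr : transitive lt).
Hypotheses (star_min : minimal lt star) (star_uniq : forall m, minimal lt m -> m = star).
Hypothesis lt_ranked : ranked lt star.

Local Notation ple := (ple lt).
Local Notation rk := (rk lt star).
Local Notation covers := (covers lt star).
Local Notation S1 := (S1 lt star).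
Local Notation simrel := (simrel lt star).
Local Notation E := (edge lt star).
Local Notation wt := (@wt T lt star).
Local Notation TW := (seq E -> F).
Local Notation BT := (seq (seq E) -> F).
Local Notation mono := (@mono F T lt star).
Local Notation Iset := (@Iset F T lt star).
Local Notation Filbelow := (@Filbelow F T lt star).
Local Notation Kdeg := (@Kdeg F T lt star).
Local Notation bsupp := (@bsupp F T lt star).
Local Notation Nbar := (@Nbar F T lt star).
Local Notation bard := (@bard F T lt star).
Local Notation blk := (T * nat)%type.
Local Notation K := (seq blk).
Local Notation Fn := (K -> F).

Lemma ple_refl x : ple x x. Proof. by rewrite /Defs.ple eqxx. Qed.

Lemma ltW x y : lt x y -> ple x y. Proof. by rewrite /Defs.ple => ->; rewrite orbT. Qed.

Lemma lt_ple_trans y x z : lt x y -> ple y z -> lt x z.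
Proof. by move=> h /orP[/eqP <- //|]; apply: lt_tr. Qed.

Lemma ple_trans y x z : ple x y -> ple y z -> ple x z.
Proof. by case/orP=> [/eqP -> //|h /(lt_ple_trans h)/ltW]. Qed.

Lemma lt_asym x y : lt x y -> lt y x = false.
Proof. by move=> h; apply/negP => /(lt_tr h); rewrite lt_irr. Qed.

Lemma lt_wf_ind (P : T -> Prop) :
  (forall x, (forall y, lt y x -> P y) -> P x) -> forall x, P x.
Proof.
move=> H x; move: {2}_.+1 (ltnSn #|[set y | lt y x]|) => n.
elim: n x => // n IH x hx; apply: H => y hy; apply: IH.
apply: (leq_trans _ (hx : (_ <= n)%N)); apply/proper_card/properP; split.
  by apply/subsetP=> z; rewrite !inE => hz; apply: lt_tr hy.
by exists y; rewrite !inE ?lt_irr.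
Qed.

Lemma star_ple x : ple star x.
Proof.
elim/lt_wf_ind: x => x IH.
case: (boolP [exists y, lt y x]) => [/existsP[y hy]|/existsPn hx].
  by apply: ple_trans (IH _ hy) (ltW hy).
by rewrite (star_uniq hx) ple_refl.
Qed.

Lemma is_chainP (C : {set T}) :
  reflect {in C &, forall x y, ple x y || ple y x} (is_chain lt C).
Proof.
apply: (iffP 'forall_implyP) => H x.
  by move=> y hx hy; move/'forall_implyP: (H x hx) => /(_ y hy).
by move=> hx; apply/'forall_implyP => y hy; apply: H.
Qed.

Lemma in_cint x z : (z \in cint lt star x) = ple z x.
Proof. by rewrite inE star_ple. Qed.

Lemma maxchain_ex x C : is_chain lt C -> C \subset cint lt star x ->
  exists2 C', maxchain lt star x C' & C \subset C'.
Proof.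
move=> hC sC.
have [D /maxsetP[/andP[cD sD] mD] sCD] :=
  @maxset_exists _ (fun D => is_chain lt D && (D \subset cint lt star x)) C
    (introT andP (conj hC sC)).
exists D => //; rewrite /maxchain cD sD /=; apply/forallP => D'.
by apply/implyP=> /and3P[c1 c2 c3]; apply/eqP/mD => //; apply/andP.
Qed.

Lemma rkE x C : maxchain lt star x C -> rk x = #|C|.-1.
Proof.
move=> hC; rewrite /Defs.rk; apply/eqP; rewrite eqn_leq; apply/andP; split.
  by apply/bigmax_leqP => D hD; rewrite (lt_ranked hD hC).
exact: (@leq_bigmax_cond _ (maxchain lt star x) (fun D => #|D|.-1) C hC).
Qed.

Lemma is_chain1 x : is_chain lt [set x].
Proof. by apply/is_chainP => u v /set1P -> /set1P ->; rewrite ple_refl. Qed.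

Lemma maxchain_ends x C : maxchain lt star x C -> (x \in C) && (star \in C).
Proof.
case/and3P=> /is_chainP cC /subsetP sC /forallP mC.
have add z : ple z x -> {in C, forall u, ple u z || ple z u} -> z \in C.
  move=> zx hz.
  have /implyP/(_ _)/eqP <- := mC (z |: C); rewrite ?setU11 // subsetU1 andbT.
  apply/andP; split.
    apply/is_chainP=> u v /setU1P[->|hu] /setU1P[->|hv]; rewrite ?ple_refl //.
    - by rewrite orbC hz.
    - by rewrite hz.
    - exact: cC.
  by apply/subsetP=> u /setU1P[->|hu]; [rewrite in_cint | apply: sC].
apply/andP; split; apply: add; rewrite ?ple_refl ?star_ple // => u hu.
  by have := sC _ hu; rewrite in_cint => ->.
by rewrite star_ple orbT.
Qed.

Lemma rk_star : rk star = 0.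
Proof.
have [|C hC _] := @maxchain_ex star set0 _ (sub0set _).
  by apply/is_chainP=> u v; rewrite inE.
rewrite (rkE hC); suff -> : C = [set star] by rewrite cards1.
apply/setP=> z; rewrite in_set1; apply/idP/eqP => [|->].
  case/and3P: hC => _ /subsetP s _ /s; rewrite in_cint => /orP[/eqP//|].
  by rewrite (negbTE (star_min _)).
by case/andP: (maxchain_ends hC).
Qed.

(** Extend [{y}] to a maximal chain of [[star, x]] and remove [x]. What is left is a maximal chain
    of [[star, z]], where [z] is its largest element, so [ranked] makes the ranks of [x] and [z]
    differ by one. *)
Lemma lt_cover y x : lt y x -> exists2 z, covers x z & ple y z.
Proof.
move=> yx; have [|C hC syC] := @maxchain_ex x [set y] (is_chain1 y); first by rewrite sub1set in_cint ltW.
have yC : y \in C by rewrite -sub1set.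
case/and3P: (hC) => /is_chainP cC /subsetP sC /forallP mC.
have /andP[xC _] := maxchain_ends hC.
have sCx u : u \in C -> ple u x by move/sC; rewrite in_cint.
pose D := C :\ x.
have yD : y \in D by rewrite in_setD1 yC andbT; apply: contraTneq yx => ->; rewrite lt_irr.
have [z zD zmax] : exists2 z, z \in D & {in D, forall u, ple u z}.
  pose m u := #|[set v in D | ple v u]|.
  have [z zD zm] := @arg_maxnP _ y (mem D) m yD.
  exists z => // u uD; have uC : u \in C by case/setD1P: uD.
  have zC : z \in C by case/setD1P: zD.
  case/orP: (cC _ _ uC zC) => // zu; case/orP: (zu) => [/eqP->|ltzu]; first exact: ple_refl.
  have : (m u <= m z)%N by apply: zm.
  rewrite leqNgt => /negP[]; apply/proper_card/properP; split.
    by apply/subsetP=> v; rewrite !inE => /andP[-> /= h]; apply: ple_trans zu.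
  exists u; rewrite !inE; first by move: uD; rewrite !inE => ->; rewrite ple_refl.
  rewrite negb_and; apply/orP; right; apply/negP => /orP[/eqP e|].
    by move: ltzu; rewrite e lt_irr.
  by rewrite (lt_asym ltzu).
exists z; last exact: zmax.
have zx : lt z x.
  by case/setD1P: zD => n /sCx /orP[/eqP e|//]; move: n; rewrite e eqxx.
rewrite /Defs.covers zx /= (rkE hC).
suff hD : maxchain lt star z D.
  by rewrite (rkE hD) (cardsD1 x C) xC -/D; have : (0 < #|D|)%N; [apply/card_gt0P; exists y | case: #|D|].
apply/and3P; split.
- by apply/is_chainP=> u v /setD1P[_ hu] /setD1P[_ hv]; apply: cC.
- by apply/subsetP=> u hu; rewrite in_cint; apply: zmax.
apply/forallP=> D'; apply/implyP=> /and3P[/is_chainP c1 /subsetP s1 s2].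
have xD' : x \notin D'.
  apply/negP=> /s1; rewrite in_cint => /(lt_ple_trans zx); by rewrite lt_irr.
have /implyP/(_ _)/eqP h := mC (x |: D').
rewrite eqEsubset s2 andbT; apply/subsetP=> u hu.
rewrite in_setD1 -h ?setU1r // ?andbT; first by apply: contraNneq xD' => <-.
apply/and3P; split.
- have hx v : v \in D' -> ple v x by move/s1; rewrite in_cint => /ple_trans; apply; apply: ltW.
  apply/is_chainP=> v w /setU1P[->|hv] /setU1P[->|hw]; rewrite ?ple_refl ?hx ?orbT //.
  exact: c1.
- apply/subsetP=> v /setU1P[->|/s1]; rewrite !in_cint ?ple_refl // => /ple_trans; apply; exact: ltW.
- apply/subsetP=> v vC; rewrite in_setU1; case: eqP => //= /eqP n; apply: (subsetP s2).
  by rewrite in_setD1 n.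
Qed.

Lemma covers_lt x y : covers x y -> lt y x. Proof. by case/andP. Qed.
Lemma covers_rk x y : covers x y -> rk x = (rk y).+1. Proof. by case/andP=> _ /eqP. Qed.

Lemma rk_lt y x : lt y x -> (rk y < rk x)%N.
Proof.
elim/lt_wf_ind: x => x IH yx; have [z xz] := lt_cover yx.
rewrite (covers_rk xz) ltnS => /orP[/eqP -> //|yz].
exact/ltnW/IH/yz/covers_lt.
Qed.

Lemma rk_eq0 x : (rk x == 0) = (x == star).
Proof.
apply/idP/eqP => [/eqP r0|->]; last by rewrite rk_star.
by case/orP: (star_ple x) => [/eqP//|/rk_lt]; rewrite r0.
Qed.

Lemma rk_gt0 x : (0 < rk x)%N = (x != star).
Proof. by rewrite lt0n rk_eq0. Qed.

(** * Normal words *)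

(* A block [(b, l)] stands for the product of the classes of the first [l] edges of a path leaving
   [b]; it absorbs a following block with head [c] when [cov b l c]. *)
Definition cov (b : T) (l : nat) (c : T) : bool := lt c b && (rk b == rk c + l)%N.

Definition hcov (b : T) (l : nat) (m : seq blk) : bool :=
  if m is (c, _) :: _ then cov b l c else false.

Definition valid (u : blk) : bool := (0 < u.2 <= rk u.1)%N.

Fixpoint normal (m : seq blk) : bool :=
  if m is u :: m' then [&& valid u, ~~ hcov u.1 u.2 m' & normal m'] else true.

(** Absorption has to go on after the first success: even if [(c, p)] does not absorb the next block
    [(d, q)], the longer block [(b, l + p)] may, since [d < b] does not give [d < c]. *)
Fixpoint ncons (b : T) (l : nat) (m : seq blk) : seq blk :=
  if m is (c, p) :: m' then
    if cov b l c then ncons b (l + p) m' else (b, l) :: m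
  else [:: (b, l)].

Definition nmul (m1 m2 : seq blk) : seq blk := foldr (fun u => ncons u.1 u.2) m2 m1.

Definition deg (m : seq blk) : nat := sumn (map snd m).

(** The successive edges of a path from [x] have ranks [rk x], [rk x - 1], ...; this is the weight
    of the first [k] of them. *)
Definition bwt (x : T) (k : nat) : nat := \sum_(j < k) (rk x - j)%N.
Definition nwt (m : seq blk) : nat := sumn (map (fun u => bwt u.1 u.2) m).

Lemma cov_rk b l c : cov b l c -> rk b = (rk c + l)%N.
Proof. by case/andP=> _ /eqP. Qed.

Lemma cov_lt b l c : cov b l c -> lt c b. Proof. by case/andP. Qed.

Lemma cov_gt0 b l c : cov b l c -> (0 < l <= rk b)%N.
Proof.
move=> h; have := rk_lt (cov_lt h).
rewrite (cov_rk h); lia.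
Qed.

Lemma cov_trans b l c p d : cov b l c -> cov c p d -> cov b (l + p) d.
Proof.
move=> h1 h2; rewrite /cov (lt_tr (cov_lt h2) (cov_lt h1)) /=.
by rewrite (cov_rk h1) (cov_rk h2) -addnA (addnC p).
Qed.

Lemma cov_valid b l c p : cov b l c -> valid (c, p) -> valid (b, l + p)%N.
Proof. by move=> h; rewrite /valid /= (cov_rk h); lia. Qed.

Lemma hcov_cov b l m : hcov b l m -> exists c p m', m = (c, p) :: m' /\ cov b l c.
Proof. by case: m => [|[c p] m'] //= h; exists c, p, m'. Qed.

Lemma ncons_nhcov b l m : ~~ hcov b l m -> ncons b l m = (b, l) :: m.
Proof. by case: m => [|[c p] m'] //= /negbTE ->. Qed.

Lemma ncons_normal b l m : valid (b, l) -> normal m -> normal (ncons b l m).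
Proof.
elim: m l => [|[c p] m IH] l v //=; first by rewrite v.
case: (boolP (cov b l c)) => h /and3P[h1 h2 h3].
  by apply: IH => //; apply: cov_valid h1.
by rewrite /= v h h1 h2 h3.
Qed.

Lemma nmul_normal m1 m2 : normal m1 -> normal m2 -> normal (nmul m1 m2).
Proof.
elim: m1 => //= -[b l] m1 IH /and3P[v _ n1] n2.
by apply: ncons_normal => //; apply: IH.
Qed.

(** By transitivity of covering, whatever [(c, p)] absorbs is also absorbed by [(b, l + p)]. This is
    the core of associativity. *)
Lemma ncons_ncons b l c p m :
  cov b l c -> ncons b l (ncons c p m) = ncons b (l + p) m.
Proof.
move=> h; elim: m p => [|[d q] m IH] p //=; first by rewrite h.
case: (boolP (cov c p d)) => hd; first by rewrite IH (cov_trans h hd) addnA.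
by rewrite /= h.
Qed.

Lemma nmul_ncons b l m c : nmul (ncons b l m) c = ncons b l (nmul m c).
Proof.
elim: m l => [|[y p] m IH] l //=; case: ifP => // h.
by rewrite IH ncons_ncons.
Qed.

Lemma nmulA : associative nmul.
Proof. by elim=> //= u m IH m2 m3; rewrite IH nmul_ncons. Qed.

Lemma nmulm0 m : normal m -> nmul m [::] = m.
Proof.
elim: m => //= -[b l] m IH /and3P[_ h n]; by rewrite IH // ncons_nhcov.
Qed.

Lemma ncons_neq0 b l m : ncons b l m != [::].
Proof. by elim: m l => //= -[c p] m IH l; case: ifP. Qed.

Lemma nmul_neq0 m1 m2 : m1 != [::] -> nmul m1 m2 != [::].
Proof. by case: m1 => //= u m1 _; apply: ncons_neq0. Qed.

Lemma deg_ncons b l m : deg (ncons b l m) = (l + deg m)%N.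
Proof.
rewrite /deg; elim: m l => [|[c p] m IH] l //=; case: ifP => // _.
by rewrite IH addnA.
Qed.

Lemma deg_nmul m1 m2 : deg (nmul m1 m2) = (deg m1 + deg m2)%N.
Proof. by elim: m1 => //= -[b l] m1 IH; rewrite deg_ncons IH addnA. Qed.

Lemma bwtD x k l : bwt x (k + l) = (bwt x k + \sum_(j < l) (rk x - k - j))%N.
Proof.
rewrite /bwt big_split_ord /=; congr addn; apply: eq_bigr => i _; by rewrite subnDA.
Qed.

Lemma bwt_cov b l c p : cov b l c -> bwt b (l + p) = (bwt b l + bwt c p)%N.
Proof. by move=> h; rewrite bwtD (cov_rk h) addnK. Qed.

Lemma nwt_ncons b l m : nwt (ncons b l m) = (bwt b l + nwt m)%N.
Proof.
rewrite /nwt; elim: m l => [|[c p] m IH] l //=; case: ifP => // h.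
by rewrite IH (bwt_cov _ h) addnA.
Qed.

Lemma nwt_nmul m1 m2 : nwt (nmul m1 m2) = (nwt m1 + nwt m2)%N.
Proof. by elim: m1 => //= -[b l] m1 IH; rewrite nwt_ncons IH addnA. Qed.

(** * Operators on functions of normal words *)

Section Operators.
Implicit Types (phi psi : Fn).

(** Transpose of plain concatenation with the block [(x, k)], cut off at [rk x] because [P_x] has
    that degree. *)
Definition Cop (x : T) (k : nat) : Fn -> Fn := fun phi m =>
  if k == 0%N then phi m else if (k <= rk x)%N then phi ((x, k) :: m) else 0.

(** The argument [n] is fuel for the recursion over [a < i]. As the operators are transposed, the
    left factor of a product acts first: the quotient is applied to [phi] before [B]. *)
Fixpoint quotf (n : nat) (A B : nat -> Fn -> Fn) (i : nat) (phi : Fn) : Fn :=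
  if n is n'.+1 then
    fun m => A i phi m - \sum_(a < i) B (i - a)%N (quotf n' A B a phi) m
  else phi.

(* The coefficients of the left quotient of power series with operator coefficients. *)
Definition quot A B i := quotf i.+1 A B i.

Lemma quotE A B i phi m :
  quot A B i phi m = A i phi m - \sum_(a < i) B (i - a)%N (quot A B a phi) m.
Proof.
have stab n n' j psi : (j < n)%N -> (j < n')%N -> quotf n A B j psi = quotf n' A B j psi.
  elim: n n' j psi => // n IH [|n'] j psi // hn hn' /=.
  apply: functional_extensionality => w; congr (_ - _); apply: eq_bigr => a _.
  by rewrite (IH n') //; apply: (leq_trans (ltn_ord a)).
rewrite {1}/quot /=; congr (_ - _); apply: eq_bigr => a _.
by rewrite (stab _ a.+1) //; apply: ltn_ord.
Qed.

Lemma quot_conv A B i phi m : (forall psi w, B 0%N psi w = psi w) ->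
  A i phi m = \sum_(a < i.+1) B (i - a)%N (quot A B a phi) m.
Proof. by move=> B0; rewrite big_ord_recr /= subnn B0 quotE addrC subrK. Qed.

(* The transpose of [X_(x,k)], given the [X_(y,k)] for [y < x].  If [(y, l) :: m'] is normal and
   [cov x k y], then [X_(x,k) X_(y,l) m'] is found by comparing the terms of index [k + l] in
   [P_x m' = P_(x/y) P_y m'], where [P_(x/y)] has degree [k]: its coefficients of index [i < k] only
   involve the [X_(y,a)] and the [X_(x,a)] with [a < k], and the latter concatenate on words starting
   with some [c <= y]. *)
Fixpoint Xin (Xf : T -> nat -> Fn -> Fn) (x : T) (k : nat) (phi : Fn) (m : seq blk) : F :=
  if k == 0%N then phi m else if (rk x < k)%N then 0 else
  if m is (y, l) :: m' then
    if cov x k y then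
      Xin Xf x (k + l) phi m'
      - \sum_(i < k) Xf y (k + l - i)%N (quot (Cop x) (Xf y) i phi) m'
      + \sum_(i < k) Xf y (k - i)%N (quot (Cop x) (Xf y) i phi) m
    else phi ((x, k) :: m)
  else phi [:: (x, k)].

(** Recursion on a bound for the rank: [Xn n x] is the intended operator as soon as [rk x <= n]. At
    rank 0 only [star] is meant, where [P_star = 1]. *)
Fixpoint Xn (n : nat) (x : T) : nat -> Fn -> Fn :=
  if n is n'.+1 then if (rk x <= n')%N then Xn n' x else Xin (Xn n') x
  else Cop x.

Definition Xop (x : T) : nat -> Fn -> Fn := Xn (rk x) x.

Lemma Xin_ext Xf Xf' x k phi m :
  (forall y, lt y x -> Xf y = Xf' y) -> Xin Xf x k phi m = Xin Xf' x k phi m.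
Proof.
move=> H; elim: m k => [|[y l] m IH] k //=.
by case: ifP => // _; case: ifP => // _; case: ifP => // /cov_lt /H e; rewrite IH e.
Qed.

Lemma XopE x k phi m : Xop x k phi m = Xin Xop x k phi m.
Proof.
have stab n y : (rk y <= n)%N -> Xn n y = Xop y.
  elim: n => [|n IH]; first by rewrite leqn0 /Xop => /eqP ->.
  by rewrite leq_eqVlt => /orP[/eqP|] h; rewrite /Xop ?h //= -ltnS h IH.
rewrite {1}/Xop; case e: (rk x) => [|n] /=.
  by case: m => [|[y l] m]; case: k => [|k]; rewrite /= /Cop /= ?e.
rewrite e ltnn; apply: Xin_ext => y yx; apply: stab.
by rewrite -ltnS -e rk_lt.
Qed.

Lemma X0 x phi m : Xop x 0 phi m = phi m.
Proof. by rewrite XopE; case: m. Qed.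

Lemma X_big x k phi m : (rk x < k)%N -> Xop x k phi m = 0.
Proof. by rewrite XopE => h; case: k h => // k h; case: m => [|u m] /=; rewrite h. Qed.

Lemma X_ncov x k phi m : ~~ hcov x k m -> Xop x k phi m = Cop x k phi m.
Proof.
rewrite XopE /Cop leqNgt; case: m => [|[y l] m] /=; first by case: ifP => // _; case: ifP.
by move=> /negbTE ->; case: ifP => // _; case: ifP.
Qed.

Lemma X_cons x k phi m : valid (x, k) -> ~~ hcov x k m -> Xop x k phi m = phi ((x, k) :: m).
Proof. by move=> /andP[/= h1 h2] h; rewrite X_ncov // /Cop h2 gtn_eqF. Qed.

Lemma X_cov x k y l phi m : cov x k y ->
  Xop x k phi ((y, l) :: m) = Xop x (k + l) phi m
      - \sum_(i < k) Xop y (k + l - i)%N (quot (Cop x) (Xop y) i phi) m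
      + \sum_(i < k) Xop y (k - i)%N (quot (Cop x) (Xop y) i phi) ((y, l) :: m).
Proof.
move=> h; rewrite XopE /= h; have /andP[k0 kx] := cov_gt0 h.
by rewrite gtn_eqF // ltnNge kx /= -XopE.
Qed.

Definition headle (z : T) (m : seq blk) : bool := if m is (c, _) :: _ then ple c z else false.

(** A head [c <= z] has rank at most [rk x - k], too low to be the end of a segment of length
    [i < k] from [x]. *)
Lemma headle_ncov z w x k i : headle z w -> cov x k z -> (i < k)%N -> ~~ hcov x i w.
Proof.
case: w => [|[c p] w] //= cz h ik; apply/negP => h'.
have := cov_rk h; rewrite (cov_rk h').
case/orP: cz => [/eqP ->|/rk_lt]; lia.
Qed.

Lemma headle_ple z w x : headle z w -> ple z x -> headle x w.
Proof. by case: w => [|[c p] w] //= h1 h2; apply: ple_trans h2. Qed.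

Definition linop (A : Fn -> Fn) : Prop :=
  forall a phi psi m, A (fun w => a * phi w + psi w) m = a * A phi m + A psi m.

Lemma linop0 A m : linop A -> A (fun _ => 0) m = 0.
Proof.
move=> lA; have := lA (-1) (fun _ => 0) (fun _ => 0) m.
rewrite (_ : (fun _ => _) = fun _ => 0); first by rewrite mulN1r addNr.
by apply: functional_extensionality => w; rewrite mulr0 addr0.
Qed.

Lemma linopB A phi psi m : linop A -> A (fun w => phi w - psi w) m = A phi m - A psi m.
Proof.
move=> lA; rewrite (_ : (fun w => _) = fun w => -1 * psi w + phi w) ?lA ?mulN1r 1?addrC //.
by apply: functional_extensionality => w; rewrite mulN1r addrC.
Qed.

Lemma linop_sum A (I : Type) (r : seq I) (P : pred I) (g : I -> Fn) m : linop A ->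
  A (fun w => \sum_(i <- r | P i) g i w) m = \sum_(i <- r | P i) A (g i) m.
Proof.
move=> lA; elim: r => [|i r IH].
  rewrite big_nil (_ : (fun w => _) = fun _ => 0) ?linop0 //.
  by apply: functional_extensionality => w; rewrite big_nil.
rewrite big_cons -IH; case: ifP => Pi.
  rewrite (_ : (fun w => _) = fun w => 1 * g i w + \sum_(i <- r | P i) g i w) ?lA ?mul1r //.
  by apply: functional_extensionality => w; rewrite big_cons Pi mul1r.
by congr A; apply: functional_extensionality => w; rewrite big_cons Pi.
Qed.

Lemma linop_comb A B : linop A -> linop B -> linop (fun phi => A (B phi)).
Proof.
move=> lA lB a phi psi m; rewrite -lA; congr A.
by apply: functional_extensionality => w; rewrite lB.
Qed.

Lemma quot_lin A B i : (forall j, (j <= i)%N -> linop (A j)) -> (forall j, linop (B j)) ->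
  linop (quot A B i).
Proof.
elim/ltn_ind: i => i IH lA lB a phi psi m; rewrite !quotE lA // mulrBr mulr_sumr.
rewrite addrACA -opprD -big_split; congr (_ - _); apply: eq_bigr => j _ /=.
rewrite -lB; congr (B _ _ _); apply: functional_extensionality => w.
by apply: IH => // j' h; apply: lA; have := ltn_ord j; lia.
Qed.

Lemma Cop_lin x k : linop (Cop x k).
Proof.
by move=> a phi psi m; rewrite /Cop; case: ifP => // _; case: ifP => // _; rewrite mulr0 addr0.
Qed.

Lemma X_lin x k : linop (Xop x k).
Proof.
elim/lt_wf_ind: x k => x IH k a phi psi m.
elim: m k => [|[y l] m IHm] k.
  by rewrite !X_ncov // Cop_lin.
case: (boolP (cov x k y)) => h; last by rewrite !X_ncov // Cop_lin.
have lq i : linop (quot (Cop x) (Xop y) i).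
  by apply: quot_lin => j *; [apply: Cop_lin | apply: IH (cov_lt h) _].
have lXq i j w : Xop y i (quot (Cop x) (Xop y) j (fun w => a * phi w + psi w)) w =
    a * Xop y i (quot (Cop x) (Xop y) j phi) w + Xop y i (quot (Cop x) (Xop y) j psi) w.
  by rewrite (linop_comb (IH _ (cov_lt h) _) (lq _)).
rewrite !X_cov // IHm.
under eq_bigr => i _ do rewrite lXq.
under [X in _ - _ + X]eq_bigr => i _ do rewrite lXq.
rewrite !big_split /= -!mulr_sumr; ring.
Qed.

(* [Xop z q], for [q > 0], is the transpose of an operator whose values are spanned by normal
   words starting with some [c <= z]. *)
Lemma X_local z q phi phi' : (0 < q)%N ->
  (forall w, normal w -> headle z w -> phi w = phi' w) ->
  forall m, normal m -> Xop z q phi m = Xop z q phi' m.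
Proof.
elim/lt_wf_ind: z q phi phi' => z IH q phi phi' q0 H m.
have hC k m' : (0 < k)%N -> ~~ hcov z k m' -> normal m' -> Cop z k phi m' = Cop z k phi' m'.
  move=> k0 h1 h2; rewrite /Cop gtn_eqF //; case: ifP => // kz; apply: H.
    by rewrite /= /valid /= k0 kz h1.
  by rewrite /= ple_refl.
elim: m q q0 => [|[y l] m IHm] q q0 nm; first by rewrite !X_ncov // hC.
case: (boolP (cov z q y)) => h; last by rewrite !X_ncov // hC.
have nm' : normal m by case/and3P: nm.
have hZ i : (i < q)%N -> forall w, normal w -> headle y w ->
    quot (Cop z) (Xop y) i phi w = quot (Cop z) (Xop y) i phi' w.
  elim/ltn_ind: i => i IHi iq w nw hw; rewrite !quotE; congr (_ - _).
    case: i iq {IHi} => [|i] iq; first by rewrite /Cop /= H // (headle_ple hw) // ltW // (cov_lt h).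
    by apply: hC => //; apply: headle_ncov h iq.
  apply: eq_bigr => a _; apply: IH; rewrite ?(cov_lt h) // ?subn_gt0 // => w' *.
  by apply: IHi => //; apply: ltn_trans iq.
rewrite !X_cov // IHm //; last by lia.
congr (_ - _ + _); apply: eq_bigr => i _;
  by apply: IH; rewrite ?(cov_lt h) //; [have := ltn_ord i; lia | move=> *; apply: hZ].
Qed.

Definition eqN phi psi := forall m, normal m -> phi m = psi m.

Lemma X_eqN z q phi phi' : eqN phi phi' -> eqN (Xop z q phi) (Xop z q phi').
Proof.
move=> H; case: q => [|q] m nm; first by rewrite !X0 H.
by apply: X_local => // w nw _; apply: H.
Qed.

Lemma X_zeroN z q phi : eqN phi (fun _ => 0) -> eqN (Xop z q phi) (fun _ => 0).
Proof. by move=> H m nm; rewrite (X_eqN _ _ H) // linop0 //; apply: X_lin. Qed.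

Lemma sum_triangle (G : nat -> nat -> F) i :
  \sum_(a < i.+1) \sum_(c < a.+1) G a c = \sum_(c < i.+1) \sum_(b < (i - c).+1) G (c + b)%N c.
Proof.
elim: i => [|i IH]; first by rewrite !big_ord1.
rewrite big_ord_recr IH [RHS]big_ord_recr /= subnn big_ord1 addn0.
rewrite [X in _ + X]big_ord_recr /= addrA; congr (_ + _).
rewrite -big_split; apply: eq_bigr => c _ /=.
have hc : (c <= i)%N by rewrite -ltnS ltn_ord.
rewrite subSn // [RHS]big_ord_recr /=; congr (_ + G _ _); lia.
Qed.

Local Notation Z x y := (quot (Xop x) (Xop y)).

Lemma Z_conv x y j phi m : Xop x j phi m = \sum_(a < j.+1) Xop y (j - a)%N (Z x y a phi) m.
Proof. by apply: quot_conv => *; apply: X0. Qed.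

(* [Dop] is the defect in [P_x = P_(x/y) P_y].  For [x > y > z] and
   [Q = P_(x/z) - P_(x/y) P_(y/z)], the defect is [Q P_z]; it vanishes on shorter words by
   induction, and its low terms vanish by definition on words starting below [z]. *)
Section Division.
Variable x : T.
Definition Dop y k j phi m :=
  Xop x j phi m - \sum_(i < j.+1 | (i <= k)%N) Xop y (j - i)%N (Z x y i phi) m.

Lemma D_small y k j phi m : (j <= k)%N -> Dop y k j phi m = 0.
Proof.
move=> jk; rewrite /Dop (Z_conv x y) big_mkcond [X in _ - X]big_mkcond -sumrB.
by apply: big1 => i _ /=; rewrite (leq_trans _ jk) ?subrr // -ltnS.
Qed.

Lemma D_sum y k j phi m :
  Dop y k j phi m = \sum_(i < j.+1 | (k < i)%N) Xop y (j - i)%N (Z x y i phi) m.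
Proof.
rewrite /Dop (Z_conv x y) (bigID (fun i : 'I_j.+1 => (i <= k)%N)) /= addrAC subrr add0r.
by apply: eq_bigl => i; rewrite ltnNge.
Qed.

(** This justifies [Cop x] in the definition of [Xin]: below index [k], on words headed below [y],
    the block at [x] absorbs nothing, so the provisional quotient is the true one. *)
Lemma Z_quotC y k i phi w : cov x k y -> (i < k)%N -> normal w -> headle y w ->
  Z x y i phi w = quot (Cop x) (Xop y) i phi w.
Proof.
move=> h; elim/ltn_ind: i w => i IH w ik nw hw; rewrite !quotE; congr (_ - _).
  by apply: X_ncov; apply: headle_ncov h ik.
apply: eq_bigr => a _; apply: X_local; rewrite ?subn_gt0 // => w' *.
by apply: IH => //; apply: ltn_trans ik.
Qed.

(** For [l <= rk y] the list [(y, l) :: w] is normal, and [X_cov] at this list is the present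
    identity solved for [X_(x,k)]. For [l > rk y] all terms lie beyond the degrees of [P_x] and
    [P_y]. *)
Lemma D_nhcov y k l phi w : cov x k y -> (0 < l)%N -> normal w -> ~~ hcov y l w ->
  Dop y k (k + l) phi w = 0.
Proof.
move=> h l0 nw hw; rewrite /Dop; case: (leqP l (rk y)) => ly; last first.
  rewrite X_big ?(cov_rk h); last by lia.
  by rewrite big1 ?subr0 // => i ik; rewrite X_big //; lia.
have nu : normal ((y, l) :: w) by rewrite /= hw nw /valid /= l0 ly.
have vy : valid (y, l) by rewrite /valid /= l0 ly.
rewrite -(@big_ord_widen _ _ _ k.+1 _ (fun i => Xop y (k + l - i)%N (Z x y i phi) w)); last by lia.
rewrite big_ord_recr /= addKn (X_cons _ vy hw) quotE X_cov //.
have e1 : \sum_(i < k) Xop y (k + l - i)%N (Z x y i phi) w =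
    \sum_(i < k) Xop y (k + l - i)%N (quot (Cop x) (Xop y) i phi) w.
  apply: eq_bigr => i _; apply: X_local => //; first by have := ltn_ord i; lia.
  by move=> w' n' h'; apply: Z_quotC h _ n' h'.
have e2 : \sum_(i < k) Xop y (k - i)%N (Z x y i phi) ((y, l) :: w) =
    \sum_(i < k) Xop y (k - i)%N (quot (Cop x) (Xop y) i phi) ((y, l) :: w).
  apply: eq_bigr => i _; apply: X_local => //; first by have := ltn_ord i; lia.
  by move=> w' n' h'; apply: Z_quotC h _ n' h'.
rewrite e1 e2; ring.
Qed.

Hypothesis IHx : forall y, lt y x -> forall z l, cov y l z ->
  forall i phi, (l < i)%N -> eqN (Z y z i phi) (fun _ => 0).

Definition Qop y z k i phi : Fn := fun m =>
  Z x z i phi m - \sum_(c < i.+1 | (c <= k)%N) Z y z (i - c)%N (Z x y c phi) m.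

Lemma Q_conv y z k i phi m :
  \sum_(a < i.+1) Xop z (i - a)%N (Qop y z k a phi) m = Dop y k i phi m.
Proof.
under eq_bigr => a _ do rewrite (linopB _ _ _ (X_lin z _)) (linop_sum _ _ _ _ (X_lin z _)).
rewrite sumrB -Z_conv; congr (_ - _).
under eq_bigr => a _ do rewrite big_mkcond /=.
rewrite (sum_triangle (fun a c => if (c <= k)%N then
  Xop z (i - a)%N (Z y z (a - c)%N (Z x y c phi)) m else 0)) [RHS]big_mkcond.
apply: eq_bigr => c _; case: ifP => _; last by rewrite big1.
rewrite (Z_conv y z); apply: eq_bigr => b _; rewrite addKn subnDA //.
Qed.

Lemma D_zero y k j phi m : cov x k y -> normal m -> Dop y k j phi m = 0.
Proof.
move: {2}_.+1 (ltnSn (size m)) => n; elim: n m y k j phi => // n IHn m y k j phi hn h nm.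
case: (leqP j k) => jk; first exact: D_small.
case: (boolP (hcov y (j - k) m)) => hm; last first.
  rewrite -(subnKC (ltnW jk)); apply: D_nhcov; rewrite ?subn_gt0 //.
have [z [p [v [em hz]]]] := hcov_cov hm; subst m; set l := (j - k)%N in hm hz.
have ej : j = (k + l)%N by rewrite /l subnKC // ltnW.
clearbody l.
have hxz : cov x j z by rewrite ej; apply: cov_trans hz.
have /and3P[vzp hv nv] := nm; rewrite /= in hn hv.
(* Below index [j] the defect vanishes on words headed below [z], because a block [(y, a - k)] with
   [a - k < l] cannot reach their heads. As [P_z] is monic, the coefficients of [Q] vanish there
   too. *)
have Q0 a w : (a < j)%N -> normal w -> headle z w -> Qop y z k a phi w = 0.
  elim/ltn_ind: a w => a IHa w aj nw hw.
  have : Dop y k a phi w = 0.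
    case: (leqP a k) => ak; first exact: D_small.
    rewrite -(subnKC (ltnW ak)); apply: D_nhcov; rewrite ?subn_gt0 //.
    by apply: headle_ncov hw hz _; rewrite ltn_subLR // -?ej // ltnW.
  rewrite -(Q_conv y z) big_ord_recr /= subnn X0 big1 ?add0r // => b _.
  rewrite (@X_local _ _ _ (fun _ => 0)) ?subn_gt0 // ?linop0 //; try exact: X_lin.
  by move=> w' *; apply: IHa => //; apply: ltn_trans aj.
have nz : headle z ((z, p) :: v) by rewrite /= ple_refl.
rewrite -(Q_conv y z) big_ord_recr /= subnn X0 big1 ?add0r => [|a _]; last first.
  rewrite (@X_local _ _ _ (fun _ => 0)) ?subn_gt0 // ?linop0 //; try exact: X_lin.
  by move=> w' *; apply: Q0.
(* Only [Q_j] at [(z, p) :: v] is left. It reappears as one term of the defect of index [j + p] at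
   the shorter word [v], which is zero by induction. *)
rewrite -(X_cons (Qop y z k j phi) vzp hv).
have := IHn v y k (j + p)%N phi hn h nv.
rewrite -(Q_conv y z) -addSn big_split_ord /= big_ord_recr /= addKn big1 ?add0r => [|a _]; last first.
  rewrite (@X_local _ _ _ (fun _ => 0)) // ?linop0 //; try exact: X_lin.
    by rewrite subn_gt0 (leq_trans (ltn_ord a)) ?leq_addr.
  by move=> w' *; apply: Q0.
suff -> : \sum_(i < p) Xop z (j + p - (j.+1 + i))%N (Qop y z k (j.+1 + i) phi) v = 0.
  by rewrite addr0.
(* For indices above [j] the products subtracted in [Q] vanish by [IHx]; these terms then form the
   defect of the pair [x], [z] at [v], zero by induction on the length. *)
have := IHn v z j (j + p)%N phi hn hxz nv.
rewrite D_sum -addSn big_split_ord /= big_pred0 ?add0r => [e|i]; last by apply/negbTE; rewrite -leqNgt -ltnS.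
rewrite -[RHS]e [RHS](eq_bigl (fun=> true)) => [|i]; last by rewrite leq_addr.
apply: eq_bigr => i _; apply: X_eqN => // w nw; rewrite /Qop big1 ?subr0 // => c ck.
apply: (IHx (cov_lt h) hz) => //; rewrite ltn_subRL.
by apply: (leq_ltn_trans (leq_add ck (leqnn l))); rewrite -ej addSn ltnS leq_addr.
Qed.

End Division.

(* [P_x(s)] is a left multiple of [P_y(s)]: the quotient series stops at degree [k = rk x - rk y]. *)
Lemma Z_zero x y k i phi : cov x k y -> (k < i)%N -> eqN (Z x y i phi) (fun _ => 0).
Proof.
elim/lt_wf_ind: x y k i phi => x IH y k i phi h.
elim/ltn_ind: i phi => i IHi phi ki m nm.
have := @D_zero x (fun y yx z l c i psi => IH y yx z l i psi c) y k i phi m h nm.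
rewrite D_sum big_mkcond big_ord_recr /= ki subnn X0 big1 ?add0r // => a _.
case: ifP => // ka; apply: X_zeroN => //; exact: IHi.
Qed.

End Operators.

(** * Words in the edges *)

Section EdgeWords.

Implicit Types (w s u v : seq E) (e : E).

Lemma erk_gt0 e : (0 < rk (esrc e))%N.
Proof. by case: e => [[x y] /= h]; rewrite /esrc /= (covers_rk h). Qed.

Lemma edge_cov e : cov (esrc e) 1 (etgt e).
Proof. by case: e => [[x y] /= h]; rewrite /cov (covers_lt h) /= addn1 (covers_rk h). Qed.

Lemma edge_valid e : valid (esrc e, 1%N).
Proof. by rewrite /valid /= erk_gt0. Qed.

Definition cls w : seq blk := foldr (fun e => ncons (esrc e) 1) [::] w.

Lemma cls_cat u v : cls (u ++ v) = nmul (cls u) (cls v).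
Proof. by elim: u => //= e u ->; rewrite nmul_ncons. Qed.

Lemma cls_normal w : normal (cls w).
Proof. by elim: w => //= e w IH; apply: ncons_normal => //; apply: edge_valid. Qed.

Lemma deg_cls w : deg (cls w) = size w.
Proof. by elim: w => //= e w IH; rewrite deg_ncons IH. Qed.

Lemma bwt1 x : bwt x 1 = rk x. Proof. by rewrite /bwt big_ord1 subn0. Qed.

Lemma wt_cons e w : wt (e :: w) = (rk (esrc e) + wt w)%N.
Proof. by rewrite /Defs.wt big_cons. Qed.

Lemma wt_cat u v : wt (u ++ v) = (wt u + wt v)%N.
Proof. by rewrite /Defs.wt big_cat. Qed.

Lemma wt_nil : wt [::] = 0%N. Proof. by rewrite /Defs.wt big_nil. Qed.

Lemma nwt_cls w : nwt (cls w) = wt w.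
Proof. by elim: w => [|e w IH]; rewrite ?wt_nil //= nwt_ncons IH bwt1 wt_cons. Qed.

Lemma cls_eq_nil w : (cls w == [::]) = (w == [::]).
Proof. by case: w => //= e w; apply/negbTE/ncons_neq0. Qed.

Definition mkedge x y (h : covers x y) : E := exist (fun p : T * T => covers p.1 p.2) (x, y) h.

Fixpoint ppath x s : bool := if s is e :: s' then (esrc e == x) && ppath (etgt e) s' else true.

Lemma epath_ppath b c s s' : epath b c s -> ppath c s' -> ppath b (s ++ s').
Proof. by elim: s b => [|e s IH] b /=; [move/eqP-> | case/andP=> -> /IH h /h]. Qed.

Lemma ppath_take b a s k : epath b a s -> ppath b (take k s).
Proof. by elim: s b k => [|e s IH] b [|k] //= /andP[-> h]; apply: IH h. Qed.

Lemma epath_size b a s : epath b a s -> rk b = (rk a + size s)%N.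
Proof.
elim: s b => [|e s IH] b /=; first by move/eqP->; rewrite addn0.
by case/andP=> /eqP <- /IH h; rewrite (cov_rk (edge_cov e)) h addn1 addnS.
Qed.

Lemma epath_ex x y : ple y x -> exists s : seq E, epath x y s.
Proof.
elim/lt_wf_ind: x => x IH /orP[/eqP ->|yx]; first by exists [::] => /=.
have [z xz yz] := lt_cover yx.
have [s hs] := IH _ (covers_lt xz) yz.
by exists (mkedge xz :: s) => /=; rewrite /esrc /etgt /= eqxx.
Qed.

Lemma epath_star x : exists s : seq E, epath x star s.
Proof. exact/epath_ex/star_ple. Qed.

Lemma cov_path x l y : cov x l y -> exists2 s : seq E, epath x y s & size s = l.
Proof.
move=> h; have [s hs] := epath_ex (ltW (cov_lt h)); exists s => //.
by have := epath_size hs; rewrite (cov_rk h); lia.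
Qed.

Lemma ppath_epath x s : ppath x s -> exists t : seq E, epath x star (s ++ t).
Proof.
elim: s x => [|e s IH] x /=; first by move=> _; have [t] := epath_star x; exists t.
by case/andP=> -> /IH[t h]; exists t.
Qed.

Lemma ppath_ex x l : (l <= rk x)%N -> exists2 s : seq E, ppath x s & size s = l.
Proof.
move=> lx; have [s hs] := epath_star x; exists (take l s); first exact: ppath_take hs.
rewrite size_take_min; apply/minn_idPl; have := epath_size hs.
rewrite rk_star.
by rewrite add0n => <-.
Qed.

Lemma ppath_size x s : ppath x s -> (size s <= rk x)%N.
Proof. by case/ppath_epath=> t /epath_size ->; rewrite size_cat; lia. Qed.

(* The classes are the congruence generated by the pairs of initial segments, of equal length,
   of paths with the same source: every word reduces to a product of canonical segments. *)
Lemma cls_gen (R : seq E -> seq E -> Prop) :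
  (forall w, R w w) -> (forall w w', R w w' -> R w' w) ->
  (forall w1 w2 w3, R w1 w2 -> R w2 w3 -> R w1 w3) ->
  (forall u v s s', R s s' -> R (u ++ s ++ v) (u ++ s' ++ v)) ->
  (forall x s s', ppath x s -> ppath x s' -> size s = size s' -> R s s') ->
  forall w w', cls w = cls w' -> R w w'.
Proof.
move=> R0 Rs Rt Rc Rp.
pose pth (b : T) (l : nat) : seq E := head [::] [seq s <- words (enum E) l | ppath b s].
have pthP b l : (l <= rk b)%N -> ppath b (pth b l) /\ size (pth b l) = l.
  move=> /ppath_ex[s hs ss].
  have : s \in [seq s <- words (enum E) l | ppath b s].
    rewrite mem_filter hs mem_words ss eqxx; apply/allP=> e _; by rewrite /= mem_enum.
  rewrite /pth; case e: [seq _ <- _ | _] => [//|s' r] _ /=.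
  have : s' \in [seq s <- words (enum E) l | ppath b s] by rewrite e inE eqxx.
  by rewrite mem_filter mem_words => /and3P[-> /eqP].
pose can (m : seq blk) := flatten (map (fun b : blk => pth b.1 b.2) m).
have Rcl s s' v : R s s' -> R (s ++ v) (s' ++ v) by move/(Rc [::] v).
have Rcr s s' u : R s s' -> R (u ++ s) (u ++ s') by move/(Rc u [::]); rewrite !cats0.
have H m x l : valid (x, l) -> normal m -> R (pth x l ++ can m) (can (ncons x l m)).
  elim: m l => [|[y p] m IH] l vl //= /and3P[vy _ nm].
  case: ifP => // h; have vlp := cov_valid h vy.
  apply: (Rt _ _ _ _ (IH _ vlp nm)); rewrite catA; apply: (Rcl).
  (* Since [cov x l y], the canonical segment of length [l] may be exchanged for one that ends at
     [y], which the segment at [y] continues. *)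
  have [q hq sq] := cov_path h.
  have [p1 s1] := pthP x l (proj2 (andP vl)).
  have [p2 s2] := pthP y p (proj2 (andP vy)).
  have [p3 s3] := pthP x (l + p)%N (proj2 (andP vlp)).
  apply: (Rt _ (q ++ pth y p)).
    have pq : ppath x q by rewrite -[q]cats0; apply: epath_ppath hq _.
    by apply: (Rcl); apply: (Rp x) => //; rewrite s1.
  by apply: (Rp x) => //; [apply: epath_ppath hq p2 | rewrite size_cat sq s2 s3].
suff C w : R w (can (cls w)) by move=> w w' e; apply: (Rt _ _ _ (C w)); rewrite e; apply/Rs/C.
elim: w => [|e w IH] //=; apply: (Rt _ _ _ _ (H _ _ _ (edge_valid e) (cls_normal w))).
have [p1 s1] := pthP (esrc e) 1%N (erk_gt0 e).
apply: (Rt _ (e :: can (cls w))); first exact: (Rcr _ _ [:: e] IH).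
by apply: (Rcl [:: e]); apply: (Rp (esrc e)); rewrite ?s1 //= eqxx.
Qed.

(* The product [u r v] in the tensor algebra. *)
Definition shift u (r : TW) v : TW := fun w =>
  let t := take (size w - size u - size v) (drop (size u) w) in
  if w == u ++ t ++ v then r t else 0.

Lemma shift_cat u r v t : shift u r v (u ++ t ++ v) = r t.
Proof.
rewrite /shift drop_size_cat // take_size_cat ?eqxx //.
by rewrite !size_cat; lia.
Qed.

Lemma shiftP u r v w : (exists t, w = u ++ t ++ v) \/ shift u r v w = 0.
Proof. by rewrite /shift; case: eqP => [->|_]; [left; eexists | right]. Qed.

Lemma shift_ext (P : TW) u r v : (forall t, P (u ++ t ++ v) = r t) ->
  (forall w, (forall t, w <> u ++ t ++ v) -> P w = 0) -> P = shift u r v.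
Proof.
move=> h1 h2; apply: functional_extensionality => w; rewrite /shift.
by case: eqP => [{1}->|n]; [apply: h1 | apply: h2 => t e; apply: n; rewrite {1}e; congr (_ ++ _);
  rewrite e drop_size_cat // take_size_cat // !size_cat; lia].
Qed.

Lemma tmul_shift u r v : tmul (tmul (mono u) r) (mono v) = shift u r v.
Proof.
have L w : tmul (mono u) r w = if take (size u) w == u then r (drop (size u) w) else 0.
  rewrite /tmul /Defs.mono; case: eqP => [e|n].
    have h : (size u < (size w).+1)%N by rewrite -{1}e size_take_min ltnS geq_minr.
    rewrite (bigD1 (Ordinal h)) //= e eqxx mul1r big1 ?addr0 // => k /eqP nk.
    case: eqP => [e'|_]; last by rewrite mul0r.
    case: nk; apply: val_inj; rewrite /= -e' size_take_min; apply/esym/minn_idPl.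
    by rewrite -ltnS.
  apply: big1 => k _; case: eqP => [e|_]; last by rewrite mul0r.
  by case: n; rewrite -{2}e -{1}e size_take_min (minn_idPl _) // -ltnS.
apply: shift_ext => [t|w hw].
  rewrite {1}/tmul catA; have h : (size (u ++ t) < (size ((u ++ t) ++ v)).+1)%N.
    by rewrite ltnS (size_cat _ v) leq_addr.
  rewrite (bigD1 (Ordinal h)) //= take_size_cat // drop_size_cat // L take_size_cat // eqxx.
  rewrite drop_size_cat // /Defs.mono eqxx mulr1 big1 ?addr0 // => k /eqP nk.
  case: eqP => [e|_]; last by rewrite mulr0.
  case: nk; apply: val_inj => /=; move: (nat_of_ord k) (ltn_ord k) e => n hn /(congr1 size).
  rewrite size_drop; move: hn; rewrite !size_cat ltnS => hn e.
  by rewrite -(subKn hn) e addnK.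
rewrite {1}/tmul; apply: big1 => k _; rewrite L /Defs.mono; case: eqP => [e1|_]; last by rewrite mul0r.
case: eqP => [e2|_]; last by rewrite mulr0.
by case: (hw (drop (size u) (take k w))); rewrite -e2 -{1}e1 catA !cat_take_drop.
Qed.

Lemma cat2_inj u v : injective (fun t : seq E => u ++ t ++ v).
Proof.
move=> t t' e; have := congr1 size e; rewrite !size_cat => /addnI/addIn st.
by move/eqP: e; rewrite eqseq_cat // eqxx /= eqseq_cat // => /andP[/eqP].
Qed.

Lemma shift_mono u s v : shift u (mono s) v = mono (u ++ s ++ v).
Proof.
apply/esym/shift_ext => [t|w hw]; rewrite /Defs.mono; last by case: eqP => // /hw.
by rewrite (inj_eq (@cat2_inj u v)).
Qed.

Lemma shift_comp u u' r v v' : shift u (shift u' r v') v = shift (u ++ u') r (v' ++ v).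
Proof.
apply: shift_ext => [t|w hw].
  rewrite -!catA (_ : u ++ u' ++ t ++ v' ++ v = u ++ (u' ++ t ++ v') ++ v) ?shift_cat //.
  by rewrite -!catA.
case: (shiftP u (shift u' r v') v w) => // -[t et]; subst w; rewrite shift_cat.
case: (shiftP u' r v' t) => // -[t' et]; subst t.
by case: (hw t'); rewrite -!catA.
Qed.

Lemma shift_add u v r r' :
  shift u (fun w => r w + r' w) v = fun w => shift u r v w + shift u r' v w.
Proof.
by apply: functional_extensionality => w; rewrite /shift; case: ifP => // _; rewrite addr0.
Qed.

Lemma shift_scale u v r (c : F) : shift u (fun w => c * r w) v = fun w => c * shift u r v w.
Proof.
by apply: functional_extensionality => w; rewrite /shift; case: ifP => // _; rewrite mulr0.
Qed.

Lemma shift_sub u v r r' :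
  shift u (fun w => r w - r' w) v = fun w => shift u r v w - shift u r' v w.
Proof.
by apply: functional_extensionality => w; rewrite /shift; case: ifP => // _; rewrite subr0.
Qed.

Lemma shift_zero u v : shift u (fun _ => 0) v = fun _ => 0.
Proof. by apply: functional_extensionality => w; rewrite /shift; case: ifP. Qed.

Lemma inspan_shift (G : TW -> Prop) u v y :
  inspan (fun y => exists u v r, G r /\ y = tmul (tmul (mono u) r) (mono v)) y ->
  inspan (fun y => exists u v r, G r /\ y = tmul (tmul (mono u) r) (mono v)) (shift u y v).
Proof.
elim=> [|f [u' [v' [r [hr ->]]]]|f g _ h1 _ h2|c f _ h].
- by rewrite shift_zero; apply: inspan0.
- apply: inspan_gen; exists (u ++ u'), (v' ++ v), r; split=> //.
  by rewrite !tmul_shift shift_comp.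
- by rewrite shift_add; apply: inspan_add.
- by rewrite shift_scale; apply: inspan_scale.
Qed.

Lemma sum_shift d u v r (G : seq E -> F) :
  \sum_(w <- words (enum E) d) shift u r v w * G w =
  if (size u + size v <= d)%N then
    \sum_(t <- words (enum E) (d - (size u + size v))) r t * G (u ++ t ++ v)
  else 0.
Proof.
have allE (w : seq E) : all (mem (enum E)) w by apply/allP=> e _; rewrite /= mem_enum.
case: leqP => h; last first.
  rewrite big_seq big1 // => w; rewrite mem_words => /andP[/eqP sw _].
  case: (shiftP u r v w) => [[t e]|->]; last by rewrite mul0r.
  by move: h; rewrite -sw e !size_cat ltnNge leq_add2l leq_addl.
rewrite (bigID (mem [seq u ++ t ++ v | t <- words (enum E) (d - (size u + size v))])) /=.
rewrite [X in _ + X]big1_seq ?addr0 => [|w /andP[hw]]; last first.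
  rewrite mem_words => /andP[/eqP sw _].
  case: (shiftP u r v w) => [[t e]|->]; last by rewrite mul0r.
  case/negP: hw; apply/mapP; exists t => //; rewrite mem_words allE andbT.
  by rewrite -sw e !size_cat addnCA addnK eqxx.
rewrite -big_filter (perm_big [seq u ++ t ++ v | t <- words (enum E) (d - (size u + size v))]) /=.
  by rewrite big_map; apply: eq_bigr => t _; rewrite shift_cat.
have inj := @cat2_inj u v.
apply: uniq_perm; rewrite ?filter_uniq ?words_uniq ?(map_inj_uniq inj) ?words_uniq ?enum_uniq //.
move=> w; rewrite mem_filter andb_idr //= => /mapP[t].
rewrite !mem_words !allE !andbT => /eqP st ->; by rewrite !size_cat st addnCA subnK.
Qed.

(** * Leading terms of the relations *)

Definition cnt s w := count (fun m => mask m s == w) (words [:: true; false] (size s)).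

Lemma esymE s j w : Defs.esym F s j w = if size w == j then (-1) ^+ j * (cnt s w)%:R else 0.
Proof.
rewrite /Defs.esym (card_tuple_words _ (fun m => mask m s == w)) /cnt.
suff /permP -> : perm_eq (words (enum {: bool}) (size s)) (words [:: true; false] (size s)) by [].
apply: uniq_perm; rewrite ?words_uniq ?enum_uniq // => m; rewrite !mem_words; congr andb.
by apply: eq_all => -[]; rewrite /= mem_enum.
Qed.

Lemma cnt_nil w : cnt [::] w = (w == [::]).
Proof. by rewrite /cnt /= eq_sym addn0. Qed.

Lemma cnt_cons e s w :
  cnt (e :: s) w = (cnt s w + (if w is e' :: w' then (e' == e) * cnt s w' else 0))%N.
Proof.
rewrite /cnt /= cats0 count_cat !count_map addnC.
congr (_ + _)%N; case: w => [|e' w].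
  by rewrite (eq_count (a2 := pred0)) ?count_pred0.
case: (eqVneq e' e) => [->|n].
  by rewrite mul1n; apply: eq_count => m; rewrite /= eqseq_cons eqxx.
by rewrite mul0n (eq_count (a2 := pred0)) ?count_pred0 // => m; rewrite /= eqseq_cons eq_sym (negbTE n).
Qed.

Lemma cnt0 s : cnt s [::] = 1%N.
Proof. by elim: s => [|e s IH]; rewrite ?cnt_nil // cnt_cons IH. Qed.

Lemma cls_ppath x s : ppath x s -> cls s = if s is [::] then [::] else [:: (x, size s)].
Proof.
elim: s x => //= e s IH x /andP[/eqP <- /IH ->]; case: s {IH} => //= e' s.
by rewrite edge_cov add1n.
Qed.

Lemma ppath_wt x s s' : ppath x s -> ppath x s' -> size s = size s' -> wt s = wt s'.
Proof.
move=> h h' e; rewrite -!nwt_cls (cls_ppath h) (cls_ppath h') -e.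
by case: s s' e {h h'} => [|? ?] [].
Qed.

(** Ranks are positive and drop along a path, so skipping the first edge lowers the weight of the
    first [n + 1] edges. *)
Lemma wt_take_lt x e s n : ppath x (e :: s) ->
  (wt (take n.+1 s) < rk (esrc e) + wt (take n s))%N.
Proof.
elim: s x e n => [|e2 s IH] x e n; first by rewrite /= !wt_nil addn0 erk_gt0.
move=> h; have /= /and3P[_ /eqP h2 h3] := h.
have r2 : rk (esrc e) = (rk (esrc e2)).+1 by rewrite (cov_rk (edge_cov e)) addn1 h2.
have {}IH := IH (esrc e2) e2.
case: n => [|n]; rewrite /= !wt_cons r2; first by rewrite take0 !wt_nil; lia.
by have := IH n; rewrite /= eqxx => /(_ h3); lia.
Qed.

Lemma cnt_wt x s w : ppath x s -> cnt s w != 0%N -> (wt w <= wt (take (size w) s))%N.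
Proof.
elim: s x w => [|e s IH] x w hs; first by rewrite cnt_nil; case: w.
case: w => [|e' w]; first by rewrite wt_nil.
have /= /andP[_ hs'] := hs; rewrite cnt_cons addn_eq0 negb_and.
case/orP => [/(IH _ _ hs')/leq_trans|].
  by apply; rewrite wt_cons; apply/ltnW/(wt_take_lt _ hs).
by case: (eqVneq e' e) => [->|//]; rewrite mul1n => /(IH _ _ hs'); rewrite !wt_cons leq_add2l.
Qed.

(* Among the subwords of a path of given length, its initial segment has the largest weight. *)
Lemma cnt_lead x s w : ppath x s -> (wt (take (size w) s) <= wt w)%N ->
  (size w <= size s)%N -> cnt s w = (w == take (size w) s).
Proof.
elim: s x w => [|e s IH] x w hs; first by rewrite cnt_nil; case: w.
case: w => [|e' w]; first by rewrite cnt0.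
have /= /andP[_ hs'] := hs => hw sw; rewrite cnt_cons.
have -> : cnt s (e' :: w) = 0%N.
  apply/eqP; apply: contraLR hw => /(cnt_wt hs') /= h; rewrite -ltnNge.
  by apply: (leq_ltn_trans h); rewrite wt_cons (wt_take_lt _ hs).
rewrite add0n eqseq_cons; case: eqP hw => [->|//]; rewrite !wt_cons leq_add2l => hw.
by rewrite mul1n (IH _ _ hs').
Qed.

Lemma Filbelow_subspace n : subspace (Filbelow n).
Proof.
have [I0 ID IZ] := inspan_subspace (fun y => exists (u v : seq E) (r : TW),
                     relgen r /\ y = tmul (tmul (mono u) r) (mono v)).
split.
- by exists (fun=> 0); split=> // w; rewrite eqxx.
- move=> f g [zf [If hf]] [zg [Ig hg]]; exists (fun w => zf w + zg w); split; first exact: ID.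
  move=> w; case: (eqVneq (f w) (zf w)) => [->|/hf //]; case: (eqVneq (g w) (zg w)) => [->|/hg //].
  by rewrite eqxx.
- move=> c f [zf [If hf]]; exists (fun w => c * zf w); split; first exact: IZ.
  by move=> w; case: (eqVneq (f w) (zf w)) => [->|/hf //]; rewrite eqxx.
Qed.

Lemma Filbelow_shift n y u v :
  Filbelow n y -> Filbelow (wt u + n + wt v) (shift u y v).
Proof.
case=> z [Iz hz]; exists (shift u z v); split; first exact: (inspan_shift u v Iz).
move=> w; rewrite /shift; case: (eqVneq w (u ++ _ ++ v)) => [e /hz h|_]; last by rewrite eqxx.
by rewrite e !wt_cat addnA ltn_add2r ltn_add2l.
Qed.

(** Complete both segments to paths from [x] to [star]. The relation between their elements of index
    [size s] has, up to a common sign, the leading terms [s] and [s']; all other subwords weigh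
    less. *)
Lemma ppath_Filbelow x s s' : ppath x s -> ppath x s' -> size s = size s' ->
  Filbelow (wt s) (fun w => mono s w - mono s' w).
Proof.
move=> h h' ss; have ww := ppath_wt h h' ss.
case: (Filbelow_subspace (wt s)) => S0 _ _.
case: s h ss ww S0 => [|e s0].
  case: s' h' => // _ _ _ _ S0; rewrite (_ : (fun w => _) = fun=> 0) //.
  by apply: functional_extensionality => w; rewrite subrr.
set s := e :: s0 => h ss ww _.
have [t ht] := ppath_epath h; have [t' ht'] := ppath_epath h'.
have lx : lt star x.
  have := star_ple x => /orP[/eqP xs|//]; move: h => /= /andP[/eqP ex _].
  by have := erk_gt0 e; rewrite ex -xs rk_star.
pose k := size s; pose r : TW := fun w => Defs.esym F (s ++ t) k w - Defs.esym F (s' ++ t') k w.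
exists (fun w => (-1) ^+ k * r w); split.
  apply: inspan_scale; apply: inspan_gen; exists [::], [::], r; split.
    by exists star, x, (s ++ t), (s' ++ t'), k; split; [exact: lx | exact: ht | exact: ht' | rewrite size_cat leq_addr | ].
  by rewrite tmul_shift; apply: shift_ext => [v|w /(_ w)]; rewrite ?cats0.
have pt p p' : epath x star (p ++ p') -> ppath x (p ++ p').
  by move=> H; rewrite -[_ ++ _]cats0; apply: epath_ppath H _.
have C p p' w : epath x star (p ++ p') -> size p = k -> (wt p <= wt w)%N ->
    (-1) ^+ k * Defs.esym F (p ++ p') k w = mono p w.
  move=> H sp hw; rewrite esymE /Defs.mono; case: eqP => [sw|n]; last first.
    by rewrite mulr0; case: eqP => // e1; case: n; rewrite e1.
  rewrite mulrA -exprD addnn -signr_odd odd_double expr0 mul1r.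
  rewrite (cnt_lead (pt _ _ H)) ?sw -?sp ?take_size_cat //.
  by rewrite size_cat leq_addr.
move=> w; apply: contraR; rewrite -leqNgt => hw; apply/eqP.
by rewrite /r mulrBr !C // -?ww // -ss.
Qed.

Lemma cls_Filbelow w w' : cls w = cls w' -> Filbelow (wt w) (fun v => mono w v - mono w' v).
Proof.
move=> e; suff [_ //] : wt w = wt w' /\ Filbelow (wt w) (fun v => mono w v - mono w' v).
refine (cls_gen (R := fun w w' => wt w = wt w' /\ Filbelow (wt w) (fun v => mono w v - mono w' v)) _ _ _ _ _ e) => {w w' e}.
- move=> w; split=> //; case: (Filbelow_subspace (wt w)) => S0 _ _.
  by rewrite (_ : (fun v => _) = fun=> 0) //; apply: functional_extensionality => v; rewrite subrr.
- move=> w w' [e h]; split=> //; case: (Filbelow_subspace (wt w)) => _ _ SZ; rewrite -e.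
  rewrite (_ : (fun v => _) = fun v => -1 * (mono w v - mono w' v)); first exact: SZ.
  by apply: functional_extensionality => v; rewrite mulN1r opprB.
- move=> w1 w2 w3 [e h] [e' h']; split; first by rewrite e.
  case: (Filbelow_subspace (wt w1)) => _ SD _; rewrite -e in h'.
  rewrite (_ : (fun v => _) = fun v => (mono w1 v - mono w2 v) + (mono w2 v - mono w3 v)); first exact: SD.
  by apply: functional_extensionality => v; rewrite addrA subrK.
- move=> u v s s' [e h]; rewrite !wt_cat e; split=> //.
  by have := Filbelow_shift u v h; rewrite shift_sub !shift_mono e addnA.
- move=> x s s' h h' ss; split; first exact: ppath_wt h h' ss.
  exact: ppath_Filbelow h h' ss.
Qed.

Definition upto (N : nat) : seq (seq E) := flatten [seq words (enum E) d | d <- iota 0 N.+1].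

Lemma mem_words_enum d w : (w \in words (enum E) d) = (size w == d).
Proof. by rewrite mem_words (_ : all _ _) ?andbT //; apply/allP => e _; rewrite /= mem_enum. Qed.

Lemma mem_upto N w : (w \in upto N) = (size w <= N)%N.
Proof.
apply/flatten_mapP/idP => [[d]|h]; first by rewrite mem_iota mem_words_enum => h /eqP ->.
by exists (size w); rewrite ?mem_iota ?mem_words_enum.
Qed.

Lemma upto_uniq N : uniq (upto N).
Proof.
rewrite /upto; elim: N.+1 0%N => //= n IH i.
rewrite cat_uniq words_uniq ?enum_uniq // IH andbT /=; apply/hasPn => w.
case/flatten_mapP=> d; rewrite mem_iota mem_words_enum => /andP[h _] /eqP sw.
by rewrite mem_words_enum sw; lia.
Qed.

(** Words of class [m] have length [deg m], so this is the sum over the whole fibre of [cls]. *)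
Definition csum (x : TW) (m : seq blk) : F := \sum_(w <- words (enum E) (deg m) | cls w == m) x w.

Lemma csum_upto x m N : \sum_(w <- upto N | cls w == m) x w = if (deg m <= N)%N then csum x m else 0.
Proof.
rewrite -big_filter; case: leqP => h; last first.
  rewrite big_seq big1 // => w; rewrite mem_filter mem_upto => /andP[/eqP e].
  by rewrite -(deg_cls w) e leqNgt h.
rewrite /csum -[RHS]big_filter; apply: perm_big; apply: uniq_perm; rewrite ?filter_uniq ?upto_uniq ?words_uniq ?enum_uniq //.
move=> w; rewrite !mem_filter mem_upto mem_words_enum; case: eqP => //= e.
by rewrite -e deg_cls eqxx -(deg_cls w) e h.
Qed.

(** Each weight component is a combination of differences of words with the same class, to which
    [cls_Filbelow] applies. *)
Lemma Kker_of_csum x : finsupp x -> (forall m, csum x m = 0) -> Kker x.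
Proof.
move=> fx cx; split=> // n; have [N hN] := fx.
apply: (subspace_classes (kap := cls) (s := upto N) (Filbelow_subspace n)).
- exact: upto_uniq.
- move=> w; rewrite mem_upto -ltnNge /wpart => /hN ->; by case: ifP.
- move=> a b _ _ e; rewrite /wpart; case: (eqVneq (wt a) n) => [<- _|]; last by rewrite eqxx.
  exact: cls_Filbelow.
- move=> k; case: (eqVneq (nwt k) n) => kn.
    rewrite (eq_bigr x) => [|w /eqP ek]; last by rewrite /wpart -nwt_cls ek kn eqxx.
    by rewrite csum_upto cx; case: ifP.
  by apply: big1 => w /eqP ek; rewrite /wpart -nwt_cls ek (negbTE kn).
Qed.

End EdgeWords.

(** * Linear independence of the normal words *)

Section Independence.

Implicit Types (w s u v : seq E) (e : E) (phi psi : Fn).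

Definition low (n : nat) phi := forall m, (nwt m < n)%N -> phi m = 0.

(** After [i] steps a path from [x] is still above the rank of [y], so continuing it is heavier than
    starting afresh at [y]. *)
Lemma bwt_split x y i q : (rk y + i < rk x)%N -> (0 < q)%N ->
  (bwt x i + bwt y q < bwt x (i + q))%N.
Proof.
move=> h q0; rewrite bwtD ltn_add2l /bwt; case: q q0 => // q _.
rewrite !big_ord_recl !subn0 -addSn leq_add //; first by lia.
by apply: leq_sum => j _; lia.
Qed.

(** Transposed, this says that [X_(x,k)] raises weights by at most [bwt x k]. *)
Lemma X_low x k n phi : low n phi -> low (n - bwt x k) (Xop x k phi).
Proof.
elim/lt_wf_ind: x k n phi => x IH k n phi lphi m.
elim: m k => [|[y l] m IHm] k; rewrite ltn_subRL => hm.
  by rewrite X_ncov // /Cop; case: ifP => _; [apply: lphi; lia|case: ifP => // _; apply: lphi].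
have [h|h] := boolP (cov x k y); last first.
  rewrite X_ncov // /Cop; case: ifP => _; [apply: lphi; lia | case: ifP => // _; exact: lphi].
have hy := cov_lt h; have rx := cov_rk h.
have lZ i : (i < k)%N -> low (n - bwt x i) (quot (Cop x) (Xop y) i phi).
  elim/ltn_ind: i => i IHi ik w; rewrite ltn_subRL => hw; rewrite quotE.
  rewrite /Cop big1 ?subr0 => [|a _].
    by case: ifP => _; [apply: lphi; lia | case: ifP => // _; apply: lphi].
  have ai := ltn_ord a.
  apply: (IH _ hy _ _ _ (IHi a ai (ltn_trans ai ik))); rewrite ltn_subRL ltn_subRL.
  have := @bwt_split x y a (i - a)%N; rewrite subnKC ?(ltnW ai) // subn_gt0 => /(_ _ ai).
  rewrite rx; lia.
have hm' : (bwt x k + bwt y l + nwt m < n)%N by move: hm; rewrite /nwt /= addnA.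
rewrite X_cov // IHm ?ltn_subRL ?(bwt_cov _ h) //.
rewrite !big1 ?subr0 ?addr0 // => i _; have ik := ltn_ord i.
  apply: (IH _ hy _ _ _ (lZ i ik)); rewrite ltn_subRL ltn_subRL.
  have := @bwt_split x y i (k - i)%N; rewrite subnKC ?(ltnW ik) // subn_gt0 => /(_ _ ik).
  rewrite rx; rewrite /nwt /= in hm *; lia.
apply: (IH _ hy _ _ _ (lZ i ik)); rewrite ltn_subRL ltn_subRL.
have := @bwt_split x y i (k + l - i)%N; rewrite subnKC; last by lia.
rewrite (bwt_cov _ h) rx; lia.
Qed.

(** Both correction sums of [X_cov] factor through a vertex of too low rank and lose weight
    strictly, so a [low] function does not see them. What remains is the recursion of [ncons]. *)
Lemma X_lead x k n phi m : low n phi -> valid (x, k) -> normal m ->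
  (bwt x k + nwt m <= n)%N -> Xop x k phi m = phi (ncons x k m).
Proof.
move=> lphi; elim: m k => [|[y l] m IHm] k vk nm hm; first by rewrite X_cons.
have [h|h] := boolP (cov x k y); last by rewrite X_cons //= (negbTE h).
have hy := cov_lt h; have rx := cov_rk h.
have lZ i : (i < k)%N -> low (n - bwt x i) (quot (Cop x) (Xop y) i phi).
  elim/ltn_ind: i => i IHi ik w; rewrite ltn_subRL => hw; rewrite quotE.
  rewrite /Cop big1 ?subr0 => [|a _].
    by case: ifP => _; [apply: lphi; lia | case: ifP => // _; apply: lphi].
  have ai := ltn_ord a.
  apply: (X_low (IHi a ai (ltn_trans ai ik))); rewrite ltn_subRL ltn_subRL.
  have := @bwt_split x y a (i - a)%N; rewrite subnKC ?(ltnW ai) // subn_gt0 => /(_ _ ai).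
  rewrite rx; lia.
have /and3P[vy _ nm'] := nm.
have hm' : (bwt x k + bwt y l + nwt m <= n)%N by move: hm; rewrite /nwt /= addnA.
rewrite X_cov //= h IHm ?(bwt_cov _ h) ?(cov_valid h vy) //.
rewrite !big1 ?subr0 ?addr0 // => i _; have ik := ltn_ord i.
  apply: (X_low (lZ i ik)); rewrite ltn_subRL ltn_subRL.
  have := @bwt_split x y i (k - i)%N; rewrite subnKC ?(ltnW ik) // subn_gt0 => /(_ _ ik).
  rewrite rx; rewrite /nwt /= in hm *; lia.
apply: (X_low (lZ i ik)); rewrite ltn_subRL ltn_subRL.
have := @bwt_split x y i (k + l - i)%N; rewrite subnKC; last by lia.
rewrite (bwt_cov _ h) rx; lia.
Qed.

(** For an edge from [x] to [y], the coefficients of index 1 in [P_x = (s - e) P_y] force [e] to act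
    as [X_(y,1) - X_(x,1)]. *)
Definition Eop e phi : Fn := fun m => Xop (etgt e) 1 phi m - Xop (esrc e) 1 phi m.

Fixpoint act w phi : Fn := if w is e :: w' then act w' (Eop e phi) else phi.

Lemma Eop_lin e : linop (Eop e).
Proof. by move=> a phi psi m; rewrite /Eop !X_lin //; ring. Qed.

Lemma act_lin w : linop (act w).
Proof.
elim: w => //= e w IH; exact: linop_comb IH (Eop_lin e).
Qed.

Lemma Eop_eqN e phi psi : eqN phi psi -> eqN (Eop e phi) (Eop e psi).
Proof. by move=> h m nm; rewrite /Eop !(X_eqN _ _ h). Qed.

Lemma act_eqN w phi psi : eqN phi psi -> eqN (act w phi) (act w psi).
Proof. by elim: w phi psi => //= e w IH phi psi /(Eop_eqN e)/IH. Qed.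

Lemma act_cat u v phi : act (u ++ v) phi = act v (act u phi).
Proof. by elim: u phi => //=. Qed.

Lemma Eop_lead e n phi m : low n phi -> normal m -> (rk (esrc e) + nwt m <= n)%N ->
  Eop e phi m = - phi (ncons (esrc e) 1 m).
Proof.
move=> lphi nm h; rewrite /Eop (X_lead (x := esrc e) lphi) ?edge_valid // ?bwt1 //.
rewrite (X_low lphi) ?sub0r // ltn_subRL bwt1; move: h.
by rewrite (cov_rk (edge_cov e)) addn1.
Qed.

Lemma Eop_low e n phi : low n phi -> low (n - rk (esrc e)) (Eop e phi).
Proof.
move=> lphi m hm; rewrite /Eop !(X_low lphi) ?subr0 // bwt1 //.
by move: hm; rewrite (cov_rk (edge_cov e)); lia.
Qed.

(** The sign arises because a block [(x, k)] represents an element [e(pi, k)], whose leading term is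
    [(-1)^k] times a product of edges. *)
Lemma act_lead w n phi m : low n phi -> normal m -> (wt w + nwt m <= n)%N ->
  act w phi m = (-1) ^+ size w * phi (nmul (cls w) m).
Proof.
elim: w n phi => [|e w IH] n phi lphi nm; first by rewrite mul1r.
rewrite wt_cons => h /=; rewrite (IH _ _ (Eop_low lphi)) //; last by lia.
rewrite (Eop_lead lphi); first by rewrite nmul_ncons // exprS mulN1r mulrN mulNr.
  by apply: nmul_normal => //; apply: cls_normal.
by rewrite nwt_nmul nwt_cls addnA.
Qed.

Definition esA s j psi : Fn := fun m =>
  \sum_(w <- words (enum E) j) Defs.esym F s j w * act w psi m.

Lemma esA0 s psi m : esA s 0 psi m = psi m.
Proof. by rewrite /esA /= big_seq1 esymE /= cnt0 !mul1r. Qed.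

Lemma esA_nil j psi m : esA [::] j.+1 psi m = 0.
Proof.
rewrite /esA big_seq big1 // => w; rewrite mem_words => /andP[/eqP sw _].
by rewrite esymE sw eqxx cnt_nil; case: w sw => // ? ? _; rewrite mulr0 mul0r.
Qed.

Lemma esA_cons e s j psi m :
  esA (e :: s) j.+1 psi m = esA s j.+1 psi m - esA s j (Eop e psi) m.
Proof.
rewrite /esA (eq_big_seq (fun w => Defs.esym F s j.+1 w * act w psi m +
  (if w is e' :: w' then if e' == e then - (Defs.esym F s j w' * act w psi m) else 0 else 0))).
  rewrite big_split /=; congr (_ + _).
  rewrite (sum_words_cons (enum E) j (fun w => if w is e' :: w' then
    if e' == e then - (Defs.esym F s j w' * act w psi m) else 0 else 0)).
  rewrite (bigD1_seq e) ?mem_enum ?enum_uniq //= [X in _ + X]big1 ?addr0 => [|e' ne].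
    by rewrite -sumrN; apply: eq_bigr => w _; rewrite eqxx.
  by rewrite big1 // => w _; rewrite (negbTE ne).
case=> [|e' w]; rewrite mem_words => /andP[/eqP //= sw _].
case: sw => sw; rewrite !esymE /= sw !eqxx cnt_cons.
case: (eqVneq e' e) => [_|_]; last by rewrite mul0n addn0 addr0.
by rewrite mul1n natrD exprS; ring.
Qed.

(* The transposed form of [(s - e_1)...(s - e_n) P_a(s) = P_b(s)]. *)
Lemma epath_esA b a s j psi : epath b a s -> forall m, normal m ->
  Xop b j psi m = \sum_(i < j.+1) Xop a (j - i)%N (esA s i psi) m.
Proof.
elim: s b j psi => [|e s IH] b j psi /=.
  move/eqP=> <- m nm; rewrite big_ord_recl subn0 big1 ?addr0 => [|i _].
    by apply: X_eqN => // w _; rewrite esA0.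
  by apply: X_zeroN => // w _; rewrite esA_nil.
case/andP=> /eqP <- hs m nm; have ce := edge_cov e.
case: j => [|j]; first by rewrite big_ord1 !X0 // esA0.
(* By [Z_zero] with [k = 1], this quotient series has only two coefficients, the identity and the
   action of [- e]. *)
rewrite (Z_conv (esrc e) (etgt e)).
rewrite [in LHS]big_ord_recl [in LHS]big_ord_recl /= [X in _ + (_ + X)]big1 ?addr0 => [|i _]; last first.
  by apply: X_zeroN => //; apply: (Z_zero _ ce).
rewrite /bump /= add1n !subSS !subn0.
have -> : Xop (etgt e) j.+1 (quot (Xop (esrc e)) (Xop (etgt e)) 0 psi) m = Xop (etgt e) j.+1 psi m.
  by apply: X_eqN => // w _; rewrite quotE big_ord0 subr0 X0.
have -> : Xop (etgt e) j (quot (Xop (esrc e)) (Xop (etgt e)) 1 psi) m =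
    Xop (etgt e) j (fun q => -1 * Eop e psi q + 0) m.
  apply: X_eqN => // w nw; rewrite quotE big_ord1 /= subn0 /Eop mulN1r addr0 opprB.
  by congr (_ - _); apply: X_eqN => // w' _; rewrite quotE big_ord0 subr0 X0.
rewrite X_lin // linop0 ?addr0; last by apply: X_lin.
rewrite (IH _ _ _ hs _ nm) (IH _ j _ hs _ nm) mulN1r.
rewrite big_ord_recl [RHS]big_ord_recl -addrA; congr (_ + _).
  by apply: X_eqN => // w _; rewrite !esA0.
rewrite -sumrB; apply: eq_bigr => i _; rewrite /= /bump /= ?add1n ?subSS.
rewrite -linopB; last by apply: X_lin.
by apply: X_eqN => // w nw; rewrite esA_cons.
Qed.

(** [P_a] is monic, so the left factor in [epath_esA] is determined coefficient by coefficient by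
    [P_b] and [P_a], which do not know the path. *)
Lemma esA_path_indep b a s s' j : epath b a s -> epath b a s' ->
  forall psi, eqN (esA s j psi) (esA s' j psi).
Proof.
move=> hs hs'; elim/ltn_ind: j => j IH psi m nm.
have := epath_esA j psi hs nm; rewrite (epath_esA j psi hs' nm) !big_ord_recr /= subnn !X0 //.
rewrite (eq_bigr (fun i : 'I_j => Xop a (j - i)%N (esA s i psi) m)) => [/addrI -> //|i _].
by apply: X_eqN => // w nw; rewrite IH.
Qed.

Lemma Iset_act z d phi m : Iset z -> normal m ->
  \sum_(w <- words (enum E) d) z w * act w phi m = 0.
Proof.
move=> Iz nm; elim: Iz => [|f [u [v [r [[a [b [s [s' [j [_ hs hs' _ ->]]]]]] ->]]]]|f g _ hf _ hg|c f _ hf].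
- by rewrite big1 // => w _; rewrite mul0r.
- rewrite tmul_shift sum_shift; case: ifP => // h.
  set d' := (d - _)%N; case: (eqVneq d' j) => [->|dj]; last first.
    rewrite big_seq big1 // => w; rewrite mem_words => /andP[/eqP sw _].
    by rewrite !esymE sw (negbTE dj) subrr mul0r.
  under eq_bigr => w _ do rewrite act_cat act_cat mulrBl.
  rewrite sumrB; apply/eqP; rewrite subr_eq0; apply/eqP.
  have H p : \sum_(w <- words (enum E) j) Defs.esym F p j w * act v (act w (act u phi)) m =
      act v (esA p j (act u phi)) m.
    rewrite /esA (linop_sum _ _ _ _ (act_lin v)); apply: eq_bigr => w _.
    have := act_lin v (Defs.esym F p j w) (act w (act u phi)) (fun=> 0) m.
    rewrite (linop0 _ (act_lin v)) addr0 => <-; congr act.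
    by apply: functional_extensionality => w'; rewrite addr0.
  by rewrite !H; apply: act_eqN => //; apply: esA_path_indep hs hs' _.
- by under eq_bigr => w _ do rewrite mulrDl; rewrite big_split /= hf hg addr0.
- by under eq_bigr => w _ do rewrite -mulrA; rewrite -mulr_sumr hf mulr0.
Qed.

(** Let words act on the indicator of [m] and evaluate at the empty word. The ideal gives 0, words
    lighter than [m] give 0, and words of the weight of [m] give a sign times the test
    [cls w == m]. *)
Lemma csum_of_Kker (x : TW) m : Kker x -> csum x m = 0.
Proof.
case=> _ /(_ (nwt m)) [z [Iz hz]].
pose phi : Fn := fun m' => (m' == m)%:R.
have lphi : low (nwt m) phi.
  by move=> m' h; rewrite /phi; case: eqP => // e; rewrite e ltnn in h.
have L w : (wt w <= nwt m)%N -> act w phi [::] = (-1) ^+ size w * (cls w == m)%:R.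
  by move=> h; rewrite (act_lead lphi) ?addn0 // nmulm0 ?cls_normal.
have := Iset_act (deg m) phi Iz (isT : normal [::]).
rewrite (eq_bigr (fun w => wpart (nwt m) x w * act w phi [::])) => [H|w _]; last first.
  case: (eqVneq (wpart (nwt m) x w) (z w)) => [-> //|/hz h].
  rewrite L ?(ltnW h) //; case: eqP => [e|_]; last by rewrite !mulr0.
  by move: h; rewrite -e nwt_cls ltnn.
suff : (-1) ^+ deg m * csum x m = 0 by move/eqP; rewrite mulf_eq0 signr_eq0 => /eqP.
rewrite /csum big_mkcond mulr_sumr -[RHS]H; apply: eq_big_seq => w.
rewrite mem_words => /andP[/eqP sw _]; rewrite /wpart.
case: (eqVneq (wt w) (nwt m)) => [e|ne].
  by rewrite L ?e // sw; case: eqP => _; rewrite ?mulr1 ?mulr0 // mulrC.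
rewrite mul0r; case: eqP => [e|]; last by rewrite mulr0.
by move: ne; rewrite -e nwt_cls eqxx.
Qed.

End Independence.

(** * Quadraticity and uniformity *)

Section Quadratic.

Implicit Types (w s u v : seq E) (e : E).

Lemma covers_cov x y : covers x y = cov x 1 y.
Proof. by rewrite /cov addn1. Qed.

Lemma edge_covers e : covers (esrc e) (etgt e).
Proof. by rewrite covers_cov edge_cov. Qed.

Lemma csum_mono w m : csum (mono w) m = (cls w == m)%:R.
Proof.
rewrite /csum big_mkcond (eq_big_seq (fun v => if v == w then (cls w == m)%:R else 0)) /=; last first.
  by move=> v _; rewrite /Defs.mono; case: (eqVneq v w) => [->|_]; case: ifP.
rewrite -big_mkcond -big_filter.
case: (boolP (w \in words (enum E) (deg m))) => hw.
  by rewrite (eq_filter (a2 := pred1 w)) // filter_pred1_uniq ?words_uniq ?enum_uniq // big_seq1.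
rewrite big_seq big1 => [|v]; last by rewrite mem_filter => /andP[/eqP -> /(negP hw)].
by case: eqP => // e; move: hw; rewrite mem_words_enum -e deg_cls eqxx.
Qed.

Lemma csumB (x y : TW) m : csum (fun w => x w - y w) m = csum x m - csum y m.
Proof. by rewrite /csum sumrB. Qed.

Lemma finsupp_mono w w' : finsupp (fun v => mono w v - mono w' v : F).
Proof.
exists (maxn (size w) (size w')) => v; rewrite gtn_max /Defs.mono => /andP[h h'].
have -> : (v == w) = false by apply: contraTF h => /eqP ->; rewrite ltnn.
by have -> : (v == w') = false by [apply: contraTF h' => /eqP ->; rewrite ltnn]; rewrite subrr.
Qed.

Lemma Kker_mono w w' : cls w = cls w' -> Kker (fun v => mono w v - mono w' v).
Proof.
move=> e; apply: Kker_of_csum => //; first exact: finsupp_mono.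
by move=> m; rewrite csumB !csum_mono e subrr.
Qed.

Lemma Kdeg_mono w w' : cls w = cls w' -> Kdeg (size w) (fun v => mono w v - mono w' v).
Proof.
move=> e; split; first exact: Kker_mono.
have sw : size w' = size w by rewrite -(deg_cls w) -(deg_cls w') e.
move=> v hv; rewrite /Defs.mono.
have -> : (v == w) = false by apply: contraNF hv => /eqP ->.
have -> : (v == w') = false by apply: contraNF hv => /eqP ->; rewrite sw.
by rewrite subrr.
Qed.

Definition Qspan : TW -> Prop :=
  inspan (fun y => exists (u v : seq E) (r : TW),
               (Kdeg 1 r \/ Kdeg 2 r) /\ y = tmul (tmul (mono u) r) (mono v)).

Definition Qrel w w' := Qspan (fun v => mono w v - mono w' v).

Lemma Qspan_subspace : subspace Qspan. Proof. exact: inspan_subspace. Qed.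

Lemma Qrel_refl w : Qrel w w.
Proof.
have [Q0 _ _] := Qspan_subspace; rewrite /Qrel (_ : (fun v => _) = fun=> 0) //.
by apply: functional_extensionality => v; rewrite subrr.
Qed.

Lemma Qrel_sym w w' : Qrel w w' -> Qrel w' w.
Proof.
have [_ _ QZ] := Qspan_subspace; rewrite /Qrel => /(QZ (-1)).
rewrite (_ : (fun v => -1 * _) = fun v => mono w' v - mono w v) //.
by apply: functional_extensionality => v; rewrite mulN1r opprB.
Qed.

Lemma Qrel_trans w1 w2 w3 : Qrel w1 w2 -> Qrel w2 w3 -> Qrel w1 w3.
Proof.
have [_ QD _] := Qspan_subspace; rewrite /Qrel => h /(QD _ _ h).
rewrite (_ : (fun v => _ + _) = fun v => mono w1 v - mono w3 v) //.
by apply: functional_extensionality => v; rewrite addrA subrK.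
Qed.

Lemma Qrel_cat u v s s' : Qrel s s' -> Qrel (u ++ s ++ v) (u ++ s' ++ v).
Proof.
by move=> /(inspan_shift u v); rewrite shift_sub !shift_mono.
Qed.

Lemma Qrel_small s s' : cls s = cls s' -> (0 < size s <= 2)%N -> Qrel s s'.
Proof.
move=> e hs; apply: inspan_gen; exists [::], [::], (fun v => mono s v - mono s' v); split.
  have := Kdeg_mono e; case: (size s) hs => [|[|[|]]] // _ h; by [left | right].
by rewrite tmul_shift shift_sub !shift_mono !cats0.
Qed.

Lemma ppath_cls x s s' : ppath x s -> ppath x s' -> size s = size s' -> cls s = cls s'.
Proof.
move=> h h'; rewrite (cls_ppath h).
rewrite (cls_ppath h').
by case: s s' {h h'} => [|? ?] [|? ?] //= ->.
Qed.

(** The first target is moved along a chain of [simrel]: if [a] and [c] cover [d], reroute the tail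
    through [d] by induction on the length, then exchange the first two edges by a quadratic
    relation. *)
Lemma Qrel_ppath : uniform lt star ->
  forall x s s', ppath x s -> ppath x s' -> size s = size s' -> Qrel s s'.
Proof.
move=> U x s s' hs hs' ss; move en : (size s) => n.
elim: n x s s' hs hs' ss en => [|n IH] x s s' hs hs' ss en.
  by case: s s' ss en {hs hs'} => [|//] [|//] _ _; apply: Qrel_refl.
case: n IH en => [|n] IH en.
  by apply: Qrel_small; rewrite ?en //; apply: ppath_cls hs hs' ss.
case: s s' hs hs' ss en => [//|e s] [//|e' s'] /= /andP[/eqP ex hs] /andP[/eqP ex' hs'] [ss] [en].
have xs : x != star by rewrite -rk_gt0 -ex erk_gt0.
have [_ _ /(_ (etgt e) (etgt e'))] := U x xs.
rewrite !inE -ex edge_covers ex -ex' edge_covers => /(_ isT isT) /connectP[p].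
rewrite ex'; clear xs; move ea : (etgt e) => a; rewrite ea in hs.
have same f f' t t' : esrc f = x -> esrc f' = x -> etgt f = etgt f' ->
    ppath (etgt f) t -> ppath (etgt f') t' -> size t = n.+1 -> size t' = n.+1 -> Qrel (f :: t) (f' :: t').
  move=> fx f'x ff ht ht' st st'; apply: (@Qrel_trans _ (f :: t')).
    rewrite -ff in ht'; have := Qrel_cat [:: f] [::] (IH _ _ _ ht ht' (etrans st (esym st')) st).
    by rewrite !cats0.
  apply: (@Qrel_cat [::] t' [:: f] [:: f']); apply: Qrel_small => //=.
  by rewrite fx f'x.
elim: p a e s ex ea hs ss en => [|c p IHp] a e s ex ea hs ss en /=.
  by move=> _ e1; apply: same => //; rewrite ?ea ?e1 -?ss.
case/andP=> /and3P[_ hc /existsP[d /andP[ad cd]]] hp hl.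
have xc : covers x c by rewrite inE in hc.
pose f' := mkedge xc; pose g := mkedge ad; pose g' := mkedge cd.
have [t ht st] : exists2 t : seq E, ppath d t & size t = n.
  apply: ppath_ex => //; have := ppath_size hs.
  by rewrite en (covers_rk ad).
have ht1 : ppath a (g :: t) by rewrite /= ht /g /esrc /= eqxx.
have ht2 : ppath c (g' :: t) by rewrite /= ht /g' /esrc /= eqxx.
apply: (@Qrel_trans _ (e :: g :: t)); first by apply: same; rewrite ?ea //= st.
apply: (@Qrel_trans _ (f' :: g' :: t)); last first.
  by apply: (IHp c) => //=; rewrite ?st -?ss ?en.
apply: (@Qrel_cat [::] t [:: e; g] [:: f'; g']); apply: Qrel_small => //.
apply: (@ppath_cls x) => //=; first by rewrite ex ea /g /esrc /= !eqxx.
by rewrite /f' /g' /esrc /etgt /= !eqxx.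
Qed.

Lemma uniform_quadratic : uniform lt star -> quadratic F lt star.
Proof.
move=> U x Kx; have [[N hN] _] := Kx.
apply: (subspace_classes (kap := cls) (s := upto N) Qspan_subspace).
- exact: upto_uniq.
- by move=> w; rewrite mem_upto -ltnNge => /hN.
- move=> a b _ _ e _; apply: (cls_gen (R := Qrel)) e.
  + exact: Qrel_refl.
  + exact: Qrel_sym.
  + exact: Qrel_trans.
  + exact: Qrel_cat.
  + exact: Qrel_ppath.
- move=> k; rewrite csum_upto csum_of_Kker //.
  by case: ifP.
Qed.

(* Counting the words satisfying [below x a] is a linear form that kills the quadratic relations. *)
Definition below (x a : T) w : bool :=
  if map (@esrc _ _ _) w is [:: y; z; t] then
    [&& y == x, z \in S1 x &
        [exists a', [&& a' \in S1 x, connect (simrel x) a a' & covers a' t]]]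
  else false.

(** A relation of degree at most 2 keeps the first source and changes the second only when both
    versions are covered by the first. If this happens at the third vertex, the last clause of
    [below] amounts to [connect] up to the second vertex. *)
Lemma below_cls x a u v t t' : (0 < size t <= 2)%N -> cls t = cls t' ->
  below x a (u ++ t ++ v) = below x a (u ++ t' ++ v).
Proof.
move=> ht et; have st : size t' = size t by rewrite -(deg_cls t) -(deg_cls t') et.
case: t t' ht et st => [|e [|f [|? t]]] // [|e' [|f' [|? t']]] // _.
  by move=> /= [ee] _; rewrite /below !map_cat /= ee.
move=> /= et _; have [ee ef] : esrc e = esrc e' /\
    (esrc f = esrc f' \/ covers (esrc e) (esrc f) /\ covers (esrc e) (esrc f')).
  move: et; case: ifP => h; case: ifP => h' [e1] //.
    by rewrite !covers_cov e1 h' -e1 h; split=> //; right.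
  by move=> e2; split=> //; left.
rewrite /below !map_cat /= -ee {ee et}.
case: (map _ u) => [|u1 [|u2 [|u3 us]]] //=; case: (map _ v) => [|v1 [|v2 vs]] //=.
  case: ef => [->//|[h1 h2]]; case: (eqVneq (esrc e) x) => //= ex.
  by rewrite !inE -ex h1 h2.
case: ef => [->//|[h1 h2]]; case: (u1 == x) => //=; case: (boolP (_ \in _)) => //= eS.
have H f0 : covers (esrc e) (esrc f0) ->
    [exists a', [&& a' \in S1 x, connect (simrel x) a a' & covers a' (esrc f0)]] = connect (simrel x) a (esrc e).
  move=> h; apply/existsP/idP => [[a' /and3P[h3 h4 h5]]|h3]; last by exists (esrc e); rewrite eS h3.
  apply: connect_trans h4 _; apply: connect1; rewrite /Defs.simrel h3 eS /=.
  by apply/existsP; exists (esrc f0); rewrite h5.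
  by rewrite !H.
all: by case: us.
Qed.

Lemma quadratic_uniform : quadratic F lt star -> uniform lt star.
Proof.
move=> Qd x xs.
have lt_sx : lt star x.
  by have := star_ple x; rewrite /ple eq_sym (negbTE xs).
have cov_ex z y : lt z y -> exists y', covers y y' by case/lt_cover=> y'; exists y'.
have [a0 ha0] := cov_ex _ _ lt_sx; exists a0; first by rewrite inE.
move=> a b; rewrite !inE => ha hb.
have rab : rk a = rk b by have := covers_rk ha; rewrite (covers_rk hb) => -[].
have rk0 y : rk y = 0%N -> y = star by move/eqP; rewrite rk_eq0 // => /eqP.
have rkp y : (0 < rk y)%N -> exists y', covers y y'.
  move=> h; apply: (cov_ex star); have := star_ple y.
  by rewrite /ple; case: eqP => // e; move: h; rewrite -e rk_star.
case: (posnP (rk a)) => [ra|ra].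
  by rewrite (rk0 a) // (rk0 b) -?rab.
have [c hc] := rkp a ra; have [d hd] := rkp b (eq_ind _ (fun n => 0 < n)%N ra _ rab).
have rcd : rk c = rk d by move: rab; rewrite (covers_rk hc) (covers_rk hd) => -[].
have step y z t : y \in S1 x -> z \in S1 x -> covers y t -> covers z t -> connect (simrel x) y z.
  move=> h1 h2 h3 h4; apply: connect1; rewrite /Defs.simrel h1 h2 /=.
  by apply/existsP; exists t; rewrite h3.
case: (posnP (rk c)) => [rc|rc].
  have e : c = d by rewrite (rk0 c) // (rk0 d) // -rcd.
  by apply: (step _ _ c); rewrite ?inE // e.
have [c1 hc1] := rkp c rc; have [d1 hd1] := rkp d (eq_ind _ (fun n => 0 < n)%N rc _ rcd).
(* [below] reads only sources; the third edge serves to make [c] visible as one. *)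
pose w := [:: mkedge ha; mkedge hc; mkedge hc1].
pose w' := [:: mkedge hb; mkedge hd; mkedge hd1].
have ew : cls w = cls w'.
  by apply: (@ppath_cls x); rewrite //= /esrc /etgt /= !eqxx.
have := Qd _ (Kker_mono ew).
have [N eN] : exists N : nat, N = 3 by exists 3.
have H y : inspan (fun y => exists (u v : seq E) (r : TW),
    (Kdeg 1 r \/ Kdeg 2 r) /\ y = tmul (tmul (mono u) r) (mono v)) y ->
    \sum_(w <- words (enum E) N) y w * (below x a w)%:R = 0.
  elim=> [|f [u [v [r [hr ->]]]]|f g _ hf _ hg|k f _ hf].
  - by rewrite big1 // => t _; rewrite mul0r.
  - rewrite tmul_shift sum_shift; case: ifP => // _; set n := (N - _)%N.
    have [l [l0 Kr]] : exists l, (0 < l <= 2)%N /\ Kdeg l r by case: hr => h; [exists 1%N | exists 2].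
    case: Kr => Kr hl; case: (eqVneq n l) => [nl|nl]; last first.
      rewrite big_seq big1 // => t; rewrite mem_words_enum => /eqP st.
      by rewrite hl ?mul0r // st.
    apply: (class_sum0 (kap := cls)) => [t t'|m].
      rewrite !mem_words_enum => /eqP st _ et; congr (_ %:R); congr nat_of_bool.
      by apply: below_cls; rewrite // st nl.
    case: (eqVneq n (deg m)) => [->|nm].
      exact: csum_of_Kker.
    rewrite big_seq_cond big1 // => t; rewrite mem_words_enum => /andP[/eqP st /eqP et].
    by move: nm; rewrite -et deg_cls st eqxx.
  - by under eq_bigr => t _ do rewrite mulrDl; rewrite big_split /= hf hg addr0.
  - by under eq_bigr => t _ do rewrite -mulrA; rewrite -mulr_sumr hf mulr0.
move/H; under eq_bigr => t _ do rewrite mulrBl.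
have S t : size t = N -> \sum_(v <- words (enum E) N) mono t v * (below x a v)%:R = (below x a t)%:R.
  move=> st; rewrite (bigD1_seq t) ?words_uniq ?enum_uniq ?mem_words_enum ?st //=.
  rewrite /Defs.mono eqxx mul1r big1 ?addr0 // => v /negbTE ->; by rewrite mul0r.
have sw : size w = N by rewrite eN.
have sw' : size w' = N by rewrite eN.
have bw : below x a w.
  by rewrite /below /= eqxx !inE ha /=; apply/existsP; exists a; rewrite inE ha hc connect0.
have bw' : below x a w' -> connect (simrel x) a b.
  rewrite /below /= => /and3P[_ _ /existsP[a' /and3P[h1 h2 h3]]].
  by apply: connect_trans h2 (step _ _ d h1 _ h3 hd); rewrite inE.
clearbody w w'; rewrite sumrB (S _ sw) (S _ sw') bw; case: (below x a w') bw' => [-> //|_].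
by move/eqP; rewrite subr0 oner_eq0.
Qed.

End Quadratic.

(** * The bar complex and its dual *)

Section Bar.

Implicit Types (ws us vs : seq (seq E)) (w : seq E) (x y z : BT) (f g : seq K -> F).

Definition bw (i j : nat) : seq (seq (seq E)) :=
  [seq ws <- words (upto j) i | all (fun w => w != [::]) ws && (sumn (map size ws) == j)].

Lemma mem_bw i j ws : (ws \in bw i j) =
  [&& size ws == i, all (fun w => w != [::]) ws & sumn (map size ws) == j].
Proof.
rewrite mem_filter mem_words andbC -!andbA; congr andb; rewrite andb_idl // => /andP[_ /eqP <-].
apply/allP => v; rewrite /= mem_upto; elim: ws => //= w ws IH; rewrite inE.
by case/orP => [/eqP ->|/IH h]; [exact: leq_addr | apply: leq_trans h (leq_addl _ _)].
Qed.

Lemma bw_uniq i j : uniq (bw i j).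
Proof. by apply/filter_uniq/words_uniq/upto_uniq. Qed.

Lemma bsuppE i j x : bsupp i j x <-> forall ws, ws \notin bw i j -> x ws = 0.
Proof.
split=> H ws.
  rewrite mem_bw; apply: contraNeq => /H[-> -> ->]; by rewrite !eqxx.
move=> hx; have : ws \in bw i j by apply: contraR hx => /H ->.
by rewrite mem_bw => /and3P[/eqP -> -> /eqP ->].
Qed.

Lemma sum_ord_iota n (G : nat -> F) :
  \sum_(l < n) (if (0 < l)%N then G l else 0) = \sum_(l <- [seq l <- iota 0 n | (0 < l)%N]) G l.
Proof. by rewrite big_filter -big_mkcond -(big_mkord (fun l => 0 < l)%N) /index_iota subn0. Qed.

(* For fixed [k], splitting the [k]-th word of a list is inverse to merging two words. *)
Lemma bard_adjoint i j y (h : BT) :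
  \sum_(ws <- bw i.+1 j) y ws * dlt cat h ws = \sum_(ws <- bw i j) bard y ws * h ws.
Proof.
pose spl k l (ws : seq (seq E)) :=
  take k ws ++ take l (nth [::] ws k) :: drop l (nth [::] ws k) :: drop k.+1 ws.
have splE p w r l : spl (size p) l (p ++ w :: r) = p ++ take l w :: drop l w :: r.
  rewrite /spl nth_cat ltnn subnn /= take_size_cat //; congr (_ ++ _ :: _ :: _).
  by rewrite -cat_rcons drop_size_cat // size_rcons.
pose ls n := [seq l <- iota 0 n | (0 < l)%N].
have mem_ls n l : (l \in ls n) = (0 < l < n)%N by rewrite mem_filter mem_iota add0n.
transitivity (\sum_(k < i) \sum_(ws <- bw i.+1 j) (-1) ^+ k.+1 * (y ws * h (merge cat k ws))).
  rewrite exchange_big; apply: eq_big_seq => ws; rewrite mem_bw => /and3P[/eqP sw _ _].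
  rewrite /dlt sw mulr_sumr; apply: eq_bigr => k _; ring.
transitivity (\sum_(k < i) \sum_(ws <- bw i j) \sum_(l <- ls (size (nth [::] ws k)))
    (-1) ^+ k.+1 * (y (spl k l ws) * h ws)); last first.
  rewrite exchange_big; apply: eq_big_seq => ws; rewrite mem_bw => /and3P[/eqP sw _ _].
  rewrite /Defs.bard sw mulr_suml; apply: eq_bigr => k _.
  rewrite (sum_ord_iota (size (nth [::] ws k)) (fun l => (-1) ^+ k.+1 * y (spl k l ws))).
  by rewrite mulr_suml; apply: eq_bigr => l _; rewrite mulrA.
apply: eq_bigr => k _; have ki := ltn_ord k.
pose P := [seq spl k l ws | ws <- bw i j, l <- ls (size (nth [::] ws k))].
have dec ws : ws \in bw i j -> exists p w r, ws = p ++ w :: r /\ size p = k.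
  by rewrite mem_bw => /and3P[/eqP sw _ _]; apply: split_at; rewrite sw.
have pe : perm_eq (bw i.+1 j) P.
  apply: uniq_perm; first exact: bw_uniq.
    apply: allpairs_uniq_dep; [exact: bw_uniq | by move=> ws _; apply/filter_uniq/iota_uniq |].
    move=> [ws l] [ws' l'] /allpairsPdep[u [n [hu hn [-> ->]]]] /allpairsPdep[u' [n' [hu' hn' [-> ->]]]] /=.
    have [p [w [r [eu sp]]]] := dec _ hu; have [p' [w' [r' [eu' sp']]]] := dec _ hu'; subst u u'.
    rewrite -{1}sp -{1}sp' !splE => /eqP; rewrite eqseq_cat ?sp ?sp' // => /andP[/eqP -> /eqP[e1 e2 ->]].
    have ew : w = w' by rewrite -(cat_take_drop n w) -(cat_take_drop n' w') e1 e2.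
    move: hn hn'; rewrite -{1}sp -{1}sp' !nth_cat !ltnn !subnn /= !mem_ls => /andP[_ hl] /andP[_ hl'].
    have := congr1 size e1; rewrite !size_takel ?(ltnW hl) ?(ltnW hl') // => ->.
    by rewrite ew.
  move=> ws; apply/idP/allpairsPdep => [|[u [n [hu hn ->]]]].
    move=> hws; have [p [a [b [r [e sp]]]]] : exists p a b r, ws = p ++ a :: b :: r /\ size p = k.
      by move: hws; rewrite mem_bw => /and3P[/eqP sw _ _]; apply: split_at2; rewrite sw.
    subst ws; move: hws; rewrite mem_bw size_cat map_cat sumn_cat all_cat /=.
    case/and3P=> /eqP h1 /and4P[h2 ha hb h3] h4.
    exists (p ++ (a ++ b) :: r), (size a); split.
    + rewrite mem_bw size_cat map_cat sumn_cat all_cat /= size_cat h2 h3 andbT.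
      rewrite -addnA h4 andbT; apply/andP; split; first by move: h1; lia.
      by case: (a) ha.
    + rewrite -sp nth_cat ltnn subnn /= mem_ls size_cat.
      by case: (a) (b) ha hb => [|? ?] [|? ?] //= _ _; lia.
    + by rewrite -sp splE take_size_cat // drop_size_cat.
  have [p [w [r [e sp]]]] := dec _ hu; subst u.
  move: hu hn; rewrite -sp splE nth_cat ltnn subnn /= mem_ls.
  rewrite !mem_bw !size_cat !map_cat !sumn_cat !all_cat /= => /and3P[h1 /and3P[h2 h3 h4] h5] /andP[n0 nw].
  rewrite h2 h4 andbT size_takel ?(ltnW nw) // size_drop; apply/and3P; split.
  + by move: h1 => /eqP h1; apply/eqP; lia.
  + by rewrite -!size_eq0 size_takel ?(ltnW nw) // size_drop -!lt0n subn_gt0 n0.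
  + by move/eqP: h5 => <-; apply/eqP; lia.
rewrite (perm_big _ pe) /= big_allpairs_dep; apply: eq_big_seq => ws hws.
have [p [w [r [e sp]]]] := dec _ hws; apply: eq_big_seq => l _; congr (_ * (_ * h _)).
by rewrite e -sp splE merge_cat cat_take_drop.
Qed.

Lemma bard_supp i j y : bsupp i.+1 j y -> bsupp i j (bard y).
Proof.
move=> /bsuppE H; apply/bsuppE => ws hws; rewrite /Defs.bard.
apply: big1 => k _; apply: big1 => l _; case: ifP => // l0; rewrite H ?mulr0 //.
apply: contra hws; move: (nat_of_ord l) (ltn_ord l) l0 (ltn_ord k) => {l} l lw l0 kw.
have [p [w [r [e sp]]]] := split_at kw; subst ws; move: lw; rewrite -sp {kw sp}.
have dr : drop (size p).+1 (p ++ w :: r) = r by rewrite -cat_rcons drop_size_cat ?size_rcons.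
rewrite nth_cat ltnn subnn /= take_size_cat // dr => lw.
rewrite !mem_bw !size_cat !map_cat !sumn_cat !all_cat /= => /and3P[/eqP h1 /and4P[h2 h3 h4 h5] /eqP h6].
apply/and3P; split.
+ by apply/eqP; move: h1; lia.
+ by rewrite h2 h5 andbT /= -size_eq0; case: (size w) lw => [|n]; rewrite ?ltn0.
+ by apply/eqP; move: h6; rewrite size_takel ?(ltnW lw) // size_drop; move: lw; lia.
Qed.

Lemma ptens_cat us (r : seq E -> F) vs w :
  ptens (map mono us ++ r :: map mono vs) (us ++ w :: vs) = r w.
Proof.
rewrite /ptens !size_cat /= !size_map eqxx.
elim: us => [|u us IH] /=; last first.
  by rewrite big_ord_recl /= /Defs.mono eqxx mul1r -[RHS]IH.
rewrite add0n big_ord_recl /= big1 ?mulr1 // => k _ /=.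
by rewrite (nth_map [::]) ?ltn_ord // /Defs.mono eqxx.
Qed.

Lemma ptens_neq us (r : seq E -> F) vs ws : (forall w, ws <> us ++ w :: vs) ->
  ptens (map mono us ++ r :: map mono vs) ws = 0.
Proof.
move=> H; rewrite /ptens size_cat /= !size_map; case: eqP => // sw.
have [p [w [q [e sp]]]] : exists p w q, ws = p ++ w :: q /\ size p = size us.
  by apply: split_at; rewrite sw addnS ltnS leq_addr.
have sq : size q = size vs by move: sw; rewrite e size_cat /= sp !addnS => -[/addnI].
have : p != us \/ q != vs.
  case: (eqVneq p us) => [ep|]; [right | by left]; apply/eqP => eq.
  by apply: (H w); rewrite e ep eq.
have nthneq (a b : seq (seq E)) : size a = size b -> a != b ->
    exists2 k, (k < size b)%N & nth [::] a k != nth [::] b k.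
  move=> sab nab; apply: NNPP => nH; case/eqP: nab; apply: (eq_from_nth (x0 := [::])) => // k hk.
  by apply/eqP; apply/negPn/negP => nk; apply: nH; exists k; rewrite -?sab.
case=> [/(nthneq _ _ sp)|/(nthneq _ _ sq)] [k hk nk].
  have hk' : (k < size ws)%N by rewrite sw; apply: leq_trans hk (leq_addr _ _).
  have ek : nth [::] ws k = nth [::] p k by rewrite e nth_cat sp hk.
  rewrite (bigD1 (Ordinal hk')) //= nth_cat size_map hk (nth_map [::]) // /Defs.mono.
  by rewrite ek (negbTE nk) mul0r.
have hk' : (size us + k.+1 < size ws)%N by rewrite sw ltn_add2l.
have ek : nth [::] ws (size us + k.+1) = nth [::] q k.
  by rewrite e nth_cat sp ltnNge leq_addr /= addKn.
rewrite (bigD1 (Ordinal hk')) //= nth_cat size_map ltnNge leq_addr /= addKn /= (nth_map [::]) //.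
by rewrite /Defs.mono ek (negbTE nk) mul0r.
Qed.

(** In a generator of [Nbar] only the word in the slot of [r] varies, and the fibre sums of [r]
    vanish. *)
Lemma Nbar_pair i j z f : Nbar z -> \sum_(ws <- bw i j) z ws * f (map cls ws) = 0.
Proof.
elim=> [|h [us [vs [r [hus hvs Kr ->]]]]|h h' _ IH _ IH'|c h _ IH].
- by rewrite big1 // => ws _; rewrite mul0r.
- pose d := (j - (sumn (map size us) + sumn (map size vs)))%N.
  pose C w := us ++ w :: vs.
  rewrite (eq_big_seq (fun ws => \sum_(w <- words (enum E) d | ws == C w) r w * f (map cls ws))) => [|ws hws].
    rewrite (exchange_big_dep xpredT) //=.
    rewrite (eq_big_seq (fun w => r w * (if C w \in bw i j then f (map cls (C w)) else 0))) => [|w _].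
      apply: (class_sum0 (kap := cls)) => [a b|m].
        rewrite !mem_words_enum /C !mem_bw !map_cat !size_cat !all_cat /= => /eqP sa /eqP sb ->.
        by rewrite -!size_eq0 sa sb.
      case: (eqVneq d (deg m)) => [->|dm].
        exact: csum_of_Kker.
      rewrite big_seq_cond big1 // => t; rewrite mem_words_enum => /andP[/eqP st /eqP et].
      by move: dm; rewrite -et deg_cls st eqxx.
    case: ifP => hC; last first.
      rewrite mulr0 big_seq_cond big1 // => ws /andP[hws /eqP ews].
      by move: hC; rewrite -ews hws.
    rewrite -big_filter (eq_filter (a2 := pred1 (C w))) => [|ws //].
    by rewrite filter_pred1_uniq ?bw_uniq // big_seq1.
  case: (classic (exists w, ws = C w)) => [[w ew]|nw]; last first.
    rewrite ptens_neq ?mul0r; last by move=> w ew; apply: nw; exists w.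
    by rewrite big1 // => w /eqP ew; case: nw; exists w.
  rewrite {1}ew ptens_cat.
  rewrite -big_filter (eq_filter (a2 := pred1 w)) => [|w' /=]; last first.
    by rewrite ew /C eqseq_cat // eqxx /= eqseq_cons eqxx andbT eq_sym.
  rewrite filter_pred1_uniq ?words_uniq ?enum_uniq ?big_seq1 // mem_words_enum.
  rewrite /d; move: hws; rewrite ew mem_bw map_cat sumn_cat /= => /and3P[_ _ /eqP <-].
  by rewrite addnCA addnK.
- by under eq_bigr => ws _ do rewrite mulrDl; rewrite big_split /= IH IH' addr0.
- by under eq_bigr => ws _ do rewrite -mulrA; rewrite -mulr_sumr IH mulr0.
Qed.

Lemma Nbar_subspace : subspace Nbar. Proof. exact: inspan_subspace. Qed.

Lemma Nbar_delta p ws ws' : all (fun w => w != [::]) (p ++ ws) -> all (fun w => w != [::]) ws' ->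
  map cls ws = map cls ws' -> Nbar (fun v => delta F (p ++ ws) v - delta F (p ++ ws') v).
Proof.
have [N0 ND _] := Nbar_subspace.
elim: ws ws' p => [|w ws IH] [|w' ws'] // p.
  move=> _ _ _; rewrite (_ : (fun v => _) = fun=> 0) //.
  by apply: functional_extensionality => v; rewrite subrr.
rewrite all_cat /= => /and3P[hp hw hws] /andP[hw' hws'] [ew ews].
rewrite (_ : (fun v => _) = fun v => (delta F (p ++ w :: ws) v - delta F (p ++ w' :: ws) v) +
   (delta F (rcons p w' ++ ws) v - delta F (rcons p w' ++ ws') v)); last first.
  by apply: functional_extensionality => v; rewrite !cat_rcons addrA subrK.
apply: ND; last by apply: IH => //; rewrite all_cat all_rcons hw' hp.
apply: inspan_gen; exists p, ws, (fun v => mono w v - mono w' v); split=> //.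
  exact: Kker_mono.
apply: functional_extensionality => v.
case: (classic (exists u, v = p ++ u :: ws)) => [[u ->]|nu]; last first.
  rewrite ptens_neq; last by move=> u e; apply: nu; exists u.
  rewrite /delta; case: eqP => [e|_]; first by case: nu; exists w.
  by case: eqP => [e|_]; [case: nu; exists w' | rewrite subrr].
rewrite ptens_cat /delta /Defs.mono !eqseq_cat // !eqxx !eqseq_cons !eqxx !andbT //.
Qed.

(** With [Nbar_pair], this identifies [Nbar] in each bidegree with the annihilator of the functions
    of classes. *)
Lemma Nbar_of_pair i j z : bsupp i j z ->
  (forall f, \sum_(ws <- bw i j) z ws * f (map cls ws) = 0) -> Nbar z.
Proof.
move=> /bsuppE hz H.
apply: (subspace_classes (kap := map cls) (s := bw i j) Nbar_subspace) => //.
- exact: bw_uniq.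
- move=> a b; rewrite !mem_bw => /and3P[_ ha _] /and3P[_ hb _] e _.
  exact: (Nbar_delta (p := [::])).
- move=> k; rewrite -[RHS](H (fun k' => (k' == k)%:R)) big_mkcond.
  by apply: eq_bigr => ws _; case: ifP; rewrite ?mulr1 ?mulr0.
Qed.

Definition vl (i j : nat) (ms : seq K) : bool :=
  [&& size ms == i, all (fun m => normal m && (m != [::])) ms & sumn (map deg ms) == j].

(** Vanishing of Ext in bidegree [(i, j)], the dual of [torvan]. *)
Definition extvan (i j : nat) : Prop := forall f,
  (forall ms, vl i.+1 j ms -> dlt nmul f ms = 0) ->
  exists g, forall ms, vl i j ms -> f ms = dlt nmul g ms.

Lemma cls_surj m : normal m -> exists w, cls w = m.
Proof.
elim: m => [|[b l] m IH] /=; first by exists [::].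
case/and3P=> /andP[/= l0 lb] h /IH[w hw].
have [s hs ss] := ppath_ex lb.
exists (s ++ w); rewrite cls_cat // (cls_ppath hs) hw.
by move: h l0; case: s hs ss => [|e s] _ <- //= h _; rewrite ncons_nhcov.
Qed.

Lemma vl_cls i j ws : ws \in bw i j -> vl i j (map cls ws).
Proof.
rewrite mem_bw /vl size_map all_map -map_comp => /and3P[-> h ht] /=; apply/andP; split.
  apply: sub_all h => w hw /=; rewrite cls_normal //=.
  by rewrite cls_eq_nil.
by move: ht; congr (sumn _ == j); apply: eq_map => w /=; rewrite deg_cls.
Qed.

Lemma vl_surj i j ms : vl i j ms -> exists2 ws, ws \in bw i j & ms = map cls ws.
Proof.
rewrite /vl; elim: ms i j => [|m ms IH] i j /=.
  by case/andP=> /eqP <- /eqP <-; exists [::]; rewrite ?mem_bw.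
case: i => [//|i] /and3P[si /andP[/andP[nm m0] hms] /eqP <-].
have [|ws hws ems] := IH i (sumn (map deg ms)); first by rewrite -eqSS si hms eqxx.
have [w hw] := cls_surj nm; exists (w :: ws); last by rewrite /= hw ems.
move: hws; rewrite !mem_bw /= eqSS => /and3P[-> -> /eqP ->] /=.
by rewrite -hw deg_cls eqxx !andbT -cls_eq_nil hw.
Qed.

Lemma bw_merge i j ws k : ws \in bw i.+1 j -> (k < i)%N -> merge cat k ws \in bw i j.
Proof.
move=> hws ki; have [p [a [b [r [e sp]]]]] : exists p a b r, ws = p ++ a :: b :: r /\ size p = k.
  by move: hws; rewrite mem_bw => /and3P[/eqP sw _ _]; apply: split_at2; rewrite sw.
subst ws k; rewrite merge_cat; move: hws.
rewrite !mem_bw !size_cat !map_cat !sumn_cat !all_cat /= size_cat.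
move=> /and3P[/eqP h1 /and4P[-> h3 h4 ->] /eqP h6]; rewrite andbT; apply/and3P; split.
+ by apply/eqP; move: h1; lia.
+ by case: (a) h3.
+ by rewrite -addnA; apply/eqP.
Qed.

Definition cl (i j : nat) : seq (seq K) := undup (map (map cls) (bw i j)).

Definition Mx (k : nat) ws (ms : seq K) : F :=
  \sum_(l < k) (-1) ^+ l.+1 * (map cls (merge cat l ws) == ms)%:R.

Lemma sum_Mx i j ws f : ws \in bw i.+1 j ->
  \sum_(ms <- cl i j) Mx i ws ms * f ms = dlt nmul f (map cls ws).
Proof.
move=> hws; under eq_bigr => ms _ do rewrite /Mx mulr_suml.
rewrite exchange_big /= -(dlt_map (op := cat) (op' := nmul) _ _ cls_cat).
rewrite /dlt; have -> : (size ws).-1 = i by move: hws; rewrite mem_bw => /and3P[/eqP ->].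
apply: eq_bigr => l _; have hm := bw_merge hws (ltn_ord l).
rewrite (bigD1_seq (map cls (merge cat l ws))) ?undup_uniq ?mem_undup ?map_f //=.
by rewrite eqxx mulr1 big1 ?addr0 // => ms /negbTE; rewrite eq_sym => ->; rewrite mulr0 mul0r.
Qed.

Lemma sum_cl i j x f : \sum_(ms <- cl i j) (\sum_(ws <- bw i j | map cls ws == ms) x ws) * f ms =
  \sum_(ws <- bw i j) x ws * f (map cls ws).
Proof.
under eq_bigr => ms _ do rewrite mulr_suml.
rewrite (exchange_big_dep xpredT) //=; apply: eq_big_seq => ws hws.
rewrite -big_filter (eq_filter (a2 := pred1 (map cls ws))) => [|ms]; last by rewrite /= eq_sym.
by rewrite filter_pred1_uniq ?undup_uniq ?mem_undup ?map_f // big_seq1.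
Qed.

Lemma pair_adjoint i j y f :
  \sum_(ws <- bw i j) bard y ws * f (map cls ws) = \sum_(ws <- bw i.+1 j) y ws * dlt nmul f (map cls ws).
Proof.
rewrite -(bard_adjoint i j y (fun ws => f (map cls ws))); apply: eq_bigr => ws _.
by rewrite (dlt_map (op' := nmul)) // => a b; apply: cls_cat.
Qed.

(** Duality over a field for complexes with finite-dimensional components; each direction is one use
    of [fredholm] with the matrix [Mx]. *)
Lemma torvan_extvan i j : torvan F lt star i.+1 j <-> extvan i.+1 j.
Proof.
split=> [tv f hf|ev x hx Nx].
  have [|u hu] := @fredholm F _ _ (cl i j) (bw i.+1 j) (fun ms ws => Mx i ws ms) (fun ws => f (map cls ws))
    (undup_uniq _) (bw_uniq _ _).
    (* A vector killed by the matrix is a cycle modulo [Nbar], hence a boundary, and the cocycle [f]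
       vanishes on boundaries. *)
    move=> w hw; pose x ws := if ws \in bw i.+1 j then w ws else 0.
    have hx : bsupp i.+1 j x by apply/bsuppE => ws; rewrite /x => /negbTE ->.
    have ex (G : BT) : \sum_(ws <- bw i.+1 j) x ws * G ws = \sum_(ws <- bw i.+1 j) w ws * G ws.
      by apply: eq_big_seq => ws hws; rewrite /x hws.
    have Nx : Nbar (bard x).
      apply: (Nbar_of_pair (bard_supp hx)) => g; rewrite pair_adjoint ex.
      rewrite (eq_big_seq (fun ws => \sum_(ms <- cl i j) g ms * (Mx i ws ms * w ws))) => [|ws hws].
        rewrite exchange_big big_seq big1 //= => ms hms.
        by rewrite -mulr_sumr hw ?mulr0.
      by rewrite -(sum_Mx g hws) mulr_sumr; apply: eq_bigr => ms _; ring.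
    have [y [hy Ny]] := tv x hx Nx.
    have := Nbar_pair i.+1 j f Ny; under eq_bigr => ws _ do rewrite mulrBl.
    rewrite sumrB pair_adjoint ex.
    rewrite [X in _ - X](_ : _ = 0) ?subr0 => [e|]; last first.
      by rewrite big_seq big1 // => ws hws; rewrite hf ?mulr0 // vl_cls.
    by rewrite -[RHS]e; apply: eq_bigr => ws _; rewrite mulrC.
  exists u => ms /vl_surj[ws hws ->]; rewrite hu // -(sum_Mx u hws).
  by apply: eq_bigr => ms' _; rewrite mulrC.
pose v ms := \sum_(ws <- bw i.+1 j | map cls ws == ms) x ws.
(* A function killed by the matrix is a cocycle, hence some [dlt nmul g], and its pairing with [x]
   is that of [g] with [bard x], which is 0. *)
have [|u hu] := @fredholm F _ _ (bw i.+2 j) (cl i.+1 j) (fun ws ms => Mx i.+1 ws ms) v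
    (bw_uniq _ _) (undup_uniq _).
  move=> f hf; rewrite sum_cl.
  have [|g hg] := ev f; first by move=> ms /vl_surj[ws hws ->]; rewrite -(sum_Mx f hws) hf.
  rewrite (eq_big_seq (fun ws => x ws * dlt nmul g (map cls ws))) => [|ws hws].
    by rewrite -pair_adjoint; apply: Nbar_pair.
  by rewrite hg // vl_cls.
pose y ws := if ws \in bw i.+2 j then u ws else 0.
have hy : bsupp i.+2 j y by apply/bsuppE => ws; rewrite /y => /negbTE ->.
exists y; split=> //; apply: (@Nbar_of_pair i.+1 j) => [|f].
  move/bsuppE: hx => hx; move/bard_supp/bsuppE: hy => hy.
  by apply/bsuppE => ws hws; rewrite hx // hy // subr0.
under eq_bigr => ws _ do rewrite mulrBl.
rewrite sumrB pair_adjoint -(sum_cl _ _ x f).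
rewrite (eq_big_seq (fun ms => (\sum_(ws <- bw i.+2 j) u ws * Mx i.+1 ws ms) * f ms)) => [|ms hms].
  apply/eqP; rewrite subr_eq0; apply/eqP.
  under eq_bigr => ms _ do rewrite mulr_suml.
  rewrite exchange_big; apply: eq_big_seq => ws hws; rewrite /y hws -(sum_Mx f hws) mulr_sumr.
  by apply: eq_bigr => ms _; rewrite mulrA.
by rewrite -hu.
Qed.

End Bar.

(** * Reduction to lists of blocks *)

Section Blocks.

Implicit Types (f g : seq K -> F) (p q : seq blk) (u v : blk) (m : K) (ms r : seq K).

Definition sg u : K := [:: u].
Definition covb u v : bool := cov u.1 u.2 v.1.
Definition bm u v : blk := (u.1, u.2 + v.2)%N.
Definition len p : nat := sumn (map snd p).

Lemma nmul_sg u v : covb u v -> nmul (sg u) (sg v) = sg (bm u v).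
Proof. by case: u v => [b l] [c k]; rewrite /covb /= => ->. Qed.

Lemma ncons_head b l m : exists l' m', ncons b l m = (b, l') :: m'.
Proof.
elim: m l => [|[c k] m IH] l /=; first by exists l, [::].
by case: ifP => _ //; exists l, ((c, k) :: m).
Qed.

Lemma path_merge k x p : path covb x p -> path covb x (merge bm k p).
Proof.
elim: k x p => [|k IH] x [|a p] //=; last by case/andP=> -> h; apply: IH.
case: p => [|b p] //= /and3P[xa ab]; rewrite -[covb x _]/(covb x a) xa /=.
by case: p => //= c p /andP[bc ->]; rewrite andbT; apply: cov_trans ab bc.
Qed.

Lemma linked_merge k p : sorted covb p -> sorted covb (merge bm k p).
Proof.
case: k p => [|k] [|a p] //=; last exact: path_merge.
case: p => //= b p /andP[ab]; case: p => //= c p /andP[bc ->]; rewrite andbT.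
by apply: cov_trans ab bc.
Qed.

Lemma len_merge k p : len (merge bm k p) = len p.
Proof. by rewrite /len; elim: k p => [|k IH] [|a [|b p]] //=; rewrite ?IH //= addnA. Qed.

Lemma merge_linked k q ms : (k.+1 < size q)%N -> sorted covb q ->
  merge nmul k (map sg q ++ ms) = map sg (merge bm k q) ++ ms.
Proof.
move=> /split_at2[p [a [b [r [-> <-]]]]].
rewrite merge_cat !map_cat /= -!catA /= => h.
rewrite -(size_map sg p) merge_cat nmul_sg //.
move: h; rewrite -[a :: _]/([:: a] ++ b :: r) -[p ++ _]/(p ++ _).
by case: p => [|c p] /=; rewrite ?cat_path /= => /andP[] // _ /and3P[].
Qed.

Lemma merge_sg k q : (k.+1 < size q)%N -> sorted covb q ->
  merge nmul k (map sg q) = map sg (merge bm k q).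
Proof. by move=> h1 h2; have := merge_linked [::] h1 h2; rewrite !cats0. Qed.

Lemma merge_catr (A : Type) (op : A -> A -> A) k (s t : seq A) :
  merge op (size s + k) (s ++ t) = s ++ merge op k t.
Proof. by elim: s => //= a s ->. Qed.

Definition isD ms := exists2 p, ms = map sg p & sorted covb p.

(* [isB] and [isA] are the two ways in which a list first fails to consist of merging blocks;
   gluing [sg u] to [v :: m] matches them.  The length of the part before the failure is the
   measure for the inductions below. *)
Inductive isB ms (mu : nat) : Prop := IsB p u v m r of
  ms = map sg (rcons p u) ++ (v :: m) :: r & sorted covb (rcons p u) & ~~ covb u v & len p = mu.

Inductive isA ms (mu : nat) : Prop := IsA p u v m r of
  ms = map sg p ++ (u :: v :: m) :: r & sorted covb (rcons p u) & (mu <= len p)%N.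

Definition good mu ms := [\/ isD ms, exists nu, isB ms nu | isA ms mu].

Lemma len_rcons p u : len (rcons p u) = (len p + u.2)%N.
Proof. by rewrite /len map_rcons -cats1 sumn_cat /= addn0. Qed.

(** The list is scanned from the left; [q] is the part already read, so a failure of type [isA]
    found later has measure at least [len q]. *)
Lemma classify q ms : all (fun m => m != [::]) ms ->
  sorted covb (if ms is (v :: _) :: _ then rcons q v else q) -> good (len q) (map sg q ++ ms).
Proof.
elim: ms q => [|[|u [|v m]] ms IH] q //=.
- by move=> _ h; constructor 1; exists q; rewrite ?cats0.
- case: ms IH => [_ _ h|[|v m] ms IH] //=.
    by constructor 1; exists (rcons q u); rewrite // map_rcons -cats1.
  move=> hms h; case: (boolP (covb u v)) => uv; last first.
    constructor 2; exists (len q); exists q u v m ms => //.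
    by rewrite map_rcons cat_rcons.
  have h2 : sorted covb (rcons (rcons q u) v).
    by case: q h {IH} => [|c q] /=; rewrite ?andbT // !rcons_path last_rcons => ->.
  have := IH (rcons q u) hms h2; rewrite map_rcons cat_rcons len_rcons.
  case=> [?|?|[p w x y r ? ? e]]; [by constructor 1 | by constructor 2 | constructor 3].
  by exists p w x y r => //; lia.
- by move=> _ h; constructor 3; exists q u v m ms.
Qed.

Lemma vl_merge i j ms k : vl i.+1 j ms -> (k < i)%N -> vl i j (merge nmul k ms).
Proof.
case/and3P=> /eqP sm hms /eqP tm ki.
have [p [a [b [r [e sp]]]]] : exists (p : seq K) a b r, ms = p ++ a :: b :: r /\ size p = k.
  by apply: split_at2; rewrite sm.
subst ms k; rewrite merge_cat; move: hms sm tm; rewrite /vl !all_cat !size_cat !map_cat !sumn_cat /=.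
case/and4P=> -> /andP[na a0] /andP[nb b0] -> sm tm; rewrite andbT /=; apply/and3P; split.
- by apply/eqP; lia.
- by rewrite nmul_normal // nmul_neq0.
- by rewrite deg_nmul -addnA tm.
Qed.

(** A merge to the right of [u] keeps the head of the next word, hence the failure. A merge to the
    left keeps total length; if the new last block reaches [v], the scan goes on beyond [u] and the
    measure grows. *)
Lemma beta_merge p u v m r k mu : sorted covb (rcons p u) -> ~~ covb u v -> len p = mu ->
  (0 < u.2)%N -> all (fun m => m != [::]) r ->
  (k.+1 < (size p + 2 + size r))%N -> k != size p ->
  good mu.+1 (merge nmul k (map sg (rcons p u) ++ (v :: m) :: r)).
Proof.
move=> h uv lp u0 hr hk kp; case: (ltnP k (size p)) => kp'.
  rewrite merge_linked ?size_rcons //.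
  have := linked_merge k h; have := len_merge k (rcons p u).
  have : (0 < size (merge bm k (rcons p u)))%N by rewrite size_merge size_rcons //; apply: leq_ltn_trans kp'.
  case/lastP: (merge bm k (rcons p u)) => // q w _ lq hq.
  case: (boolP (covb w v)) => wv; last first.
    by constructor 2; exists (len q); exists q w v m r.
  have := @classify (rcons q w) ((v :: m) :: r) hr.
  rewrite lq len_rcons lp; case=> [|?|?|[p' a b c d e1 e2 e3]].
  - by case: (q) hq => [|c q'] /=; rewrite ?andbT // !rcons_path last_rcons => ->.
  - by constructor 1.
  - by constructor 2.
  - by constructor 3; exists p' a b c d => //; lia.
constructor 2; exists (len p).
have -> : k = (size (map sg (rcons p u)) + (k - (size p).+1))%N.
  by rewrite size_map size_rcons subnKC // ltn_neqAle eq_sym kp.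
rewrite merge_catr.
have [v' [m' [r' [-> ev]]]] : exists v' m' r', merge nmul (k - (size p).+1) ((v :: m) :: r) = (v' :: m') :: r' /\ v'.1 = v.1.
  case: (k - (size p).+1)%N => [|n] /=; last by exists v, m, (merge nmul n r).
  case: (r) => [|m2 r2]; first by exists v, m, [::].
  have [l' [m' ->]] := ncons_head v.1 v.2 (nmul m m2).
  by exists (v.1, l'), m', r2.
by exists p u v' m' r' => //; rewrite /covb ev.
Qed.

(** Contracting homotopy: at a list of type [isA], the signed value of [f] after the first block of
    the failing word is split off; 0 at types [isB] and [isD]. *)
Fixpoint hom f ms : F :=
  match ms with
  | (u :: m) :: ms' =>
    match m with
    | v :: m' => - f (sg u :: m :: ms')
    | [::] => if ms' is (v :: _) :: _ then
                if covb u v then - hom (fun l => f (sg u :: l)) ms' else 0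
              else 0
    end
  | _ => 0
  end.

Lemma hom_step u v m ms f : covb u v ->
  hom f (sg u :: (v :: m) :: ms) = - hom (fun l => f (sg u :: l)) ((v :: m) :: ms).
Proof. by move=> uv; rewrite {1}/hom -/hom /sg uv. Qed.

Lemma hom_alpha p u v m r f : sorted covb (rcons p u) ->
  hom f (map sg p ++ (u :: v :: m) :: r) =
  (-1) ^+ (size p).+1 * f (map sg p ++ sg u :: (v :: m) :: r).
Proof.
elim: p f => [|a p IH] f; first by rewrite /= expr1 mulN1r.
case: p IH => [|b p] IH.
  by case/andP=> au _; rewrite /= au opprK expr2 mulN1r opprK mul1r.
move=> h; have /andP[ab h'] : covb a b && path covb b (rcons p u) by [].
transitivity (- hom (fun l => f (sg a :: l)) (map sg (b :: p) ++ (u :: v :: m) :: r)).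
    exact: hom_step.
  by rewrite (IH _ h') [in RHS]exprS mulN1r mulNr.
Qed.

Lemma hom_beta p u v m r f : sorted covb (rcons p u) -> ~~ covb u v ->
  hom f (map sg (rcons p u) ++ (v :: m) :: r) = 0.
Proof.
elim: p f => [|a p IH] f; first by rewrite /= => _ /negbTE ->.
case: p IH => [|b p] IH h uv.
  by move: h; rewrite /= andbT => ->; rewrite (negbTE uv) oppr0.
have /andP[ab h'] : covb a b && path covb b (rcons p u) by [].
transitivity (- hom (fun l => f (sg a :: l)) (map sg (rcons (b :: p) u) ++ (v :: m) :: r)).
    exact: hom_step.
  by rewrite (IH _ h') // oppr0.
Qed.

Lemma hom_D p f : sorted covb p -> hom f (map sg p) = 0.
Proof.
elim: p f => [|a [|b p] IH] f // h; have /andP[ab {}h] : covb a b && path covb b p by [].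
transitivity (- hom (fun l => f (sg a :: l)) (map sg (b :: p))); first exact: hom_step.
by rewrite IH // oppr0.
Qed.

Lemma hom_good mu ms f : good mu ms ->
  (forall p u v m r, ms = map sg p ++ (u :: v :: m) :: r -> sorted covb (rcons p u) ->
     (mu <= len p)%N -> f (map sg p ++ sg u :: (v :: m) :: r) = 0) -> hom f ms = 0.
Proof.
case=> [[p -> h] _|[nu [p u v m r -> h uv _]] _|[p u v m r -> h hl] H].
- exact: hom_D.
- exact: hom_beta.
- by rewrite hom_alpha // (H p u v m r) // mulr0.
Qed.

Definition Dp (i j : nat) p : bool :=
  [&& size p == i, sorted covb p, all valid p & len p == j].

Lemma normal_sg u : normal (sg u) = valid u. Proof. by rewrite /= !andbT. Qed.

Lemma sumn_deg_sg p : sumn (map deg (map sg p)) = len p.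
Proof. by rewrite /len -map_comp; congr sumn; apply: eq_map => u; rewrite /= /deg /= addn0. Qed.

Lemma vl_sg i j p : sorted covb p -> vl i j (map sg p) = Dp i j p.
Proof.
move=> h; rewrite /vl /Dp size_map h /=; congr andb; congr andb.
  by rewrite all_map; apply: eq_all => u; rewrite /= !andbT.
by rewrite sumn_deg_sg.
Qed.

Lemma alpha_split i j p u v m r : vl i j (map sg p ++ (u :: v :: m) :: r) ->
  [/\ vl i.+1 j (map sg p ++ sg u :: (v :: m) :: r), (0 < u.2)%N, ~~ covb u v,
      all (fun m => m != [::]) r & (size p + 1 + size r = i)%N].
Proof.
case/and3P; rewrite size_cat map_cat sumn_cat all_cat size_map => /eqP si /andP[hp /andP[hu hr]] /eqP hj.
have {hu}/andP[/and3P[vu uv nv] _] := hu.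
have h2 : all (fun m => m != [::]) r by apply: sub_all hr => x /andP[].
split=> //; last 1 first.
- by rewrite -si /=; lia.
- apply/and3P; rewrite size_cat map_cat sumn_cat all_cat size_map; split.
  + by rewrite -si /=; apply/eqP; lia.
  + have vs : normal (sg u) && (sg u != [::]) by rewrite normal_sg vu.
    have vm : normal (v :: m) && (v :: m != [::]) by rewrite andbT.
    by rewrite hp andTb; exact: (introT and3P (And3 vs vm hr)).
  + by rewrite -hj /= /deg /=; apply/eqP; lia.
- by case/andP: vu.
- by move: uv; rewrite /covb; case: (v).
Qed.

Lemma beta_vl i j p u v m r : vl i j (map sg (rcons p u) ++ (v :: m) :: r) ->
  [/\ (0 < u.2)%N, all (fun m => m != [::]) r & (size p + 2 + size r = i)%N].
Proof.
case/and3P; rewrite size_cat all_cat size_map size_rcons map_rcons all_rcons normal_sg.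
move=> /eqP si /andP[/andP[/andP[vu _] _] /andP[_ hr]] _; split.
- by case/andP: vu.
- by apply: sub_all hr => x /andP[].
- by rewrite -si /=; lia.
Qed.

Lemma dlt_beta i j p u v m r f : sorted covb (rcons p u) -> ~~ covb u v ->
  vl i.+1 j (map sg (rcons p u) ++ (v :: m) :: r) ->
  (forall ms, vl i j ms -> good (len p).+1 ms -> f ms = 0) ->
  dlt nmul f (map sg (rcons p u) ++ (v :: m) :: r) =
    (-1) ^+ (size p).+1 * f (map sg p ++ (u :: v :: m) :: r).
Proof.
move=> h uv hv H; have [u0 hr si] := beta_vl hv.
have sz : (size (map sg (rcons p u) ++ (v :: m) :: r)).-1 = i.
  by case/and3P: hv => /eqP ->.
rewrite /dlt sz; have pi : (size p < i)%N by rewrite -ltnS -si; lia.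
rewrite (bigD1 (Ordinal pi)) //= big1 ?addr0 => [|k nk].
  congr (_ * f _); rewrite map_rcons cat_rcons.
  have -> : merge nmul (size p) (map sg p ++ sg u :: (v :: m) :: r) =
      map sg p ++ nmul (sg u) (v :: m) :: r by rewrite -{1}(size_map sg p) merge_cat.
  by case: (u) (v) uv => [b l] [c k]; rewrite /covb /= => /negbTE ->.
rewrite H ?mulr0 //; first by apply: vl_merge.
apply: beta_merge => //; rewrite si ltnS //.
Qed.

Section Acyclic.
Variables (i j : nat).

(** Triangularity: gluing at the failure returns [f] itself, the two signs cancelling. The other
    merges lead to lists where [hom f] is 0 or is a value of [f] of larger measure, which vanishes
    by assumption. *)
Lemma acyclic_step f t :
  (forall p, Dp i.+1 j p -> f (map sg p) = 0) ->
  (forall p u v m r, sorted covb (rcons p u) -> ~~ covb u v -> (t < len p)%N ->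
     vl i.+1 j (map sg (rcons p u) ++ (v :: m) :: r) ->
     f (map sg (rcons p u) ++ (v :: m) :: r) = 0) ->
  (forall p u v m r, sorted covb (rcons p u) -> ~~ covb u v -> (t <= len p)%N ->
     vl i.+1 j (map sg (rcons p u) ++ (v :: m) :: r) ->
     f (map sg (rcons p u) ++ (v :: m) :: r) =
     dlt nmul (hom f) (map sg (rcons p u) ++ (v :: m) :: r)).
Proof.
move=> fD fB p u v m r h uv tp hv; rewrite (dlt_beta h uv hv) => [|ms hms gm].
  rewrite hom_alpha // mulrA -exprD addnn -signr_odd odd_double expr0 mul1r.
  by rewrite map_rcons cat_rcons.
apply: hom_good gm _ => p' u' v' m' r' e h' hl; subst ms.
have [hv' _ uv' _ _] := alpha_split hms.
have := fB p' u' v' m' r' h' uv'; rewrite map_rcons cat_rcons; apply => //.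
by apply: leq_trans hl; rewrite ltnS.
Qed.

(** First [g] is built so that [f] and [dlt nmul g] agree on lists of type [isB]. The difference is
    a cocycle, and its cocycle identity at the lists of type [isB] one degree higher kills it on
    type [isA]. *)
Lemma acyclic f :
  (forall p, Dp i.+1 j p -> f (map sg p) = 0) ->
  (forall ms, vl i.+2 j ms -> dlt nmul f ms = 0) ->
  exists2 g, (forall p, sorted covb p -> g (map sg p) = 0) &
    forall ms, vl i.+1 j ms -> f ms = dlt nmul g ms.
Proof.
move=> fD fC.
have [g gD gB] : exists2 g, (forall p, sorted covb p -> g (map sg p) = 0) &
    (forall p u v m r, sorted covb (rcons p u) -> ~~ covb u v ->
     vl i.+1 j (map sg (rcons p u) ++ (v :: m) :: r) ->
     f (map sg (rcons p u) ++ (v :: m) :: r) = dlt nmul g (map sg (rcons p u) ++ (v :: m) :: r)).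
  suff /(_ 0%N)[g gD gB] : forall t, exists2 g, (forall p, sorted covb p -> g (map sg p) = 0) &
      (forall p u v m r, sorted covb (rcons p u) -> ~~ covb u v -> (t <= len p)%N ->
       vl i.+1 j (map sg (rcons p u) ++ (v :: m) :: r) ->
       f (map sg (rcons p u) ++ (v :: m) :: r) = dlt nmul g (map sg (rcons p u) ++ (v :: m) :: r)).
    by exists g => // *; apply: gB.
  move=> t; move en : (j.+1 - t)%N => n; elim: n t en => [|n IH] t en.
    (* For [t > j] there is nothing to match, as [len p] is at most the total degree [j]. *)
    exists (fun=> 0) => // p u v m r _ _ tp /and3P[_ _ /eqP].
    rewrite map_cat sumn_cat sumn_deg_sg len_rcons => hj.
    by exfalso; move: hj tp en => /= hj tp en; lia.
  have [g gD gB] := IH t.+1 ltac:(lia).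
  pose f' ms := f ms - dlt nmul g ms.
  have dgD p : Dp i.+1 j p -> dlt nmul g (map sg p) = 0.
    move=> h; have /and4P[/eqP sp lp _ _] := h.
    rewrite /dlt size_map sp big1 // => k _.
    rewrite merge_sg ?sp ?ltnS //.
    by rewrite gD ?mulr0 //; apply: linked_merge.
  (* This is [g + hom f'], in a form to which [dltB] and [dltN] apply. *)
  exists (fun ms => g ms - - hom f' ms) => [p hp|p u v m r h uv tp hv].
    by rewrite gD // hom_D // opprK addr0.
  rewrite dltB dltN opprK -(@acyclic_step f' t) // /f'.
  - by rewrite addrC subrK.
  - by move=> q hq; rewrite fD // dgD // subrr.
  - by move=> p' u' v' m' r' h' uv' tp' hv'; rewrite gB ?subrr.
exists g => // ms hms; apply/eqP; rewrite -subr_eq0; apply/eqP.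
pose f' ms := f ms - dlt nmul g ms; rewrite -/(f' ms).
have f'D p : Dp i.+1 j p -> f' (map sg p) = 0.
  move=> h; have /and4P[/eqP sp lp _ _] := h.
  rewrite /f' fD // sub0r /dlt size_map sp big1 ?oppr0 // => k _.
  rewrite merge_sg ?sp ?ltnS //.
  by rewrite gD ?mulr0 //; apply: linked_merge.
have f'B ms' nu : vl i.+1 j ms' -> isB ms' nu -> f' ms' = 0.
  by move=> hv [p u v m r e h uv _]; subst ms'; rewrite /f' gB ?subrr.
have f'C ms' : vl i.+2 j ms' -> dlt nmul f' ms' = 0.
  by move=> hv; rewrite dltB fC // (dlt_dlt _ _ nmulA) subrr.
(* Decreasing induction on the measure: by [dlt_beta], [dlt nmul f'] at the split list is, up to
   sign, the value at the unsplit list. *)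
have main t : forall ms, vl i.+1 j ms -> good t ms -> f' ms = 0.
  move en : (j.+1 - t)%N => n; elim: n t en => [|n IH] t en ms' hv [[p e h]|[nu hB]|[p u v m r e h tp]].
  - by subst ms'; apply: f'D; rewrite -vl_sg.
  - exact: f'B hB.
  - exfalso; subst ms'; case/and3P: hv => _ _ /eqP; rewrite map_cat sumn_cat sumn_deg_sg => hj.
    by move: hj tp en => /= hj tp en; lia.
  - by subst ms'; apply: f'D; rewrite -vl_sg.
  - exact: f'B hB.
  subst ms'; have [hv' u0 uv hr si] := alpha_split hv.
  have ec : map sg p ++ sg u :: (v :: m) :: r = map sg (rcons p u) ++ (v :: m) :: r.
    by rewrite map_rcons cat_rcons.
  rewrite ec in hv'; have := f'C _ hv'; rewrite (dlt_beta h uv hv') => [|ms' hms' gm].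
    by move/eqP; rewrite mulf_eq0 signr_eq0 => /eqP.
  apply: (IH t.+1) hms' _; first by lia.
  case: gm => [?|?|[p' u' v' m' r' e' h' hl]]; [by constructor 1 | by constructor 2 | constructor 3].
  by exists p' u' v' m' r' => //; apply: leq_trans hl.
apply: (main 0%N) => //.
have hn : all (fun m => m != [::]) ms by case/and3P: hms => _ h _; apply: sub_all h => x /andP[].
apply: (@classify [::]) hn _; by case: (ms) => [|[]].
Qed.

End Acyclic.

Definition dext (i j : nat) : Prop := forall f : seq blk -> F,
  (forall p, Dp i.+1 j p -> dlt bm f p = 0) ->
  exists g0 : seq blk -> F, forall p, Dp i j p -> f p = dlt bm g0 p.

Lemma dlt_sg i j f p : Dp i j p -> dlt nmul f (map sg p) = dlt bm (fun q => f (map sg q)) p.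
Proof.
case/and4P=> _ lp _ _; rewrite /dlt size_map; apply: eq_bigr => k _; congr (_ * f _).
rewrite merge_sg //.
by move: (nat_of_ord k) (ltn_ord k) => n; case: (size p).
Qed.

Definition unsg (ms : seq K) : seq blk := flatten ms.
Lemma unsgK p : unsg (map sg p) = p.
Proof. by rewrite /unsg; elim: p => //= a p ->. Qed.

(** Restriction of cochains to lists of single merging blocks is surjective with acyclic kernel.
    Extension goes through [unsg], and [acyclic] corrects the extension of a cocycle to a
    cocycle. *)
Lemma extvan_dext i j : extvan i.+1 j <-> dext i.+1 j.
Proof.
split=> [ev f hf|dv f hf].
  pose f0 ms := f (unsg ms).
  have f0E p : f0 (map sg p) = f p by rewrite /f0 unsgK.
  have ext q : (fun q => f0 (map sg q)) = f by apply: functional_extensionality.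
  have dD p : Dp i.+2 j p -> dlt nmul f0 (map sg p) = 0.
    by move=> h; rewrite (dlt_sg _ h) ext // hf.
  have [g gD hg] := acyclic dD (fun ms _ => dlt_dlt (F := F) f0 ms nmulA).
  have [ms hms|k hk] := ev (fun ms => f0 ms - g ms).
    by rewrite dltB hg // subrr.
  exists (fun q => k (map sg q)) => p hp; rewrite -(dlt_sg _ hp) -hk; last first.
    by rewrite vl_sg //; case/and4P: hp.
  by rewrite gD ?subr0 ?f0E //; case/and4P: hp.
have [p hp|g hg] := dv (fun p => f (map sg p)).
  by rewrite -(dlt_sg _ hp) hf // vl_sg //; case/and4P: hp.
pose g0 ms := g (unsg ms).
have ext : (fun q => g0 (map sg q)) = g.
  by apply: functional_extensionality => q; rewrite /g0 unsgK.
have [p hp|ms hms|h _ hh] := @acyclic i j (fun ms => f ms - dlt nmul g0 ms).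
- by rewrite (dlt_sg _ hp) ext -hg // subrr.
- by rewrite dltB hf // (dlt_dlt _ _ nmulA) subrr.
exists (fun ms => g0 ms - - h ms) => ms hms.
by rewrite dltB dltN opprK -hh // addrC subrK.
Qed.

End Blocks.

(** * Cohomology of truncated lower intervals *)

Section DescendingChains.

Implicit Types (s t : seq T) (p : seq blk) (f g : seq T -> F) (x y z : T).

Definition gt : rel T := fun x y => lt y x.

Lemma gt_trans : transitive gt. Proof. by move=> y x z h1 h2; apply: lt_tr h1. Qed.

Lemma gt_irr : irreflexive gt. Proof. by move=> x; apply: lt_irr. Qed.

Fixpoint del (k : nat) s : seq T :=
  match s, k with [::], _ => [::] | _ :: r, 0 => r | a :: r, k'.+1 => a :: del k' r end.

Definition dls f s : F := \sum_(k < size s) (-1) ^+ k * f (del k s).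

Lemma size_del k s : (k < size s)%N -> size (del k s) = (size s).-1.
Proof. by elim: s k => [|a s IH] [|k] //= h; rewrite IH //; case: (size s) h. Qed.

Lemma del_subseq k s : subseq (del k s) s.
Proof.
elim: s k => [|a s IH] [|k] //=; first exact: subseq_cons.
by rewrite eqxx.
Qed.

Lemma dls_cons f a s : dls f (a :: s) = f s - dls (fun t => f (a :: t)) s.
Proof.
rewrite /dls big_ord_recl mul1r; congr (_ + _); rewrite -sumrN; apply: eq_bigr => k _.
by rewrite /= /bump /= exprS mulN1r mulNr.
Qed.

Lemma dls_nil f : dls f [::] = 0. Proof. by rewrite /dls big_ord0. Qed.

Lemma dls_rcons f s y :
  dls f (rcons s y) = dls (fun t => f (rcons t y)) s + (-1) ^+ size s * f s.
Proof.
elim: s f => [|a s IH] f; first by rewrite dls_cons !dls_nil /= mul1r subr0 add0r.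
by rewrite /= !dls_cons IH exprS; ring.
Qed.

Lemma eq_dls f g s : (forall k, (k < size s)%N -> f (del k s) = g (del k s)) -> dls f s = dls g s.
Proof. by move=> H; apply: eq_bigr => k _; rewrite H. Qed.

Lemma dlsD (c d : F) f g s : dls (fun t => c * f t + d * g t) s = c * dls f s + d * dls g s.
Proof.
by rewrite /dls !mulr_sumr -big_split; apply: eq_bigr => k _ /=; ring.
Qed.

Lemma dlsZ (c : F) f s : dls (fun t => c * f t) s = c * dls f s.
Proof. by rewrite /dls mulr_sumr; apply: eq_bigr => k _; ring. Qed.

Definition chains (P : pred T) (n : nat) s : bool := [&& size s == n, sorted gt s & all P s].

Lemma chains_del P n k s : (k < n.+1)%N -> chains P n.+1 s -> chains P n (del k s).
Proof.
move=> kn /and3P[/eqP sn ss sP]; apply/and3P; split.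
- by rewrite size_del ?sn.
- exact: (subseq_sorted gt_trans (del_subseq k s)).
- by apply/allP => y /(mem_subseq (del_subseq k s)); apply: (allP sP).
Qed.

Lemma chains_sub (P Q : pred T) n s : subpred P Q -> chains P n s -> chains Q n s.
Proof. by move=> PQ /and3P[h1 h2 h3]; apply/and3P; split=> //; apply: sub_all h3. Qed.

(* The reduced cohomology of the order complex of [P] vanishes in degree [n - 1]. *)
Definition chvan (P : pred T) (n : nat) : Prop := forall f,
  (forall s, chains P n.+1 s -> dls f s = 0) ->
  exists g, forall s, chains P n s -> f s = dls g s.

Lemma chvan_eq P Q n : P =1 Q -> chvan P n -> chvan Q n.
Proof.
move=> PQ H f hf; have e m s : chains P m s = chains Q m s by rewrite /chains (eq_all PQ).
by have [s|g hg] := H f; [rewrite e => /hf | exists g => s; rewrite -e => /hg].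
Qed.

Definition trunc x (j : nat) : pred T := fun y => lt y x && (rk x < rk y + j)%N.
Definition open_int x y : pred T := fun z => lt x z && lt z y.

Lemma chains_rcons P n s y : chains P n.+1 (rcons s y) ->
  chains (fun z => P z && lt y z) n s && P y.
Proof.
case/and3P; rewrite size_rcons all_rcons eqSS => sn ss /andP[Py sP]; rewrite Py andbT.
have h : pairwise gt (rcons s y) by rewrite -sorted_pairwise //; apply: gt_trans.
apply/and3P; split=> //.
  by move: ss; rewrite -cats1 => /cat_sorted2[].
move: h; rewrite -cats1 pairwise_cat allrel1r => /and3P[h _ _].
by rewrite (eq_all (a2 := predI P (gt^~ y))) // all_predI sP.
Qed.

Lemma chains_rcons_inv P n s y : chains (fun z => P z && lt y z) n s -> P y -> chains P n.+1 (rcons s y).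
Proof.
case/and3P=> sn ss sP Py; apply/and3P; split; rewrite ?size_rcons ?eqSS //.
  rewrite sorted_pairwise; last exact: gt_trans.
  rewrite -cats1 pairwise_cat allrel1r /= -sorted_pairwise ?ss; last exact: gt_trans.
  by rewrite ?andbT; apply: sub_all sP => z /andP[].
by rewrite all_rcons Py; apply: sub_all sP => z /andP[].
Qed.

Section LongExactSequence.
Variables (x : T) (j : nat).
Hypothesis j_gt0 : (0 < j)%N.

Lemma truncS y : trunc x j.+1 y = trunc x j y || (lt y x && (rk x == rk y + j)%N).
Proof. by rewrite /trunc -andb_orr addnS ltnS leq_eqVlt orbC. Qed.

Lemma trunc_below y z : lt y x -> rk x = (rk y + j)%N -> lt y z ->
  trunc x j.+1 z = open_int y x z /\ (lt z x -> trunc x j z).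
Proof.
move=> yx rx yz; have := rk_lt yz.
rewrite /trunc /open_int yz rx /= => h; split=> [|->]; first by case: (lt z x) => //=; lia.
by rewrite /=; lia.
Qed.

Lemma chains_level n s y : lt y x -> rk x = (rk y + j)%N ->
  chains (trunc x j.+1) n.+1 (rcons s y) = chains (open_int y x) n s.
Proof.
move=> yx rx; apply/idP/idP => [/chains_rcons/andP[h _]|h].
  by apply: chains_sub h => z /andP[h1 h2]; rewrite -(proj1 (trunc_below yx rx h2)).
apply: chains_rcons_inv; last by rewrite truncS yx rx eqxx orbT.
apply: chains_sub h => z zi; have /andP[yz _] := zi.
by rewrite yz (proj1 (trunc_below yx rx yz)) zi.
Qed.

Lemma open_trunc n s y : lt y x -> rk x = (rk y + j)%N ->
  chains (open_int y x) n s -> chains (trunc x j) n s.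
Proof.
move=> yx rx; apply: chains_sub => z /andP[yz zx].
exact: (proj2 (trunc_below yx rx yz)).
Qed.

Lemma trunc_last n s : chains (trunc x j.+1) n s ->
  chains (trunc x j) n s \/
  exists s' y, [/\ s = rcons s' y, lt y x & rk x = (rk y + j)%N].
Proof.
case/lastP: s => [|s y] hs; first by left; case/and3P: hs => h _ _; apply/and3P.
have := hs; case: n hs => [|n] hs; first by case/and3P; rewrite size_rcons.
case/chains_rcons/andP=> h; rewrite truncS; case/orP => [hy|/andP[yx /eqP rx]]; last by right; exists s, y.
left; apply: chains_rcons_inv => //; apply: chains_sub h => z /andP[/andP[zx h] yz].
rewrite yz andbT /trunc zx /=; have := rk_lt yz.
by case/andP: hy => _; lia.
Qed.

(** The equation tests whether a chain ends in the bottom level. On the empty chain [last] returns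
    [x], and the test fails because [j > 0]. *)
Lemma trunc_last_neq n s y : chains (trunc x j) n s -> (rk x == rk (last x s) + j)%N = false.
Proof.
case/lastP: s => [|s z]; first by move=> _ /=; apply/negbTE; lia.
by rewrite last_rcons => /and3P[_ _]; rewrite all_rcons => /andP[/andP[_ h] _]; apply/negbTE; lia.
Qed.

(* If [L] is the bottom level of [trunc x j.+1], the sequence
   [H^n(trunc x j.+1) -> H^n(trunc x j) -> sum_(y in L) H^n((y, x)) -> H^(n+1)(trunc x j.+1)]
   is exact, with [n] the number of elements of the chains; a cochain on [trunc x j] is extended
   to chains ending in [L] by primitives of its restrictions to the [(y, x)]. *)
Lemma chvan_truncate n : chvan (trunc x j.+1) n ->
  (forall y, lt y x -> rk x = (rk y + j)%N -> chvan (open_int y x) n) -> chvan (trunc x j) n.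
Proof.
move=> HP HL f hf.
have [G hG] : exists G : T -> seq T -> F, forall y, lt y x && (rk x == rk y + j)%N ->
    forall s, chains (open_int y x) n s -> f s = dls (G y) s.
  apply: (fin_all_exists (P := fun y Gy => lt y x && (rk x == rk y + j)%N ->
    forall s, chains (open_int y x) n s -> f s = dls Gy s)) => y.
  case: (boolP (lt y x && _)) => [/andP[yx /eqP rx]|_]; last by exists (fun=> 0).
  have [s hs|g hg] := HL y yx rx f; first by apply: hf; apply: open_trunc hs.
  by exists g.
(* Chosen so that at a chain [rcons s' y] the term [c * f s'], coming from the primitive, cancels
   the last term [(-1) ^+ n * f s']. *)
pose c : F := - (-1) ^+ n.
pose F0 s := if (rk x == rk (last x s) + j)%N then c * G (last x s) (take (size s).-1 s) else f s.
have F0Q m s : chains (trunc x j) m s -> F0 s = f s.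
  by move=> h; rewrite /F0 (trunc_last_neq x h).
have F0L s y : rk x = (rk y + j)%N -> F0 (rcons s y) = c * G y s.
  by move=> rx; rewrite /F0 last_rcons rx eqxx size_rcons /= -cats1 take_size_cat.
have [s hs|g hg] := HP F0; last first.
  exists g => s hs; rewrite -hg ?(F0Q _ _ hs) //.
  by apply: chains_sub hs => z hz; rewrite truncS hz.
have [hq|[s' [y [es yx rx]]]] := trunc_last hs.
  rewrite -(hf s hq); apply: eq_dls => k hk; apply: (F0Q n).
  by apply: chains_del => //; case/and3P: hq => /eqP <-.
move: hs; rewrite es chains_level // => hs.
have sn : size s' = n by case/and3P: hs => /eqP.
rewrite dls_rcons sn (F0Q _ _ (open_trunc yx rx hs)) (eq_dls (g := fun t => c * G y t)) => [|k hk].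
  by rewrite dlsZ -hG ?yx ?rx ?eqxx // /c mulNr addNr.
exact: F0L.
Qed.

(** Extend [f] to chains ending in [y], and by 0 to all others. A primitive [G] is then a cocycle on
    [trunc x j]; its own primitive [g0] there corrects [G (rcons t y)] to a primitive of [f]. *)
Lemma chvan_interval n y : lt y x -> rk x = (rk y + j)%N ->
  chvan (trunc x j) n -> chvan (trunc x j.+1) n.+1 -> chvan (open_int y x) n.
Proof.
move=> yx rx HQ HP f hf.
pose F0 s := if last x s == y then f (take (size s).-1 s) else 0.
have F0y s : F0 (rcons s y) = f s.
  by rewrite /F0 last_rcons eqxx size_rcons /= -cats1 take_size_cat.
have F0Q m s : chains (trunc x j) m s -> F0 s = 0.
  move=> h; rewrite /F0; case: eqP => // e.
  by have := trunc_last_neq x h; rewrite e rx eqxx.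
have F0n s z : z != y -> F0 (rcons s z) = 0 by move=> h; rewrite /F0 last_rcons (negbTE h).
have [s hs|G hG] := HP F0.
  have [hq|[s' [z [es zx rz]]]] := trunc_last hs.
    rewrite (eq_dls (g := fun=> 0)) => [|k hk].
      by rewrite /dls big1 // => k _; rewrite mulr0.
    apply: (F0Q n.+1); apply: chains_del => //; case/and3P: hq => /eqP <- //.
  move: hs; rewrite es chains_level // => hs; rewrite dls_rcons.
  rewrite (F0Q _ _ (open_trunc zx rz hs)) mulr0 addr0.
  case: (eqVneq z y) => [ezy|zy]; last first.
    rewrite (eq_dls (g := fun=> 0)) => [|k hk]; last exact: F0n.
    by rewrite /dls big1 // => k _; rewrite mulr0.
  by rewrite -(hf s'); [apply: eq_dls => k _; rewrite ezy F0y | rewrite -ezy].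
have [s hs|g0 hg0] := HQ G.
  rewrite -hG ?(F0Q _ _ hs) //; by apply: chains_sub hs => z hz; rewrite truncS hz.
exists (fun t => 1 * G (rcons t y) + (-1) ^+ n * g0 t) => s hs.
have sn : size s = n by case/and3P: hs => /eqP.
rewrite dlsD mul1r -hg0; last exact: open_trunc hs.
by rewrite -(F0y s) hG ?chains_level // dls_rcons sn.
Qed.

End LongExactSequence.

Lemma trunc_size x j n s : chains (trunc x j) n s -> (0 < j)%N -> (n < j)%N.
Proof.
move=> hs j0; case/and3P: hs => /eqP <- ss sP.
suff H t z : path gt z t -> all (trunc x j) (z :: t) -> (size t + rk x < rk z + j)%N.
  case: s ss sP => [|z t] //= ss sP.
  have := H t z ss sP; case/andP: sP => /andP[/rk_lt zx _] _; lia.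
elim: t z => [|y t IH] z /=; first by move=> _ /andP[/andP[_]].
case/andP=> /rk_lt yz ht /andP[_ hyt]; have := IH y ht hyt; lia.
Qed.

Lemma trunc_star x : trunc x (rk x) =1 open_int star x.
Proof.
move=> y; rewrite /trunc /open_int -{1}[rk x]add0n ltn_add2r andbC; congr andb.
rewrite lt0n rk_eq0.
have := star_ple y; rewrite /ple eq_sym.
by case: eqP => [<- _|_ /= ->]; rewrite ?lt_irr.
Qed.

Lemma open_trunc_size x y n s : lt y x -> chains (open_int y x) n s -> (n < rk x - rk y)%N.
Proof.
move=> yx hs; apply: (@trunc_size x (rk x - rk y)%N n s); last by have := rk_lt yx; lia.
apply: (@open_trunc x (rk x - rk y)%N) hs => //; have := rk_lt yx; lia.
Qed.

(** An interval [(y, x)] lies between the truncations of index [rk x - rk y] and its successor, or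
    is itself a truncation if [y = star]. Conversely, truncations are reached from [(star, x)] by
    removing one level at a time. *)
Lemma truncations_intervals :
  (forall x j n, (0 < j <= rk x)%N -> n != j.-1 -> chvan (trunc x j) n) <->
  (forall a b, lt a b -> forall n, n != (rk b - rk a).-1 -> chvan (open_int a b) n).
Proof.
split=> H.
  move=> y x yx n hn; have ryx := rk_lt yx; set j := (rk x - rk y)%N in hn.
  have rx : rk x = (rk y + j)%N by rewrite /j; lia.
  have j0 : (0 < j)%N by rewrite /j; lia.
  case: (eqVneq y star) => [ys|ys].
    apply: chvan_eq (H x (rk x) n _ _); rewrite ?ys; first exact: trunc_star.
      by lia.
    by move: hn; rewrite rx ys rk_star.
  have ry : (0 < rk y)%N by rewrite rk_gt0.
  case: (ltnP n j) => nj; last first.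
    by move=> f _; exists (fun=> 0) => s /(open_trunc_size yx); rewrite -/j ltnNge nj.
  apply: (@chvan_interval x j) => //; apply: H; rewrite ?rx; clear -j0 nj ry hn; lia.
move=> x j; move em : (rk x - j)%N => m; elim: m j em => [|m IH] j em n /andP[j0 jx] hn.
  have ej : j = rk x by lia.
  subst j; have sx : lt star x.
    have := star_ple x; rewrite /ple => /orP[/eqP e|//].
    by move: j0; rewrite -e rk_star.
  apply: (@chvan_eq (open_int star x)); first by move=> y; rewrite trunc_star.
  by apply: H => //; rewrite rk_star // subn0.
(* Chains here have fewer than [j] elements, and [n < j] keeps [n] away from the top degree [j] of
   the next truncation. *)
case: (ltnP n j) => nj; last first.
  by move=> f _; exists (fun=> 0) => s /trunc_size /(_ j0); rewrite ltnNge nj.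
apply: chvan_truncate => //; first by apply: IH; lia.
by move=> y yx rx; apply: H => //; rewrite rx addKn.
Qed.

(* The list of blocks of total length [j] with heads [x :: s]. *)
Fixpoint enc x (j : nat) s : seq blk :=
  if s is y :: s' then (x, rk x - rk y)%N :: enc y (j - (rk x - rk y)) s' else [:: (x, j)].

Definition tchain x j n s : bool := [&& size s == n, path gt x s & all (fun y => rk x < rk y + j)%N s].

Lemma tchainE x j n s : tchain x j n s = chains (trunc x j) n s.
Proof.
rewrite /tchain /chains path_sortedE; last exact: gt_trans.
have -> : all (trunc x j) s = all (gt x) s && all (fun y => rk x < rk y + j)%N s.
  by rewrite -all_predI; apply: eq_all.
by case: (all (gt x) s); rewrite ?andbF.
Qed.

Lemma enc_head x j s : exists l q, enc x j s = (x, l) :: q.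
Proof. by case: s => [|y s] /=; [exists j, [::] | eexists; eexists]. Qed.

Lemma size_enc x j s : size (enc x j s) = (size s).+1.
Proof. by elim: s x j => //= y s IH x j; rewrite IH. Qed.

(** The condition [rk x < rk y + j] says that a positive length remains for the blocks from [y]
    on. *)
Lemma enc_Dp x j n s : (0 < j <= rk x)%N -> tchain x j n s -> Dp n.+1 j (enc x j s).
Proof.
elim: s x j n => [|y s IH] x j [|n] hj //=.
  by move=> _; rewrite /Dp /= /valid /len /= hj addn0 eqxx.
case/and3P; rewrite eqSS /= => sn /andP[yx ps] /andP[hy hs].
have ryx := rk_lt yx.
have hj' : (0 < j - (rk x - rk y) <= rk y)%N by lia.
have ht : tchain y (j - (rk x - rk y)) n s.
  by apply/and3P; split=> //; apply: sub_all hs => z; lia.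
move: (IH y _ n hj' ht).
have [l [q e]] := enc_head y (j - (rk x - rk y)) s.
rewrite /Dp e /= /len /= !eqSS => /and4P[-> -> -> /eqP hl].
rewrite /covb /cov /= (yx : lt y x) /valid /=; apply/and3P; split; [by rewrite andbT; lia | by lia | by lia].
Qed.

Lemma Dp_enc n j p : Dp n.+1 j p -> exists x s, [/\ p = enc x j s, (0 < j <= rk x)%N & tchain x j n s].
Proof.
elim: p n j => [|[x d] p IH] n j; first by case/and4P.
case: p IH => [|[y e] p] IH.
  case/and4P; rewrite eqSS /len /= andbT addn0 => sn _ hv /eqP ej; subst d.
  by exists x, [::]; rewrite /tchain sn.
case: n => [|n]; case/and4P; rewrite eqSS // => sn /andP[xy sp] /andP[vx vp] /eqP hl.
have hD : Dp n.+1 (len ((y, e) :: p)) ((y, e) :: p) by apply/and4P.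
have [y' [s [ep hj hs]]] := IH _ _ hD.
have [l [q eq]] := enc_head y' (len ((y, e) :: p)) s.
have ey : y' = y by move: ep; rewrite eq => -[->].
subst y'; have ej : j = (d + len ((y, e) :: p))%N by rewrite -hl.
have rx := cov_rk xy; rewrite /= in rx; have yx := cov_lt xy; rewrite /= in yx.
case/andP: vx => /= d0 dx.
exists x, (y :: s); split=> /=.
- have ed : (rk x - rk y = d)%N by rewrite rx addKn.
  by rewrite ed ej addKn -ep.
- by move: hj; rewrite rx ej; lia.
case/and3P: hs => h1 h2 h3; apply/and3P; split=> /=; first by rewrite eqSS.
  by rewrite h2 andbT; exact: yx.
apply/andP; split; first by rewrite rx ej; lia.
by apply: sub_all h3 => z; rewrite rx ej; lia.
Qed.

Lemma enc_merge x j n s k : (k < n)%N -> tchain x j n s -> merge bm k (enc x j s) = enc x j (del k s).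
Proof.
elim: s x j n k => [|y s IH] x j [|n] k //= hk /and3P[]; rewrite eqSS /= => sn /andP[yx ps] /andP[hy hs].
have ryx := rk_lt yx.
case: k hk => [|k] hk /=; last first.
  by rewrite (IH _ _ n) //; apply/and3P; split=> //; apply: sub_all hs => z; lia.
case: s {IH sn} ps hs => [|z s] /=.
  by move=> _ _; rewrite /bm /= subnKC //; lia.
case/andP=> /rk_lt zy _ /andP[hz _]; rewrite /bm /=.
have -> : (rk x - rk y + (rk y - rk z) = rk x - rk z)%N by lia.
by have -> : (j - (rk x - rk y) - (rk y - rk z) = j - (rk x - rk z))%N by lia.
Qed.

Lemma dlt_enc x j n s (f : seq blk -> F) : tchain x j n s ->
  dlt bm f (enc x j s) = - dls (fun t => f (enc x j t)) s.
Proof.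
move=> hs; have /and3P[/eqP sn _ _] := hs.
rewrite /dlt size_enc /= /dls -sumrN sn; apply: eq_bigr => k _.
by rewrite (enc_merge _ hs) // exprS mulN1r mulNr.
Qed.

Definition dec (p : seq blk) : seq T := map fst (behead p).

Lemma encK x j s : dec (enc x j s) = s.
Proof.
elim: s x j => //= y s IH x j; have := IH y (j - (rk x - rk y))%N.
by have [l [q ->]] := enc_head y (j - (rk x - rk y)) s; rewrite /dec /= => ->.
Qed.

(** Merging never changes the first head, so the complex is a direct sum over [x]. The factor [-1]
    in the primitives is the sign in [dlt_enc]. *)
Lemma dext_chvan n j : dext n.+1 j <->
  (forall x, (0 < j <= rk x)%N -> chvan (trunc x j) n).
Proof.
split=> [dv x hj f hf|H f hf].
  pose F0 (p : seq blk) := if p is (y, _) :: _ then (if y == x then f (dec p) else 0) else 0.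
  have F0x s : F0 (enc x j s) = f s.
    by have [l [q e]] := enc_head x j s; rewrite /F0 e eqxx -e encK.
  have F0y y s : y != x -> F0 (enc y j s) = 0.
    by move=> yx; have [l [q e]] := enc_head y j s; rewrite /F0 e (negbTE yx).
  have [p /Dp_enc[y [s [-> hy hs]]]|G hG] := dv F0.
    rewrite (dlt_enc _ hs); case: (eqVneq y x) => [e|yx]; last first.
      rewrite (eq_dls (g := fun=> 0)) => [|k hk]; last exact: F0y.
      by rewrite /dls big1 ?oppr0 // => k _; rewrite mulr0.
    subst y; rewrite (eq_dls (g := f)) => [|k hk]; last exact: F0x.
    by rewrite hf ?oppr0 // -tchainE.
  exists (fun t => -1 * G (enc x j t)) => s; rewrite -tchainE => hs.
  by rewrite dlsZ mulN1r -(dlt_enc _ hs) -hG ?F0x //; apply: enc_Dp.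
have [g hg] : exists g : T -> seq T -> F, forall x, (0 < j <= rk x)%N ->
    forall s, tchain x j n s -> f (enc x j s) = dls (g x) s.
  apply: (fin_all_exists (P := fun x gx => (0 < j <= rk x)%N ->
    forall s, tchain x j n s -> f (enc x j s) = dls gx s)) => x.
  case: (boolP (0 < j <= rk x)%N) => hj; last by exists (fun=> 0).
  have [s|gx hgx] := H x hj (fun s => f (enc x j s)).
    rewrite -tchainE => hs; apply/eqP; rewrite -oppr_eq0; apply/eqP.
    by rewrite -(dlt_enc _ hs) hf //; apply: enc_Dp.
  by exists gx => _ s; rewrite tchainE => /hgx.
exists (fun p : seq blk => if p is (x, _) :: _ then -1 * g x (dec p) else 0).
move=> p /Dp_enc[x [s [-> hx hs]]]; rewrite (dlt_enc _ hs) (hg x) //.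
rewrite -[RHS]mulN1r -dlsZ; apply: eq_dls => k hk.
have [l [q e]] := enc_head x j (del k s); rewrite e -e encK; ring.
Qed.

Lemma torvan_0 j : j != 0%N -> torvan F lt star 0 j.
Proof.
move=> j0 x hx _; exists (fun=> 0); split=> [ws|]; first by rewrite eqxx.
rewrite (_ : (fun ws => _) = fun=> 0); first exact: inspan0.
apply: functional_extensionality => ws.
rewrite (_ : bard _ ws = 0) ?subr0; last first.
  by apply: big1 => k _; apply: big1 => l _; rewrite mulr0; case: ifP.
apply/eqP/negP => /negP /hx[/size0nil -> _ /= e].
by move: j0; rewrite -e.
Qed.

Lemma koszul_truncations : koszul F lt star <->
  (forall x j n, (0 < j <= rk x)%N -> n != j.-1 -> chvan (trunc x j) n).
Proof.
split=> [Ko x j n hj hn|H [|n] j ij].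
- have : torvan F lt star n.+1 j by apply: Ko; lia.
  move/torvan_extvan.
  by move/extvan_dext/dext_chvan; apply.
- by apply: torvan_0; rewrite eq_sym.
apply/torvan_extvan.
apply/extvan_dext/dext_chvan => x hj.
by apply: H => //; lia.
Qed.

(** * Chains as sets and as descending lists *)

Definition set_of s : {set T} := [set y in s].
(** Elements of a chain have distinct ranks, so sorting by rank restores the order of the chain. *)
Definition seq_of (C : {set T}) : seq T := sort (fun y z => rk z <= rk y)%N (enum C).

Lemma mem_seq_of C : seq_of C =i C.
Proof. by move=> y; rewrite mem_sort mem_enum. Qed.

Lemma set_ofK C : set_of (seq_of C) = C.
Proof. by apply/setP => y; rewrite inE mem_seq_of. Qed.

Lemma seq_of_sorted C : is_chain lt C -> sorted gt (seq_of C).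
Proof.
move/is_chainP => hC.
have hs : sorted (fun y z => rk z <= rk y)%N (seq_of C) by apply: sort_sorted => y z; apply: leq_total.
have us : uniq (seq_of C) by rewrite sort_uniq enum_uniq.
have sC : {subset seq_of C <= C} by move=> y; rewrite mem_seq_of.
case: (seq_of C) hs us sC => //= a s; elim: s a => //= b s IH a /andP[ab hs] /andP[nab us] sC.
rewrite IH // ?andbT; last by move=> y hy; apply: sC; rewrite inE hy orbT.
have aC : a \in C by apply: sC; rewrite inE eqxx.
have bC : b \in C by apply: sC; rewrite !inE eqxx orbT.
have nab' : a != b by move: nab; rewrite inE negb_or => /andP[].
case/orP: (hC _ _ aC bC) => /orP[/eqP e|//]; rewrite ?e ?eqxx // in nab'.
by move/rk_lt; rewrite ltnNge ab.
Qed.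

Lemma sorted_gt_chain s : sorted gt s -> is_chain lt (set_of s).
Proof.
rewrite sorted_pairwise; last exact: gt_trans.
move=> hs; apply/is_chainP => y z; rewrite !inE.
elim: s hs => //= a s IH /andP[/allP ha hs]; rewrite !inE.
case/orP=> [/eqP ->|hy] /orP[/eqP ->|hz].
- by rewrite /ple eqxx.
- by rewrite /ple (ha _ hz : lt z a) !orbT.
- by rewrite /ple (ha _ hy : lt y a) !orbT.
- exact: IH.
Qed.

Lemma seq_ofK s : sorted gt s -> seq_of (set_of s) = s.
Proof.
move=> hs; apply: (irr_sorted_eq gt_trans gt_irr) => //.
  exact/seq_of_sorted/sorted_gt_chain.
by move=> y; rewrite mem_seq_of inE.
Qed.

Lemma card_set_of s : sorted gt s -> #|set_of s| = size s.
Proof. by move=> hs; rewrite cardsE (card_uniqP (sorted_uniq gt_trans gt_irr hs)). Qed.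

Lemma chains_ochain a b n s : chains (open_int a b) n s -> ochain lt a b (set_of s) /\ #|set_of s| = n.
Proof.
case/and3P=> /eqP sn ss sP; rewrite card_set_of //; split=> //.
rewrite /ochain sorted_gt_chain //; apply/subsetP => y; rewrite !inE => hy.
exact: (allP sP).
Qed.

Lemma ochain_chains a b C : ochain lt a b C -> chains (open_int a b) #|C| (seq_of C).
Proof.
case/andP=> hC /subsetP sC; apply/and3P; split.
- by rewrite size_sort -cardE.
- exact: seq_of_sorted.
- by apply/allP => y; rewrite mem_seq_of => /sC; rewrite inE.
Qed.

(* [cobd] counts positions from the bottom of a chain, [dls] from the top: hence the global sign. *)
Lemma cobd_set_of (g : {set T} -> F) s : sorted gt s ->
  cobd lt g (set_of s) = (-1) ^+ (size s).-1 * dls (fun t => g (set_of t)) s.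
Proof.
elim: s g => [|a s IH] g hs.
  by rewrite dls_nil mulr0 /cobd big1 // => y; rewrite inE.
have ps : pairwise gt (a :: s) by rewrite -sorted_pairwise //; apply: gt_trans.
have /= /andP[/allP ha _] := ps.
have as' : a \notin s by apply/negP => /ha; rewrite /gt lt_irr.
have ss : sorted gt s by apply: path_sorted hs.
have es : set_of (a :: s) = a |: set_of s by apply/setP => y; rewrite !inE.
have aS : a \notin set_of s by rewrite inE.
rewrite /cobd es (big_setU1 _ aS) /= dls_cons mulrBr; congr (_ + _).
  have -> : [set u in a |: set_of s | lt u a] = set_of s.
    apply/setP => y; rewrite !inE; case: eqP => [->|_] /=; first by rewrite lt_irr (negbTE as').
    by case: (boolP (y \in s)) => //= /ha.
  by rewrite card_set_of // setU1K.
pose ga D := g (a |: D).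
have e2 : \sum_(y in set_of s) (-1) ^+ #|[set u in a |: set_of s | lt u y]| * g ((a |: set_of s) :\ y) =
    cobd lt ga (set_of s).
  apply: eq_bigr => y; rewrite inE => hy; have ay : lt y a := ha _ hy.
  have nya : a != y by apply: contraTneq ay => ->; rewrite lt_irr.
  congr ((-1) ^+ _ * g _).
    congr #|pred_of_set _|; apply/setP => u; rewrite !inE.
    by case: eqP => [->|] //=; rewrite (lt_asym ay) andbF.
  apply/setP => u; rewrite !inE; case: (eqVneq u a) => [->|_] //=.
  by rewrite nya.
rewrite e2 IH // -mulrN.
have -> : (fun t => ga (set_of t)) = fun t => g (set_of (a :: t)).
  by apply: functional_extensionality => t; rewrite /ga; congr g; apply/setP => y; rewrite !inE.
case: (s) => [|b r]; first by rewrite !dls_nil oppr0 !mulr0.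
by rewrite /= exprS; ring.
Qed.

Lemma hvan_chvan a b n : hvan F lt a b n <-> chvan (open_int a b) n.
Proof.
split=> [H f hf|H f hf].
  have [C hC cC|g hg] := H (fun C => f (seq_of C)).
    have hs := ochain_chains hC; rewrite cC in hs; have /and3P[_ ss _] := hs.
    rewrite -{1}(set_ofK C) cobd_set_of // (eq_dls (g := f)) ?hf ?mulr0 // => k hk.
    by rewrite seq_ofK //; apply: (subseq_sorted gt_trans (del_subseq _ _)).
  exists (fun t => (-1) ^+ n.-1 * g (set_of t)) => s hs.
  have [h1 h2] := chains_ochain hs; have /and3P[/eqP sn ss _] := hs.
  by rewrite dlsZ -[f s](congr1 f (seq_ofK ss)) hg // cobd_set_of // sn.
have [s hs|g hg] := H (fun s => f (set_of s)).
  have [h1 h2] := chains_ochain hs; have /and3P[_ ss _] := hs.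
  have := hf _ h1 h2; rewrite cobd_set_of // => /eqP.
  by rewrite mulf_eq0 signr_eq0 => /eqP.
exists (fun C => (-1) ^+ n.-1 * g (seq_of C)) => C hC cC.
have hs := ochain_chains hC; rewrite cC in hs; have /and3P[/eqP sn ss _] := hs.
rewrite -{2}(set_ofK C) cobd_set_of // sn dlsZ mulrA -exprD addnn -signr_odd odd_double mul1r.
rewrite -{1}(set_ofK C) hg //; apply: eq_dls => k hk.
by rewrite seq_ofK //; apply: (subseq_sorted gt_trans (del_subseq _ _)).
Qed.

Lemma long_chain a b : lt a b -> exists s, chains (open_int a b) (rk b - rk a).-1 s.
Proof.
elim/lt_wf_ind: b => b IH ab.
have [z bz /orP[/eqP az|az]] := lt_cover ab.
  by exists [::]; rewrite (covers_rk bz) az subSnn.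
have [s /and3P[sn ss sP]] := IH z (covers_lt bz) az; have raz := rk_lt az.
exists (z :: s); apply/and3P; split.
- by rewrite /= (eqP sn) (covers_rk bz); apply/eqP; lia.
- rewrite /= path_sortedE ?ss ?andbT; last exact: gt_trans.
  by apply: sub_all sP => y /andP[].
- rewrite /= {1}/open_int az (covers_lt bz) /=; apply: sub_all sP => y /andP[h1 h2].
  by rewrite /open_int h1 (lt_tr h2 (covers_lt bz)).
Qed.

Lemma dimplusE a b : lt a b -> dimplus lt a b = (rk b - rk a).-1.
Proof.
move=> ab; apply/eqP; rewrite eqn_leq; apply/andP; split.
  apply/bigmax_leqP => C /ochain_chains /(open_trunc_size ab); have := rk_lt ab; lia.
have [s /chains_ochain[h <-]] := long_chain ab.
exact: (@leq_bigmax_cond _ (ochain lt a b) (fun C => #|C|) _ h).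
Qed.

Lemma koszul_CM : koszul F lt star <-> cohen_macaulay F lt.
Proof.
rewrite koszul_truncations truncations_intervals; split=> H a b ab n.
  move=> nh; apply/eqP/negPn/negP; rewrite dimplusE // => hn; apply: nh.
  by apply/hvan_chvan; apply: H.
move=> hn; apply/hvan_chvan; apply: NNPP => nh.
by move: hn; rewrite -(dimplusE ab) -(H a b ab n nh) eqxx.
Qed.

End DescendingChains.

End SplittingAlgebra.

Theorem theorem1p2 (F : fieldType) (T : finType) (lt : rel T) (star : T) :
  irreflexive lt -> transitive lt ->
  minimal lt star -> (forall m, minimal lt m -> m = star) ->
  ranked lt star ->
  (quadratic F lt star <-> uniform lt star) /\
  (koszul F lt star <-> cohen_macaulay F lt).
Proof.
move=> lt_irr lt_tr star_min star_uniq lt_ranked; split; last exact: koszul_CM.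
by split; [apply: quadratic_uniform | apply: uniform_quadratic].
Qed.
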